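(* Assume $N,L\ge2$ and let $M\in\mathbb Z$. (i) The operators $E_i,F_i,K_i^{\pm1},D$ ($0\le i<N$) on $\mathcal F_M$ defined below satisfy the defining relations of $U_q(\widehat{\mathfrak{sl}}_N)$ and make $\mathcal F_M$ an integrable $U_q(\widehat{\mathfrak{sl}}_N)$-module; likewise the operators $\dot E_a,\dot F_a,\dot K_a^{\pm1},\dot D$ ($0\le a<L$) make $\mathcal F_M$ an integrable $U_q(\widehat{\mathfrak{sl}}_L)$-module. (ii) The resulting actions of $U'_q(\widehat{\mathfrak{sl}}_N)$ and $U'_q(\widehat{\mathfrak{sl}}_L)$ on $\mathcal F_M$ commute with each other.
   Context: Let $N,L\ge 2$ be integers, $q$ an indeterminate and $\mathbb K=\mathbb Q(q^{1/(2N)})$. Let $\mathbb K^L$ have basis $\mathfrak e_1,\dots,\mathfrak e_L$, $\mathbb K^N$ have basis $\mathfrak v_1,\dots,\mathfrak v_N$, and $V_{\mathrm{aff}}=\mathbb K[z^{\pm1}]\otimes\mathbb K^L\otimes\mathbb K^N$, with basis $z^m\mathfrak e_a\mathfrak v_\epsilon$. Identify $V_{\mathrm{aff}}^{\otimes n}=(\mathbb K[z^{\pm1}]\otimes\mathbb K^L)^{\otimes n}\otimes(\mathbb K^N)^{\otimes n}$, and $(\mathbb K[z^{\pm1}]\otimes\mathbb K^L)^{\otimes n}=\mathbb K[z_1^{\pm1},\dots,z_n^{\pm1}]\otimes(\mathbb K^L)^{\otimes n}$ via $z^{m_1}\mathfrak e_{a_1}\otimes\cdots\otimes z^{m_n}\mathfrak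 e_{a_n}\mapsto z_1^{m_1}\cdots z_n^{m_n}\otimes\mathfrak e_{a_1}\otimes\cdots\otimes\mathfrak e_{a_n}$. With $E_{a,b}$ the matrix units of $\mathbb K^L$ put $R(z_1,z_2)=(q^2z_1-z_2)\sum_{a}E_{a,a}\otimes E_{a,a}+q(z_1-z_2)\sum_{a\neq b}E_{a,a}\otimes E_{b,b}+z_1(q^2-1)\sum_{a<b}E_{a,b}\otimes E_{b,a}+z_2(q^2-1)\sum_{a>b}E_{a,b}\otimes E_{b,a}$, let $s$ be the operator exchanging the two tensor factors of $(\mathbb K[z^{\pm1}]\otimes\mathbb K^L)^{\otimes 2}$, and $\overset{c}{T}=\frac{z_1-q^2z_2}{z_1-z_2}\bigl(1-s\cdot\frac{R(z_1,z_2)}{q^2z_1-z_2}\bigr)-1$. Let $\overset{s}{T}$ on $(\mathbb K^N)^{\otimes 2}$ send $\mathfrak v_{\epsilon_1}\otimes\mathfrak v_{\epsilon_2}$ to $q^2\mathfrak v_{\epsilon_1}\otimes\mathfrak v_{\epsilon_2}$ if $\epsilon_1=\epsilon_2$, to $q\,\mathfrak v_{\epsilon_2}\otimes\mathfrak v_{\epsilon_1}$ if $\epsilon_1<\epsilon_2$, and to $q\,\mathfrak v_{\epsilon_2}\otimes\mathfrak v_{\epsilon_1}+(q^2-1)\mathfrak v_{\epsilon_1}\otimes\mathfrak v_{\epsilon_2}$ if $\epsilon_1>\epsilon_2$. For $1\le i<n$ let $\overset{c}{T}_i$, $\overset{s}{T}_i$ act in the $i$th and $(i+1)$st factors. The wedge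 product is $\wedge^nV_{\mathrm{aff}}=V_{\mathrm{aff}}^{\otimes n}/\sum_{i=1}^{n-1}\mathrm{Im}(\overset{c}{T}_i-\overset{s}{T}_i)$. Every $k\in\mathbb Z$ is written uniquely as $k=\bar k-N(\dot k+L\underline k)$ with $\bar k\in\{1,\dots,N\}$, $\dot k\in\{1,\dots,L\}$, $\underline k\in\mathbb Z$; $u_k=z^{\underline k}\mathfrak e_{\dot k}\mathfrak v_{\bar k}$; $u_{k_1}\wedge\cdots\wedge u_{k_n}$ is the image of $u_{k_1}\otimes\cdots\otimes u_{k_n}$; $v\wedge w$ denotes the image of the tensor product of lifts. Fock space: $\mathcal F_M$ is the inductive limit of $\wedge^nV_{\mathrm{aff}}$ along $v\mapsto v\wedge u_{M-n}$; the image of $v\in\wedge^nV_{\mathrm{aff}}$ is written $v\wedge u_{M-n}\wedge u_{M-n-1}\wedge\cdots$; the vacuum is $|M\rangle=u_M\wedge u_{M-1}\wedge\cdots$; for $v\in\wedge^nV_{\mathrm{aff}}$ and $u=w\wedge u_{M-n-r}\wedge\cdots\in\mathcal F_{M-n}$ ($w\in\wedge^rV_{\mathrm{aff}}$) put $v\wedge u=(v\wedge w)\wedge u_{M-n-r}\wedge\cdots\in\mathcal F_M$. Quantum affine algebras: for $M'\ge2$, $U_q(\widehat{\mathfrak{sl}}_{M'})$ is the $\mathbb K$-algebra with generators $E_i,F_i,K_i^{\pm1}$ ($0\le i<M'$) and $D$, and relations: the $K_i^{\pm1}$ and $D$ commute pairwise, $K_iK_i^{-1}=K_i^{-1}K_i=1$,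 $K_iE_j=q^{a_{ij}}E_jK_i$, $K_iF_j=q^{-a_{ij}}F_jK_i$, $[D,E_i]=\delta_{i,0}E_i$, $[D,F_i]=-\delta_{i,0}F_i$, $[E_i,F_j]=\delta_{ij}\frac{K_i-K_i^{-1}}{q-q^{-1}}$, and for $i\ne j$, $\sum_{k=0}^{1-a_{ij}}(-1)^k\begin{bmatrix}1-a_{ij}\\k\end{bmatrix}_qX_i^{1-a_{ij}-k}X_jX_i^k=0$ for $X=E,F$; here $a_{ij}=2\delta(i\equiv j)-\delta(i\equiv j+1)-\delta(i\equiv j-1)$ (congruences mod $M'$) and $[k]_q=\frac{q^k-q^{-k}}{q-q^{-1}}$, $q$-binomials as usual. $U'_q(\widehat{\mathfrak{sl}}_{M'})$ is the subalgebra generated by $E_i,F_i,K_i^{\pm1}$. The generators of $U_q(\widehat{\mathfrak{sl}}_L)$ are written with dots: $\dot E_a,\dot F_a,\dot K_a,\dot D$. $U_q(\widehat{\mathfrak{sl}}_N)$ acts on $V_{\mathrm{aff}}$ by $K_i(z^m\mathfrak e_a\mathfrak v_\epsilon)=q^{\delta_{\epsilon,i}-\delta_{\epsilon,i+1}}z^m\mathfrak e_a\mathfrak v_\epsilon$, $E_i(z^m\mathfrak e_a\mathfrak v_\epsilon)=\delta_{\epsilon,i+1}z^{m+\delta_{i,0}}\mathfrak e_a\mathfrak v_{\epsilon-1}$, $F_i(z^m\mathfrak e_a\mathfrak v_\epsilon)=\delta_{\epsilon,i}z^{m-\delta_{i,0}}\mathfrak e_a\mathfrak v_{\epsilon+1}$,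 $D(z^m\mathfrak e_a\mathfrak v_\epsilon)=mz^m\mathfrak e_a\mathfrak v_\epsilon$ (indices of $\mathfrak v$ and Kronecker deltas mod $N$); $U_q(\widehat{\mathfrak{sl}}_L)$ acts by $\dot K_a(z^m\mathfrak e_b\mathfrak v_\epsilon)=q^{\delta_{b,L-a+1}-\delta_{b,L-a}}z^m\mathfrak e_b\mathfrak v_\epsilon$, $\dot E_a(z^m\mathfrak e_b\mathfrak v_\epsilon)=\delta_{b,L-a}z^{m+\delta_{a,0}}\mathfrak e_{b+1}\mathfrak v_\epsilon$, $\dot F_a(z^m\mathfrak e_b\mathfrak v_\epsilon)=\delta_{b,L-a+1}z^{m-\delta_{a,0}}\mathfrak e_{b-1}\mathfrak v_\epsilon$, $\dot D(z^m\mathfrak e_b\mathfrak v_\epsilon)=mz^m\mathfrak e_b\mathfrak v_\epsilon$ (indices of $\mathfrak e$ and deltas mod $L$). $U_q(\widehat{\mathfrak{sl}}_N)$ acts on $V_{\mathrm{aff}}^{\otimes n}$ via the iterated coproduct $\Delta^+$: $\Delta^+(K_i)=K_i\otimes K_i$, $\Delta^+(E_i)=E_i\otimes K_i+1\otimes E_i$, $\Delta^+(F_i)=F_i\otimes1+K_i^{-1}\otimes F_i$, $\Delta^+(D)=D\otimes1+1\otimes D$; $U_q(\widehat{\mathfrak{sl}}_L)$ acts via the iterated coproduct $\Delta^-$: $\Delta^-(\dot K_a)=\dot K_a\otimes\dot K_a$, $\Delta^-(\dot E_a)=\dot E_a\otimes1+\dot K_a\otimes\dot E_a$, $\Delta^-(\dot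 F_a)=\dot F_a\otimes\dot K_a^{-1}+1\otimes\dot F_a$, $\Delta^-(\dot D)=\dot D\otimes1+1\otimes\dot D$. Both actions descend to $\wedge^nV_{\mathrm{aff}}$ (known). Operators on $\mathcal F_M$: every $w\in\mathcal F_M$ can be written $w=v\wedge|-NLm\rangle$ with $m$ large and $v\in\wedge^{M+NLm}V_{\mathrm{aff}}$. Let $\bar v_m=u_{-NLm}\wedge u_{-NLm-1}\wedge\cdots\wedge u_{-NL(m+1)+1}$ and write $|m\rangle\!\rangle:=|-NLm\rangle$. Set $D|m\rangle\!\rangle=\dot D|m\rangle\!\rangle=NL\frac{m(1-m)}2|m\rangle\!\rangle$, $K_i|m\rangle\!\rangle=q^{L\delta_{i,0}}|m\rangle\!\rangle$, $E_i|m\rangle\!\rangle=0$, $F_i|m\rangle\!\rangle=\delta_{i,0}F_0(\bar v_m)\wedge|-NL(m+1)\rangle$, $\dot K_a|m\rangle\!\rangle=q^{N\delta_{a,0}}|m\rangle\!\rangle$, $\dot E_a|m\rangle\!\rangle=0$, $\dot F_a|m\rangle\!\rangle=\delta_{a,0}q^{-N}\dot F_0(\bar v_m)\wedge|-NL(m+1)\rangle$; and for $w=v\wedge|m\rangle\!\rangle$: $D(w)=D(v)\wedge|m\rangle\!\rangle+v\wedge D|m\rangle\!\rangle$, $K_i(w)=K_i(v)\wedge K_i|m\rangle\!\rangle$, $E_i(w)=E_i(v)\wedge K_i|m\rangle\!\rangle$, $F_i(w)=F_i(v)\wedge|m\rangle\!\rangle+K_i^{-1}(v)\wedge F_i|m\rangle\!\rangle$,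 $\dot D(w)=\dot D(v)\wedge|m\rangle\!\rangle+v\wedge\dot D|m\rangle\!\rangle$, $\dot K_a(w)=\dot K_a(v)\wedge\dot K_a|m\rangle\!\rangle$, $\dot E_a(w)=\dot E_a(v)\wedge|m\rangle\!\rangle$, $\dot F_a(w)=\dot F_a(v)\wedge\dot K_a^{-1}|m\rangle\!\rangle+v\wedge\dot F_a|m\rangle\!\rangle$. These operators are well defined (independent of the presentation). A module is integrable if the $E_i,F_i$ act locally nilpotently and it is a direct sum of weight spaces. *)

(* Defs.v *)
From HB Require Import structures.
From mathcomp Require Import all_boot all_order all_algebra.
From Stdlib Require List.
Unset Printing Implicit Defensive.
Import Order.TTheory GRing.Theory Num.Theory.
Local Open Scope ring_scope.

(* The base field K = Q(t), t = q^(1/(2N)) an indeterminate; q := t^(2N).   *)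
Definition Kf : fieldType := {fraction {poly rat}}.
Definition tK (p : {poly rat}) : Kf := FracField.tofrac p.
Definition qq (N : nat) : Kf := (tK 'X) ^+ (2 * N).

(* Integer encoding of the basis u_k of V_aff                              *)
(*  k = bar k - N (dot k + L under k), bar k in 1..N, dot k in 1..L        *)
Definition ind (b : bool) : int := if b then 1 else 0.
Definition modrep (n x : int) : int := ((x - 1) %% n)%Z + 1.
Definition eqmod (n x y : int) : bool := ((x - y) %% n)%Z == 0.
Definition kbar (N : nat) (k : int) : int := modrep N%:Z k.
Definition kdot (N L : nat) (k : int) : int :=
  modrep L%:Z ((kbar N k - k) %/ N%:Z)%Z.
Definition kund (N L : nat) (k : int) : int :=
  ((((kbar N k - k) %/ N%:Z)%Z - kdot N L k) %/ L%:Z)%Z.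
(* index of u with z^m e_a v_e *)
Definition enc (N L : nat) (m a e : int) : int := e - N%:Z * (a + L%:Z * m).

(* Formal linear combinations of pure tensors u_{k_1} (x) ... (x) u_{k_n}   *)
(* (a pure tensor is the list [k_1; ...; k_n]).                             *)
Definition Tens := seq (Kf * seq int).
Definition scaleT (c : Kf) (v : Tens) : Tens := [seq (c * p.1, p.2) | p <- v].
Definition consT (x : int) (v : Tens) : Tens := [seq (p.1, x :: p.2) | p <- v].
Definition prependT (w : seq int) (v : Tens) : Tens := [seq (p.1, w ++ p.2) | p <- v].
Definition coefT (v : Tens) (s : seq int) : Kf := \sum_(p <- v | p.2 == s) p.1.
Definition subT (v w : Tens) : Tens := v ++ scaleT (-1) w.
Definition linop (f : seq int -> Tens) (v : Tens) : Tens :=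
  flatten [seq scaleT p.1 (f p.2) | p <- v].

(* Two-site rational functions: K(z1,z2) (x) K^L (x) K^L (x) K^N (x) K^N    *)
Definition Fr : fieldType := {fraction {poly {poly Kf}}}.
Definition tof (p : {poly {poly Kf}}) : Fr := FracField.tofrac p.
Definition cst (c : Kf) : Fr := tof (c%:P%:P).
Definition z1 : Fr := tof 'X.
Definition z2 : Fr := tof ('X%:P).
Definition swF (x : Fr) : Fr :=
  let r := repr x in tof (swapXY (frac r).1) / tof (swapXY (frac r).2).

(* (K(z1,z2) (x) K^L (x) K^L)-valued: coefficient of e_{b1+1} (x) e_{b2+1} *)
Definition Rop (N L : nat) (P : 'I_L -> 'I_L -> Fr) (b1 b2 : 'I_L) : Fr :=
  let q := cst (qq N) in
    (\sum_(a : 'I_L) if (b1 == a) && (b2 == a) then (q ^+ 2 * z1 - z2) * P a a else 0)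
  + (\sum_(a : 'I_L) \sum_(b : 'I_L | a != b)
        if (b1 == a) && (b2 == b) then q * (z1 - z2) * P a b else 0)
  + (\sum_(a : 'I_L) \sum_(b : 'I_L | (a < b)%N)
        if (b1 == a) && (b2 == b) then z1 * (q ^+ 2 - 1) * P b a else 0)
  + (\sum_(a : 'I_L) \sum_(b : 'I_L | (b < a)%N)
        if (b1 == a) && (b2 == b) then z2 * (q ^+ 2 - 1) * P b a else 0).

(* T^c = (z1 - q^2 z2)/(z1 - z2) (1 - s . R(z1,z2)/(q^2 z1 - z2)) - 1 *)
Definition Tc (N L : nat) (P : 'I_L -> 'I_L -> Fr) (b1 b2 : 'I_L) : Fr :=
  let q := cst (qq N) in
  let G := fun x y => Rop N L P x y / (q ^+ 2 * z1 - z2) in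
  (z1 - q ^+ 2 * z2) / (z1 - z2) * (P b1 b2 - swF (G b2 b1)) - P b1 b2.

(* coefficient of v_{e1+1} (x) v_{e2+1} in T^s (v_{h1+1} (x) v_{h2+1}) *)
Definition Tsimg (N : nat) (h1 h2 e1 e2 : 'I_N) : Kf :=
  let q := qq N in
  if h1 == h2 then (if (e1 == h1) && (e2 == h2) then q ^+ 2 else 0)
  else if (h1 < h2)%N then (if (e1 == h2) && (e2 == h1) then q else 0)
  else (if (e1 == h2) && (e2 == h1) then q else 0)
       + (if (e1 == h1) && (e2 == h2) then q ^+ 2 - 1 else 0).

Definition Full2 (N L : nat) := 'I_L -> 'I_L -> 'I_N -> 'I_N -> Fr.

(* T^c (x) 1 - 1 (x) T^s on V_aff^{(x)2} (seen inside the rational functions) *)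
Definition TcTs (N L : nat) (F : Full2 N L) : Full2 N L :=
  fun b1 b2 e1 e2 =>
    Tc N L (fun x y => F x y e1 e2) b1 b2
    - \sum_(h1 : 'I_N) \sum_(h2 : 'I_N) cst (Tsimg N h1 h2 e1 e2) * F b1 b2 h1 h2.

(* embedding of sum c . u_{k1} (x) u_{k2} into the rational two-site space *)
Definition emb2 (N L : nat) (r : seq (Kf * (int * int))) : Full2 N L :=
  fun b1 b2 e1 e2 =>
    \sum_(p <- r)
      if [&& kdot N L p.2.1 == b1%:Z + 1, kdot N L p.2.2 == b2%:Z + 1,
             kbar N p.2.1 == e1%:Z + 1 & kbar N p.2.2 == e2%:Z + 1]
      then cst p.1 * z1 ^ (kund N L p.2.1) * z2 ^ (kund N L p.2.2) else 0.

Definition T2rel (N L : nat) (k1 k2 : int) (r : seq (Kf * (int * int))) : Prop :=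
  forall b1 b2 e1 e2,
    emb2 N L r b1 b2 e1 e2 = TcTs N L (emb2 N L [:: (1, (k1, k2))]) b1 b2 e1 e2.

(* generator c . x (x) (T^c_i - T^s_i)(u_{k1} (x) u_{k2}) (x) w of the relations *)
Record gen := Gen { gc : Kf; gpre : seq int; gk1 : int; gk2 : int;
                    gr : seq (Kf * (int * int)); gpost : seq int }.
Definition genT (g : gen) : Tens :=
  scaleT (gc g) [seq (p.1, gpre g ++ [:: p.2.1; p.2.2] ++ gpost g) | p <- gr g].

(* v lies in sum_i Im(T^c_i - T^s_i) *)
Definition in_rel (N L : nat) (v : Tens) : Prop :=
  exists gs : seq gen,
    (forall g, Stdlib.Lists.List.In g gs -> T2rel N L (gk1 g) (gk2 g) (gr g)) /\
    forall s, coefT v s = coefT (flatten (map genT gs)) s.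

(* The Fock space F_M as the inductive limit of the wedge powers            *)
(* u_{M-n} (x) u_{M-n-1} (x) ... (x) u_{M-P+1} : extension from length n to P *)
Definition tailS (M : int) (n P : nat) : seq int :=
  [seq M - n%:Z - j%:Z | j <- iota 0 (P - n)].
Definition extTo (M : int) (P : nat) (v : Tens) : Tens :=
  [seq (p.1, p.2 ++ tailS M (size p.2) P) | p <- v].

(* equality in F_M of the images of two formal combinations of pure tensors *)
Definition fock_eq (N L : nat) (M : int) (v w : Tens) : Prop :=
  exists P : nat, (forall p, Stdlib.Lists.List.In p (v ++ w) -> (size p.2 <= P)%N) /\
    in_rel N L (subT (extTo M P v) (extTo M P w)).

Definition wtK (N : nat) (i : nat) (k : int) : int :=
  ind (eqmod N (kbar N k) i) - ind (eqmod N (kbar N k) (i%:Z + 1)).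
Definition E1 (N L : nat) (i : nat) (k : int) : option int :=
  if eqmod N (kbar N k) (i%:Z + 1)
  then Some (enc N L (kund N L k + ind (i == 0)%N) (kdot N L k) (modrep N (kbar N k - 1)))
  else None.
Definition F1 (N L : nat) (i : nat) (k : int) : option int :=
  if eqmod N (kbar N k) i
  then Some (enc N L (kund N L k - ind (i == 0)%N) (kdot N L k) (modrep N (kbar N k + 1)))
  else None.
Definition wtKd (N L : nat) (a : nat) (k : int) : int :=
  ind (eqmod L (kdot N L k) (L%:Z - a%:Z + 1)) - ind (eqmod L (kdot N L k) (L%:Z - a%:Z)).
Definition Ed1 (N L : nat) (a : nat) (k : int) : option int :=
  if eqmod L (kdot N L k) (L%:Z - a%:Z)
  then Some (enc N L (kund N L k + ind (a == 0)%N) (modrep L (kdot N L k + 1)) (kbar N k))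
  else None.
Definition Fd1 (N L : nat) (a : nat) (k : int) : option int :=
  if eqmod L (kdot N L k) (L%:Z - a%:Z + 1)
  then Some (enc N L (kund N L k - ind (a == 0)%N) (modrep L (kdot N L k - 1)) (kbar N k))
  else None.

(* Actions on V_aff^{(x)n} through iterated coproducts                      *)
Fixpoint copAct (x1 : int -> option int) (cl : int -> Kf) (cr : seq int -> Kf)
    (w : seq int) : Tens :=
  match w with
  | [::] => [::]
  | x :: r => (if x1 x is Some y then [:: (cr r, y :: r)] else [::])
              ++ scaleT (cl x) (consT x (copAct x1 cl cr r))
  end.
Definition grp (f : int -> Kf) (r : seq int) : Kf := \prod_(x <- r) f x.

Definition Kt (N : nat) (i : nat) (w : seq int) : Kf :=
  grp (fun x => qq N ^ wtK N i x) w.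
Definition Kdt (N L : nat) (a : nat) (w : seq int) : Kf :=
  grp (fun x => qq N ^ wtKd N L a x) w.
(* Delta^+(E) = E (x) K + 1 (x) E ;  Delta^+(F) = F (x) 1 + K^-1 (x) F *)
Definition Et (N L : nat) (i : nat) : seq int -> Tens :=
  copAct (E1 N L i) (fun _ => 1) (Kt N i).
Definition Ft (N L : nat) (i : nat) : seq int -> Tens :=
  copAct (F1 N L i) (fun x => qq N ^ (- wtK N i x)) (fun _ => 1).
(* Delta^-(E) = E (x) 1 + K (x) E ;  Delta^-(F) = F (x) K^-1 + 1 (x) F *)
Definition Edt (N L : nat) (a : nat) : seq int -> Tens :=
  copAct (Ed1 N L a) (fun x => qq N ^ wtKd N L a x) (fun _ => 1).
Definition Fdt (N L : nat) (a : nat) : seq int -> Tens :=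
  copAct (Fd1 N L a) (fun _ => 1) (fun r => (Kdt N L a r)^-1).
(* D and Ddot: Delta(D) = D (x) 1 + 1 (x) D *)
Definition Dt (N L : nat) (w : seq int) : Kf := (\sum_(x <- w) kund N L x)%:~R.

(* Operators on F_M : w = v /\ |m>> with m large                           *)
Section Fock.
Variables (N L : nat) (M : int).
(* the choice of m (any large m gives the same result) *)
Definition mch (w : seq int) : nat := (size w + absz M)%N.
Definition Pn (w : seq int) : nat := absz (M + (N * L * mch w)%:Z).
(* v in wedge^{M+NLm} with v /\ |m>> = w *)
Definition vof (w : seq int) : seq int := w ++ tailS M (size w) (Pn w).
Definition vbar (m : nat) : seq int :=
  [seq - (N * L * m)%:Z - j%:Z | j <- iota 0 (N * L)].
Definition Dvac (m : nat) : Kf := (N * L)%:R * (m%:Z * (1 - m%:Z))%:~R / 2.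

Definition fK (i : nat) (w : seq int) : Tens :=
  let v := vof w in [:: (Kt N i v * qq N ^ (L%:Z * ind (i == 0)%N), v)].
Definition fKi (i : nat) (w : seq int) : Tens :=
  let v := vof w in [:: ((Kt N i v)^-1 * qq N ^ (- (L%:Z * ind (i == 0)%N)), v)].
Definition fE (i : nat) (w : seq int) : Tens :=
  let v := vof w in scaleT (qq N ^ (L%:Z * ind (i == 0)%N)) (Et N L i v).
Definition fF (i : nat) (w : seq int) : Tens :=
  let v := vof w in
  Ft N L i v ++ (if (i == 0)%N
                 then scaleT (Kt N i v)^-1 (prependT v (Ft N L 0 (vbar (mch w))))
                 else [::]).
Definition fD (w : seq int) : Tens :=
  let v := vof w in [:: (Dt N L v + Dvac (mch w), v)].

Definition fKd (a : nat) (w : seq int) : Tens :=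
  let v := vof w in [:: (Kdt N L a v * qq N ^ (N%:Z * ind (a == 0)%N), v)].
Definition fKdi (a : nat) (w : seq int) : Tens :=
  let v := vof w in [:: ((Kdt N L a v)^-1 * qq N ^ (- (N%:Z * ind (a == 0)%N)), v)].
Definition fEd (a : nat) (w : seq int) : Tens := Edt N L a (vof w).
Definition fFd (a : nat) (w : seq int) : Tens :=
  let v := vof w in
  scaleT (qq N ^ (- (N%:Z * ind (a == 0)%N))) (Fdt N L a v)
  ++ (if (a == 0)%N
      then prependT v (scaleT (qq N ^ (- N%:Z)) (Fdt N L 0 (vbar (mch w))))
      else [::]).
Definition fDd (w : seq int) : Tens :=
  let v := vof w in [:: (Dt N L v + Dvac (mch w), v)].

Definition opE i := linop (fE i).
Definition opF i := linop (fF i).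
Definition opK i := linop (fK i).
Definition opKi i := linop (fKi i).
Definition opD := linop fD.
Definition opEd a := linop (fEd a).
Definition opFd a := linop (fFd a).
Definition opKd a := linop (fKd a).
Definition opKdi a := linop (fKdi a).
Definition opDd := linop fDd.
End Fock.

Definition op := Tens -> Tens.

Definition cartan (Mp i j : nat) : int :=
  2 * ind (eqmod Mp i j) - ind (eqmod Mp i (j%:Z + 1)) - ind (eqmod Mp i (j%:Z - 1)).
Definition qint (q : Kf) (k : nat) : Kf := (q ^+ k - q ^- k) / (q - q^-1).
Definition qfact (q : Kf) (n : nat) : Kf := \prod_(1 <= k < n.+1) qint q k.
Definition qbinom (q : Kf) (n k : nat) : Kf :=
  qfact q n / (qfact q k * qfact q (n - k)).

Definition serre (q : Kf) (n : nat) (Xi Xj : op) (x : Tens) : Tens :=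
  flatten [seq scaleT ((-1) ^+ k * qbinom q n k) (iter (n - k) Xi (Xj (iter k Xi x)))
          | k <- iota 0 n.+1].

Definition Uq_relations (eqv : Tens -> Tens -> Prop) (Mp : nat) (q : Kf)
    (E F K Ki : nat -> op) (D : op) : Prop :=
  (forall i j, (i < Mp)%N -> (j < Mp)%N -> forall x,
      [/\ eqv (K i (K j x)) (K j (K i x)), eqv (K i (Ki j x)) (Ki j (K i x)),
          eqv (Ki i (Ki j x)) (Ki j (Ki i x)) & eqv (Ki i (K j x)) (K j (Ki i x))])
  /\ (forall i, (i < Mp)%N -> forall x,
      eqv (K i (D x)) (D (K i x)) /\ eqv (Ki i (D x)) (D (Ki i x)))
  /\ (forall i, (i < Mp)%N -> forall x, eqv (K i (Ki i x)) x /\ eqv (Ki i (K i x)) x)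
  /\ (forall i j, (i < Mp)%N -> (j < Mp)%N -> forall x,
      eqv (K i (E j x)) (scaleT (q ^ cartan Mp i j) (E j (K i x))) /\
      eqv (K i (F j x)) (scaleT (q ^ (- cartan Mp i j)) (F j (K i x))))
  /\ (forall i, (i < Mp)%N -> forall x,
      eqv (subT (D (E i x)) (E i (D x))) (scaleT (ind (i == 0)%N)%:~R (E i x)) /\
      eqv (subT (D (F i x)) (F i (D x))) (scaleT (- (ind (i == 0)%N)%:~R) (F i x)))
  /\ (forall i j, (i < Mp)%N -> (j < Mp)%N -> forall x,
      eqv (subT (E i (F j x)) (F j (E i x)))
          (scaleT ((ind (i == j))%:~R / (q - q^-1)) (subT (K i x) (Ki i x))))
  /\ (forall i j, (i < Mp)%N -> (j < Mp)%N -> i <> j -> forall x,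
      eqv (serre q (absz (1 - cartan Mp i j)) (E i) (E j) x) [::] /\
      eqv (serre q (absz (1 - cartan Mp i j)) (F i) (F j) x) [::]).

Definition weight_vector (eqv : Tens -> Tens -> Prop) (Mp : nat) (q : Kf)
    (K : nat -> op) (D : op) (x : Tens) : Prop :=
  exists (lam : nat -> int) (d : Kf),
    (forall i, (i < Mp)%N -> eqv (K i x) (scaleT (q ^ lam i) x)) /\ eqv (D x) (scaleT d x).

Definition integrable (eqv : Tens -> Tens -> Prop) (Mp : nat) (q : Kf)
    (E F K : nat -> op) (D : op) : Prop :=
  (forall i, (i < Mp)%N -> forall x,
      (exists k, eqv (iter k (E i) x) [::]) /\ (exists k, eqv (iter k (F i) x) [::]))
  /\ (forall x, exists ws : seq Tens,
        (forall y, Stdlib.Lists.List.In y ws -> weight_vector eqv Mp q K D y) /\ eqv x (flatten ws)).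

(* Main.v *)
(** We work with linear functionals instead of vectors.  By a separation argument (the space of formal
    combinations of words has countable dimension), two combinations agree in F_M as soon as they
    agree under every functional which kills the two-site relations and is unchanged when the next
    vacuum letter is appended to a word.  The relations are made explicit first: T^c is a divided
    difference, so on monomials it is a swap plus an oriented geometric sum.

    The transposes of E_i, F_i, K_i on functionals obey a one-letter rule coming from the coproduct.
    Hence every relation (Serre, [E, F], local nilpotency, commutation of the two families) follows
    by stripping letters down to a tail on which the generators act trivially: the vacuum |-NLm>, or
    for i = 0 its first block with the letters of class 0 removed.  That E_i and F_i kill these tails
    rests on two facts about a block of NL letters: a word with more than L (resp. N) letters of the
    same class in one block vanishes, and letters of neighbouring blocks can be put in order.  For
    relations involving the F_i only, the tail gives a highest weight vector of some weight b for a
    quantum sl_2, which local nilpotency forces to be killed by F_i^(b + 1). *)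
Require Import Defs.
From HB Require Import structures.
From mathcomp Require Import all_boot all_order all_algebra.
From mathcomp Require Import zify ring.
From Stdlib Require List.
From Stdlib Require Import Classical ClassicalEpsilon FunctionalExtensionality.
Import Order.TTheory GRing.Theory Num.Theory.
Local Open Scope ring_scope.

Set Implicit Arguments.
Unset Strict Implicit.

(** * Letters *)

(** Equality in [fock_eq] asks for an explicit list of generators, and [T2rel] describes these only
    through an identity of rational functions. On the dual side the question becomes a family of
    scalar equations, which can be inherited letter by letter; prefixing a letter raises the charge,
    so every statement ranges over all charges. The obstacle is the F_i. For index 0, the vacuum
    |-NLm> has weight q^L (resp. q^N) under K_0 and is not killed by F_0; removing the letters of
    class 0 from one block cancels exactly this weight. Moreover the tail of index i is adapted to
    F_i alone: another F_j need not kill it. So the Serre relations among the F_i, and the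
    commutation of F_i with the other algebra, are not read off on the tail; the quantum sl_2
    argument is used there instead, with b = - a_ij for Serre and b = 0 across the two algebras.
    Genericity of q enters as 1 + q^2 <> 0, because a repeated letter satisfies -B = q^2 B, and as
    q^k <> 1, in the quantum sl_2 argument. *)

Section Bars.
Variable N : nat.
Hypothesis hN : (1 < N)%N.

(* The letter [k] is recorded by its bar index [ec k] (0-based) and its column [pc k], which in
   the notation of the paper is the dot index plus [L] times the exponent of z; the column itself
   splits into the 0-based dot index [dc k] and the exponent [bk k]. *)
Definition mk (p : int) (e : nat) : int := e%:Z + 1 - N%:Z * p.
Definition pc (k : int) : int := - ((k - 1) %/ N%:Z)%Z.
Definition ec (k : int) : nat := absz ((k - 1) %% N%:Z)%Z.

Lemma ec_lt k : (ec k < N)%N.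
Proof. rewrite /ec; lia. Qed.

Lemma mkK k : mk (pc k) (ec k) = k.
Proof. by rewrite /mk /pc /ec; have := divz_eq (k - 1) N%:Z; lia. Qed.

Lemma pc_mk p e : (e < N)%N -> pc (mk p e) = p.
Proof.
move=> he; rewrite /pc /mk.
have -> : e%:Z + 1 - N%:Z * p - 1 = (- p) * N%:Z + e%:Z by ring.
rewrite divzMDl; last by lia.
by rewrite divz_small ?addr0 ?opprK //; lia.
Qed.

Lemma ec_mk p e : (e < N)%N -> ec (mk p e) = e.
Proof.
move=> he; rewrite /ec /mk.
have -> : e%:Z + 1 - N%:Z * p - 1 = (- p) * N%:Z + e%:Z by ring.
by rewrite modzMDl modz_small //; lia.
Qed.

Lemma kbarE k : kbar N k = (ec k)%:Z + 1.
Proof. rewrite /kbar /modrep /ec; lia. Qed.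

Lemma kcolE k : ((kbar N k - k) %/ N%:Z)%Z = pc k.
Proof.
rewrite kbarE -{2}(mkK k) /mk.
have -> : (ec k)%:Z + 1 - ((ec k)%:Z + 1 - N%:Z * pc k) = pc k * N%:Z by ring.
by rewrite mulzK //; lia.
Qed.

Lemma letter_eq j k : ec j = ec k -> pc j = pc k -> j = k.
Proof. by move=> he hp; rewrite -(mkK j) -(mkK k) he hp. Qed.

Lemma ecS k : ec (k - N%:Z) = ec k.
Proof.
rewrite /ec; have -> : k - N%:Z - 1 = (-1) * N%:Z + (k - 1) by ring.
by rewrite modzMDl.
Qed.

Lemma pcS k : pc (k - N%:Z) = pc k + 1.
Proof.
rewrite /pc; have -> : k - N%:Z - 1 = (-1) * N%:Z + (k - 1) by ring.
by rewrite divzMDl; lia.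
Qed.

Lemma eqmod_nat (n : nat) (a b : nat) :
  (0 < n)%N -> eqmod n%:Z a%:Z b%:Z = (a %% n == b %% n)%N.
Proof.
move=> hn; rewrite /eqmod.
have -> : ((a%:Z - b%:Z) %% n%:Z)%Z == 0 = (a%:Z == b%:Z %[mod n%:Z])%Z.
  by rewrite eqz_mod_dvd; apply/eqP/dvdz_mod0P.
by rewrite !modz_nat eqz_nat.
Qed.

Definition nx (n i : nat) : nat := (i.+1 %% n)%N.
(** The bar index modulo N, so that E_i sends class i + 1 to class i with no exception at i = 0. *)
Definition clN (k : int) : nat := ((ec k).+1 %% N)%N.

Lemma clN_lt k : (clN k < N)%N. Proof. by rewrite ltn_mod; lia. Qed.

Lemma clN_nx k i : (i < N)%N -> (clN k == nx N i) = (ec k == i).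
Proof.
move=> hi; have he := ec_lt k; rewrite /clN /nx.
have H j : (j < N)%N -> (j.+1 %% N)%N = (if j == N.-1 then 0 else j.+1)%N.
  move=> hj; case: eqP => [->|hne]; first by rewrite prednK ?modnn //; lia.
  by rewrite modn_small //; lia.
by rewrite !H //; case: (eqVneq (ec k) N.-1); case: (eqVneq i N.-1); lia.
Qed.

Lemma clN_eq k i : (i < N)%N -> (clN k == i) = (ec k == if i == 0%N then N.-1 else i.-1).
Proof.
move=> hi; have he := ec_lt k; rewrite /clN.
have [h|h] := eqVneq (ec k) N.-1.
  by rewrite h prednK ?modnn; [case: (i) hi => [|j] //=; lia|lia].
by rewrite modn_small; [case: (i) hi => [|j] //=; lia|lia].
Qed.

Lemma wtKE i k : (i < N)%N -> wtK N i k = ind (clN k == i) - ind (clN k == nx N i).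
Proof.
move=> hi; rewrite /wtK kbarE.
have -> : (ec k)%:Z + 1 = (ec k).+1%:Z by lia.
have -> : i%:Z + 1 = i.+1%:Z by lia.
by rewrite !eqmod_nat ?(modn_small hi) //; lia.
Qed.

End Bars.

Section Letters.
Variables (N L : nat).
Hypotheses (hN : (1 < N)%N) (hL : (1 < L)%N).
Local Notation mk := (mk N).
Local Notation pc := (pc N).
Local Notation ec := (ec N).
Local Notation clN := (clN N).

Definition dc (k : int) : nat := absz ((pc k - 1) %% L%:Z)%Z.
Definition bk (k : int) : int := ((pc k - 1) %/ L%:Z)%Z.

Lemma dc_lt k : (dc k < L)%N.
Proof. rewrite /dc; lia. Qed.

Lemma pcE k : pc k = L%:Z * bk k + (dc k)%:Z + 1.
Proof. rewrite /bk /dc; have := divz_eq (pc k - 1) L%:Z; lia. Qed.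

Lemma dc_mk m d e : (e < N)%N -> (d < L)%N -> dc (mk (L%:Z * m + d%:Z + 1) e) = d.
Proof.
move=> he hd; rewrite /dc pc_mk //.
have -> : L%:Z * m + d%:Z + 1 - 1 = m * L%:Z + d%:Z by ring.
by rewrite modzMDl modz_small //; lia.
Qed.

Lemma bk_mk m d e : (e < N)%N -> (d < L)%N -> bk (mk (L%:Z * m + d%:Z + 1) e) = m.
Proof.
move=> he hd; rewrite /bk pc_mk //.
have -> : L%:Z * m + d%:Z + 1 - 1 = m * L%:Z + d%:Z by ring.
rewrite divzMDl; last by lia.
by rewrite divz_small ?addr0 //; lia.
Qed.

Lemma kdotE k : kdot N L k = (dc k)%:Z + 1.
Proof. rewrite /kdot (kcolE hN) /modrep /dc; lia. Qed.

Lemma kundE k : kund N L k = bk k.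
Proof.
rewrite /kund (kcolE hN) kdotE pcE.
have -> : L%:Z * bk k + (dc k)%:Z + 1 - ((dc k)%:Z + 1) = bk k * L%:Z by ring.
by rewrite mulzK //; lia.
Qed.

Lemma encE m a e : enc N L m (a%:Z + 1) (e%:Z + 1) = mk (L%:Z * m + a%:Z + 1) e.
Proof. by rewrite /enc /mk; ring. Qed.

(** One cyclic step down the bars, gaining a factor z (L columns) when bar 1 becomes bar N. Every
    E_i acts on letters by this one map; only the class on which it acts depends on i. *)
Definition rhoN (k : int) : int :=
  if ec k == 0%N then mk (pc k + L%:Z) N.-1 else mk (pc k) (ec k).-1.
Definition rhoN' (k : int) : int :=
  if ec k == N.-1 then mk (pc k - L%:Z) 0 else mk (pc k) (ec k).+1.
(** The class runs against the dot index because the dotted E_a raises that index: the letters it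
    moves have dot index L - a modulo L, which is class a + 1, and arrive in class a. *)
Definition clL (k : int) : nat := ((L - dc k) %% L)%N.

Lemma clL_lt k : (clL k < L)%N. Proof. by rewrite ltn_mod; lia. Qed.

Lemma clL_nx k i : (i < L)%N -> (clL k == nx L i) = (dc k == L - i.+1)%N.
Proof.
move=> hi; have hd := dc_lt k; rewrite /clL /nx.
have [h|h] := eqVneq (dc k) 0%N.
  rewrite h subn0 modnn; have [->|h2] := eqVneq i L.-1; first by rewrite prednK ?modnn; lia.
  by rewrite modn_small; lia.
rewrite modn_small; last by lia.
have [->|h2] := eqVneq i L.-1; first by rewrite prednK ?modnn; lia.
by rewrite modn_small; lia.
Qed.

Lemma clL_eq k i : (i < L)%N -> (clL k == i) = (dc k == if i == 0 then 0 else L - i)%N.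
Proof.
move=> hi; have hd := dc_lt k; rewrite /clL.
have [h|h] := eqVneq (dc k) 0%N; first by rewrite h subn0 modnn; case: (i) hi => [|j] /=; lia.
by rewrite modn_small; [case: (i) hi => [|j] /=; lia|lia].
Qed.

Lemma ec_rhoN k : ec (rhoN k) = if ec k == 0%N then N.-1 else (ec k).-1.
Proof. by have := ec_lt hN k; rewrite /rhoN; case: eqP => h hk; rewrite ec_mk //; lia. Qed.
Lemma ec_rhoN' k : ec (rhoN' k) = if ec k == N.-1 then 0%N else (ec k).+1.
Proof. by have := ec_lt hN k; rewrite /rhoN'; case: eqP => h hk; rewrite ec_mk //; lia. Qed.
Lemma pc_rhoN k : pc (rhoN k) = if ec k == 0%N then pc k + L%:Z else pc k.
Proof. by have := ec_lt hN k; rewrite /rhoN; case: eqP => h hk; rewrite pc_mk //; lia. Qed.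
Lemma pc_rhoN' k : pc (rhoN' k) = if ec k == N.-1 then pc k - L%:Z else pc k.
Proof. by have := ec_lt hN k; rewrite /rhoN'; case: eqP => h hk; rewrite pc_mk //; lia. Qed.

Lemma rhoNK : cancel rhoN rhoN'.
Proof.
move=> k; have := ec_lt hN k => h; apply: (letter_eq hN).
  by rewrite ec_rhoN' ec_rhoN; do ! case: eqP => //; lia.
by rewrite pc_rhoN' ec_rhoN pc_rhoN; do ! case: eqP => //; lia.
Qed.

Lemma rhoNK' : cancel rhoN' rhoN.
Proof.
move=> k; have := ec_lt hN k => h; apply: (letter_eq hN).
  by rewrite ec_rhoN ec_rhoN'; do ! case: eqP => //; lia.
by rewrite pc_rhoN ec_rhoN' pc_rhoN'; do ! case: eqP => //; lia.
Qed.

Lemma dcE_of (k : int) (m : int) (d : nat) :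
  (d < L)%N -> pc k = L%:Z * m + d%:Z + 1 -> dc k = d /\ bk k = m.
Proof.
move=> hd hp; rewrite -(mkK hN k) hp; split; first by rewrite dc_mk // ec_lt.
by rewrite bk_mk // ec_lt.
Qed.

Lemma dcS k : dc (k - N%:Z) = if dc k == L.-1 then 0%N else (dc k).+1.
Proof.
have h := dc_lt k; case: eqP => hk.
  by apply: (dcE_of (m := bk k + 1) _ _).1; rewrite ?(pcS hN) ?pcE; lia.
by apply: (dcE_of (m := bk k) _ _).1; rewrite ?(pcS hN) ?pcE; lia.
Qed.
Lemma bkS k : bk (k - N%:Z) = if dc k == L.-1 then bk k + 1 else bk k.
Proof.
have h := dc_lt k; case: eqP => hk.
  by apply: (dcE_of (m := bk k + 1) (d := 0%N) _ _).2; rewrite ?(pcS hN) ?pcE; lia.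
by apply: (dcE_of (m := bk k) (d := (dc k).+1) _ _).2; rewrite ?(pcS hN) ?pcE; lia.
Qed.
Lemma dc_rhoN k : dc (rhoN k) = dc k.
Proof.
have h := dc_lt k; rewrite /dc pc_rhoN; case: eqP => // _.
have -> : pc k + L%:Z - 1 = 1 * L%:Z + (pc k - 1) by ring.
by rewrite modzMDl.
Qed.
Lemma bk_rhoN k : bk (rhoN k) = if ec k == 0%N then bk k + 1 else bk k.
Proof.
rewrite /bk pc_rhoN; case: eqP => // _.
have -> : pc k + L%:Z - 1 = 1 * L%:Z + (pc k - 1) by ring.
by rewrite divzMDl; [rewrite addrC|lia].
Qed.
Lemma E1E i k : (i < N)%N -> E1 N L i k = if clN k == nx N i then Some (rhoN k) else None.
Proof.
move=> hi; rewrite /E1 (kbarE hN) kundE kdotE clN_nx //; have he := ec_lt hN k.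
have -> : (ec k)%:Z + 1 = (ec k).+1%:Z by lia.
have -> : i%:Z + 1 = i.+1%:Z by lia.
rewrite eqmod_nat; last by lia.
have -> : ((ec k).+1 %% N == i.+1 %% N)%N = (ec k == i) by rewrite -clN_nx.
case: eqP => // <-; congr Some.
have -> : modrep N%:Z ((ec k).+1%:Z - 1) = (if ec k == 0%N then N.-1 else (ec k).-1)%:Z + 1.
  rewrite /modrep; case: eqP => h.
    have -> : (ec k).+1%:Z - 1 - 1 = (-1) * N%:Z + N.-1%:Z by lia.
    by rewrite modzMDl modz_small //; lia.
  have -> : (ec k).+1%:Z - 1 - 1 = (ec k).-1%:Z by lia.
  by rewrite modz_small //; lia.
by rewrite encE /rhoN /ind; case: (ec k == 0%N); congr mk; rewrite pcE; lia.
Qed.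

Lemma F1E i k : (i < N)%N -> F1 N L i k = if clN k == i then Some (rhoN' k) else None.
Proof.
move=> hi; rewrite /F1 (kbarE hN) kundE kdotE; have he := ec_lt hN k.
have -> : (ec k)%:Z + 1 = (ec k).+1%:Z by lia.
rewrite eqmod_nat; last by lia.
rewrite (modn_small hi) -/(clN k); case: eqP => // hc; congr Some.
have hce : ec k = if i == 0%N then N.-1 else i.-1 by apply/eqP; rewrite -clN_eq // hc.
have -> : modrep N%:Z ((ec k).+1%:Z + 1) = (if ec k == N.-1 then 0%N else (ec k).+1)%:Z + 1.
  rewrite /modrep; case: eqP => h.
    have -> : (ec k).+1%:Z + 1 - 1 = 1 * N%:Z + 0 by lia.
    by rewrite modzMDl modz_small //; lia.
  have -> : (ec k).+1%:Z + 1 - 1 = (ec k).+1%:Z by lia.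
  by rewrite modz_small //; lia.
rewrite encE /rhoN' /ind.
have -> : (ec k == N.-1) = (i == 0%N) by rewrite hce; case: (i) hi => [|j] /=; lia.
by case: (i == 0%N); congr mk; rewrite pcE; lia.
Qed.

Lemma Ed1E a k : (a < L)%N -> Ed1 N L a k = if clL k == nx L a then Some (k - N%:Z) else None.
Proof.
move=> ha; rewrite /Ed1 (kbarE hN) kundE kdotE clL_nx //; have hd := dc_lt k.
have -> : (dc k)%:Z + 1 = (dc k).+1%:Z by lia.
have -> : L%:Z - a%:Z = (L - a)%N%:Z by lia.
rewrite eqmod_nat; last by lia.
have -> : ((dc k).+1 %% L == (L - a) %% L)%N = (dc k == L - a.+1)%N.
  have [->|h0] := eqVneq a 0%N.
    rewrite subn0 modnn; have [->|h] := eqVneq (dc k) L.-1; first by rewrite prednK ?modnn; lia.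
    by rewrite modn_small; lia.
  rewrite (@modn_small (L - a)); last by lia.
  have [->|h] := eqVneq (dc k) L.-1; first by rewrite prednK ?modnn; lia.
  by rewrite modn_small; lia.
case: eqP => // hda; congr Some.
have -> : modrep L%:Z ((dc k).+1%:Z + 1) = (if dc k == L.-1 then 0%N else (dc k).+1)%:Z + 1.
  rewrite /modrep; case: eqP => h.
    have -> : (dc k).+1%:Z + 1 - 1 = 1 * L%:Z + 0 by lia.
    by rewrite modzMDl modz_small //; lia.
  have -> : (dc k).+1%:Z + 1 - 1 = (dc k).+1%:Z by lia.
  by rewrite modz_small //; lia.
rewrite encE -{5}(mkK hN k) /ind; have -> : (dc k == L.-1) = (a == 0%N) by lia.
by case: eqP => h; rewrite /mk pcE; lia.
Qed.

Lemma Fd1E a k : (a < L)%N -> Fd1 N L a k = if clL k == a then Some (k + N%:Z) else None.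
Proof.
move=> ha; rewrite /Fd1 (kbarE hN) kundE kdotE clL_eq //; have hd := dc_lt k.
have -> : (dc k)%:Z + 1 = (dc k).+1%:Z by lia.
have -> : L%:Z - a%:Z + 1 = (L - a).+1%N%:Z by lia.
rewrite eqmod_nat; last by lia.
have -> : ((dc k).+1 %% L == (L - a).+1 %% L)%N = (dc k == if a == 0 then 0 else L - a)%N.
  have [->|h0] := eqVneq a 0%N.
    rewrite subn0 -(addn1 L) modnDl (@modn_small 1) //.
    have [->|h] := eqVneq (dc k) L.-1; first by rewrite prednK ?modnn; lia.
    by rewrite modn_small; lia.
  have [->|h] := eqVneq (dc k) L.-1.
    rewrite prednK ?modnn; last by lia.
    have [->|h1] := eqVneq a 1%N; first by rewrite subn1 prednK ?modnn; lia.
    by rewrite modn_small; lia.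
  rewrite (@modn_small (dc k).+1); last by lia.
  have [->|h1] := eqVneq a 1%N; first by rewrite subn1 prednK ?modnn; lia.
  by rewrite modn_small; lia.
case: eqP => // hda; congr Some.
have -> : modrep L%:Z ((dc k).+1%:Z - 1) = (if dc k == 0%N then L.-1 else (dc k).-1)%:Z + 1.
  rewrite /modrep; case: eqP => h.
    have -> : (dc k).+1%:Z - 1 - 1 = (-1) * L%:Z + L.-1%:Z by lia.
    by rewrite modzMDl modz_small //; lia.
  have -> : (dc k).+1%:Z - 1 - 1 = (dc k).-1%:Z by lia.
  by rewrite modz_small //; lia.
rewrite encE -{5}(mkK hN k) /ind; have -> : (dc k == 0%N) = (a == 0%N) by move: hda; case: eqP; lia.
move: hda; case: eqP => h hda; rewrite /mk pcE; first by lia.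
have -> : (dc k).-1%:Z = (dc k)%:Z - 1 by lia.
by ring.
Qed.

Lemma wtKdE a k : (a < L)%N -> wtKd N L a k = ind (clL k == a) - ind (clL k == nx L a).
Proof.
(* The two tests in [wtKd] are the guards of [Fd1] and [Ed1]; comparing [Some] with [None]
   identifies them with the class tests. *)
move=> ha; have := Ed1E k ha; have := Fd1E k ha; rewrite /wtKd /Ed1 /Fd1.
by do 4 case: ifP.
Qed.

Lemma clN_inj x y : (ec x == ec y) = (clN x == clN y).
Proof. by rewrite -(clN_nx hN x (ec_lt hN y)). Qed.

Lemma clL_inj x y : (dc x == dc y) = (clL x == clL y).
Proof.
have hx := dc_lt x; have hy := dc_lt y.
have E z : (clL z == 0%N) = (dc z == 0%N) by rewrite clL_eq //; lia.
have [z|z] := eqVneq (dc y) 0%N.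
  by have := E y; rewrite z eqxx => /eqP ->; rewrite E.
have [z'|z'] := eqVneq (dc x) 0%N.
  by have := E x; rewrite z' eqxx => /eqP ->; rewrite eq_sym (negbTE z) eq_sym E (negbTE z).
by rewrite /clL !modn_small; lia.
Qed.

End Letters.

Ltac decide_ifs := repeat match goal with
  |- context [if ?b then _ else _] => first
    [ have -> : b = true by lia | have -> : b = false by lia ] end.

(** * Relations on two sites *)

Section OrientedSums.
Variable K : fieldType.

(** The sum over 0 <= j < c, oriented like an integral: for c < 0 it is minus the sum over c <= j <
    0. This makes [osumS] valid for every integer c. *)
Definition osum (g : int -> K) (c : int) : K :=
  match c with
  | Posz n => \sum_(j < n) g j%:Z
  | Negz n => - \sum_(j < n.+1) g (- 1 - j%:Z)
  end.

Lemma osumS g c : osum g (c + 1) = osum g c + g c.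
Proof.
case: c => [n|[|n]].
- by rewrite -PoszD addn1 /= big_ord_recr.
- by rewrite /= big_ord0 big_ord1 subr0 addNr.
- have -> : Negz n.+1 + 1 = Negz n by lia.
  rewrite /= [in RHS]big_ord_recr /=.
  have -> : Negz n.+1 = - 1 - n.+1%:Z by lia.
  by rewrite opprD -addrA addNr addr0.
Qed.

Lemma osum0 g : osum g 0 = 0.
Proof. by rewrite /= big_ord0. Qed.

Lemma int_rect1 (P : int -> Prop) :
  P 0 -> (forall c, P c -> P (c + 1)) -> (forall c, P (c + 1) -> P c) -> forall c, P c.
Proof.
move=> h0 hs hp; elim/int_ind => // n; first by move=> /hs; rewrite intS addrC.
by move=> H; apply: hp; have -> : - n.+1%:Z + 1 = - n%:Z by lia.
Qed.

Lemma osum_shift g c : osum (fun j => g (j + 1)) c = osum g (c + 1) - g 0.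
Proof.
elim/int_rect1: c => [|c IH|c].
- by rewrite osumS !osum0 add0r subrr.
- by rewrite osumS IH [in RHS]osumS addrAC.
- by rewrite osumS [osum g (c + 1 + 1)]osumS addrAC => /addIr.
Qed.

Lemma osum_lin a b g g' c :
  osum (fun j => a * g j + b * g' j) c = a * osum g c + b * osum g' c.
Proof.
by case: c => n /=; rewrite big_split /= -!mulr_sumr; ring.
Qed.

Lemma eq_osum g g' c : g =1 g' -> osum g c = osum g' c.
Proof. by move=> e; case: c => n /=; [|congr (- _)]; apply: eq_bigr => j _. Qed.

End OrientedSums.

(** * The transpose of T^c on columns *)

Section Columns.
Variables (K : fieldType) (q : K) (L : nat).
Hypothesis hL : (1 < L)%N.
Local Notation h := (q ^+ 2 - 1).

(** The ceiling of (p2 - p1) / L, that is, the signed number of columns p1 + L j from p1 up to but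
    excluding p2. *)
Definition cnt (p1 p2 : int) : int := ((p2 - p1 - 1 + L%:Z) %/ L%:Z)%Z.
Definition SS (G : int -> int -> K) (p1 p2 : int) : K :=
  osum (fun j => G (p1 + L%:Z * j) (p2 - L%:Z * j)) (cnt p1 p2).
Definition dcp (p : int) : nat := absz ((p - 1) %% L%:Z)%Z.
Definition ne (p1 p2 : int) : K := if dcp p1 == dcp p2 then 1 else q.

(* [heck G] is the transpose of T^c evaluated on a function [G] of the two columns.  Indeed
   T^c (p1, p2) = - q^[p1 <> p2 mod L] (p2, p1) + (q^2 - 1) sum_j (p1 + L j, p2 - L j), where j runs
   over the integers with p1 <= p1 + L j < p2 (and the sum is oriented when p2 <= p1). *)
Definition heck (G : int -> int -> K) (p1 p2 : int) : K :=
  - ne p1 p2 * G p2 p1 + h * SS G p1 p2.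

Lemma SS_lin a b G H p1 p2 :
  SS (fun p p' => a * G p p' + b * H p p') p1 p2 = a * SS G p1 p2 + b * SS H p1 p2.
Proof. by rewrite /SS osum_lin. Qed.

Lemma heck_lin a b G H p1 p2 :
  heck (fun p p' => a * G p p' + b * H p p') p1 p2 = a * heck G p1 p2 + b * heck H p1 p2.
Proof. by rewrite /heck SS_lin; ring. Qed.

Lemma eq_heck G H p1 p2 : (forall p p', G p p' = H p p') -> heck G p1 p2 = heck H p1 p2.
Proof. by move=> e; rewrite /heck e /SS; congr (_ + _ * _); apply: eq_osum => j. Qed.

Lemma dcp_lt p : (dcp p < L)%N.
Proof. by rewrite /dcp; lia. Qed.

Lemma divz_uniq (x c r : int) : x = c * L%:Z + r -> 0 <= r < L%:Z -> (x %/ L%:Z)%Z = c.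
Proof.
move=> -> hr; rewrite divzMDl; last by lia.
by rewrite divz_small ?addr0 //; lia.
Qed.
Lemma dcp_uniq (p c : int) (d : nat) : p = c * L%:Z + d%:Z + 1 -> (d < L)%N -> dcp p = d.
Proof. by move=> -> hd; rewrite /dcp addrK modzMDl modz_small //; lia. Qed.
Lemma dcpE p : exists c, p = c * L%:Z + (dcp p)%:Z + 1.
Proof. by exists ((p - 1) %/ L%:Z)%Z; rewrite /dcp; have := divz_eq (p - 1) L%:Z; lia. Qed.

Lemma dcpS p : dcp (p + 1) = if dcp p == L.-1 then 0%N else (dcp p).+1.
Proof.
have hd := dcp_lt p; have [c e] := dcpE p; case: eqP => hp.
  by apply: (@dcp_uniq _ (c + 1)); lia.
by apply: (@dcp_uniq _ c); lia.
Qed.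
Lemma dcpP p : dcp (p - 1) = if dcp p == 0%N then L.-1 else (dcp p).-1.
Proof.
have hd := dcp_lt p; have [c e] := dcpE p; case: eqP => hp.
  by apply: (@dcp_uniq _ (c - 1)); lia.
by apply: (@dcp_uniq _ c); lia.
Qed.
Lemma dcpM p c : dcp (p + L%:Z * c) = dcp p.
Proof. by rewrite /dcp addrAC mulrC addrC modzMDl. Qed.
Lemma dcpD p : dcp (p + L%:Z) = dcp p.
Proof. by rewrite -{1}(mulr1 L%:Z) dcpM. Qed.
Lemma cnt_dcp p1 p2 c1 c2 : p1 = c1 * L%:Z + (dcp p1)%:Z + 1 -> p2 = c2 * L%:Z + (dcp p2)%:Z + 1 ->
  cnt p1 p2 = c2 - c1 + (if (dcp p1 < dcp p2)%N then 1 else 0).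
Proof.
have h1 := dcp_lt p1; have h2 := dcp_lt p2; move=> e1 e2; rewrite /cnt.
case: ifP => hlt; first by apply: (@divz_uniq _ _ ((dcp p2)%:Z - (dcp p1)%:Z - 1)); lia.
by apply: (@divz_uniq _ _ ((dcp p2)%:Z - (dcp p1)%:Z - 1 + L%:Z)); lia.
Qed.

Lemma cnt_succ1 p1 p2 :
  cnt (p1 + 1) p2 = cnt p1 p2 - (if dcp (p1 + 1) == dcp p2 then 1 else 0).
Proof.
have [c1 e1] := dcpE p1; have [c2 e2] := dcpE p2; have [c3 e3] := dcpE (p1 + 1).
have h1 := dcp_lt p1; have h2 := dcp_lt p2; have h3 := dcp_lt (p1 + 1).
rewrite (cnt_dcp e1 e2) (cnt_dcp e3 e2).
have hs := dcpS p1; move: hs; case: eqP => hp hs.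
  have -> : c3 = c1 + 1.
    apply: (mulIf (x := L%:Z)); first by lia.
    by rewrite mulrDl mul1r; lia.
  by rewrite hs; case: ifP; case: ifP; case: ifP; lia.
have -> : c3 = c1.
  apply: (mulIf (x := L%:Z)); first by lia.
  by lia.
by rewrite hs; case: ifP; case: ifP; case: ifP; lia.
Qed.

Lemma cnt_shift p1 p2 x : cnt (p1 + x) (p2 + x) = cnt p1 p2.
Proof. by rewrite /cnt; congr (_ %/ _)%Z; ring. Qed.

Lemma cnt_succ2 p1 p2 : cnt p1 (p2 + 1) = cnt p1 p2 + (if dcp p1 == dcp p2 then 1 else 0).
Proof.
have := cnt_succ1 (p1 - 1) p2; rewrite -(cnt_shift (p1 - 1) p2 1) !subrK => ->.
by rewrite subrK.
Qed.

Lemma cnt_succ1L p1 p2 : cnt (p1 + L%:Z) p2 = cnt p1 p2 - 1.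
Proof.
rewrite /cnt; have -> : p2 - (p1 + L%:Z) - 1 + L%:Z = (-1) * L%:Z + (p2 - p1 - 1 + L%:Z) by ring.
by rewrite divzMDl; lia.
Qed.
Lemma cnt_succ2L p1 p2 : cnt p1 (p2 + L%:Z) = cnt p1 p2 + 1.
Proof.
rewrite /cnt; have -> : p2 + L%:Z - p1 - 1 + L%:Z = 1 * L%:Z + (p2 - p1 - 1 + L%:Z) by ring.
by rewrite divzMDl; lia.
Qed.

Lemma cnt_eq p1 p2 : dcp p1 = dcp p2 -> L%:Z * cnt p1 p2 = p2 - p1.
Proof.
move=> e; have [c1 e1] := dcpE p1; have [c2 e2] := dcpE p2.
by rewrite (cnt_dcp e1 e2) e ltnn addr0; lia.
Qed.

(** The range shrinks by one term exactly when p1 + 1 and p2 agree modulo L, and the lost term is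
    then the last one, at the columns (p2, p1 + 1). *)
Lemma SS_succ1 G p1 p2 : SS G (p1 + 1) p2 =
  SS (fun p p' => G (p + 1) p') p1 p2 - (if dcp (p1 + 1) == dcp p2 then G p2 (p1 + 1) else 0).
Proof.
rewrite /SS cnt_succ1.
rewrite (eq_osum (g := fun j => G (p1 + 1 + _) _) (g' := fun j => G (p1 + L%:Z * j + 1) (p2 - L%:Z * j)));
  last by move=> j; rewrite addrAC.
case: eqP => e; last by rewrite !subr0.
set g := fun j => _.
have -> : cnt p1 p2 = cnt p1 p2 - 1 + 1 by rewrite subrK.
rewrite osumS addrK; have -> : g (cnt p1 p2 - 1) = G p2 (p1 + 1); last by rewrite addrK.
have := cnt_eq e; rewrite cnt_succ1 e eqxx /g => ->.
by congr G; ring.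
Qed.

Lemma SS_succ2 G p1 p2 : SS G p1 (p2 + 1) =
  SS (fun p p' => G p (p' + 1)) p1 p2 + (if dcp p1 == dcp p2 then G p2 (p1 + 1) else 0).
Proof.
rewrite /SS cnt_succ2.
rewrite (eq_osum (g := fun j => G _ (p2 + 1 - _)) (g' := fun j => G (p1 + L%:Z * j) (p2 - L%:Z * j + 1)));
  last by move=> j; rewrite addrAC.
case: eqP => e; last by rewrite !addr0.
rewrite osumS (cnt_eq e); congr (_ + _).
by congr G; ring.
Qed.

Lemma SS_per a b G p1 p2 : (forall p c, a (p + L%:Z * c) = a p) ->
  (forall p c, b (p + L%:Z * c) = b p) ->
  SS (fun p p' => a p * b p' * G p p') p1 p2 = a p1 * b p2 * SS G p1 p2.
Proof.
move=> ha hb; rewrite /SS (eq_osum (g' := fun j => a p1 * b p2 * G (p1 + L%:Z * j) (p2 - L%:Z * j)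
  + 0 * 0)); first by rewrite osum_lin mul0r addr0.
by move=> j; rewrite ha -mulrN hb mul0r addr0.
Qed.

(** Transposed Bernstein relation z_1 T = T z_2 - (q^2 - 1) z_2 for T = T^c: shifting the summation
    index by one leaves a single boundary term. *)
Lemma heck_z1 G p1 p2 : heck (fun p p' => G (p + L%:Z) p') p1 p2 =
  heck G p1 (p2 + L%:Z) - h * G p1 (p2 + L%:Z).
Proof.
rewrite /heck /ne dcpD /SS cnt_succ2L.
have := osum_shift (fun j => G (p1 + L%:Z * j) (p2 + L%:Z - L%:Z * j)) (cnt p1 p2).
rewrite (eq_osum (g' := fun j => G (p1 + L%:Z * j + L%:Z) (p2 - L%:Z * j))).
  by move=> ->; rewrite mulr0 addr0 subr0; ring.
by move=> j; congr G; ring.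
Qed.

(** The companion z_2 T = T z_1 + (q^2 - 1) z_2. The two corrections cancel in [heck_z12], since T^c
    commutes with the symmetric monomial z_1 z_2. *)
Lemma heck_z2 G p1 p2 : heck (fun p p' => G p (p' + L%:Z)) p1 p2 =
  heck G (p1 + L%:Z) p2 + h * G p1 (p2 + L%:Z).
Proof.
rewrite /heck /ne dcpD /SS cnt_succ1L.
have := osum_shift (fun j => G (p1 + L%:Z * j) (p2 + L%:Z - L%:Z * j)) (cnt p1 p2 - 1).
rewrite subrK (eq_osum (g' := fun j => G (p1 + L%:Z + L%:Z * j) (p2 - L%:Z * j))); last first.
  by move=> j; congr G; ring.
move=> ->; rewrite mulr0 addr0 subr0.
rewrite (eq_osum (g' := fun j => G (p1 + L%:Z * j) (p2 + L%:Z - L%:Z * j))); last first.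
  by move=> j; congr G; ring.
by ring.
Qed.

Lemma heck_z1' G p1 p2 : heck (fun p p' => G (p - L%:Z) p') p1 p2 =
  heck G p1 (p2 - L%:Z) + h * G (p1 - L%:Z) p2.
Proof.
have := heck_z1 (fun p p' => G (p - L%:Z) p') p1 (p2 - L%:Z); rewrite subrK => /eqP.
rewrite eq_sym subr_eq => /eqP ->; congr (_ + _).
by apply: eq_heck => p p'; rewrite addrK.
Qed.

Lemma heck_z2' G p1 p2 : heck (fun p p' => G p (p' - L%:Z)) p1 p2 =
  heck G (p1 - L%:Z) p2 - h * G (p1 - L%:Z) p2.
Proof.
have E := heck_z2 (fun p p' => G p (p' - L%:Z)) (p1 - L%:Z) p2.
have -> : heck G (p1 - L%:Z) p2 = heck (fun p p' => G p (p' + L%:Z - L%:Z)) (p1 - L%:Z) p2.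
  by apply: eq_heck => p p'; rewrite addrK.
by rewrite E subrK !addrK.
Qed.

Lemma heck_z12 G p1 p2 : heck (fun p p' => G (p + L%:Z) (p' + L%:Z)) p1 p2 =
  heck G (p1 + L%:Z) (p2 + L%:Z).
Proof. by rewrite (heck_z1 (fun p p' => G p (p' + L%:Z))) heck_z2 addrK. Qed.
Lemma heck_z12' G p1 p2 : heck (fun p p' => G (p - L%:Z) (p' - L%:Z)) p1 p2 =
  heck G (p1 - L%:Z) (p2 - L%:Z).
Proof.
have := heck_z12 (fun p p' => G (p - L%:Z) (p' - L%:Z)) (p1 - L%:Z) (p2 - L%:Z).
by rewrite !subrK => <-; apply: eq_heck => p p'; rewrite !addrK.
Qed.

End Columns.

(** * Compatibility of the generators with the two-site relations *)

Section TwoSites.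
Variables (K : fieldType) (q : K) (N L : nat).
Hypotheses (hN : (1 < N)%N) (hL : (1 < L)%N) (q0 : q != 0).
Local Notation h := (q ^+ 2 - 1).
Local Notation mk := (mk N).
Local Notation ec := (ec N).
Local Notation pc := (pc N).

Local Notation heck := (heck q L).

(** The value of B on (T^c - T^s)(u_{k1} (x) u_{k2}); thus [isR2] means that B kills the image of
    T^c - T^s. *)
Definition RR (B : int -> int -> K) (k1 k2 : int) : K :=
  heck (fun p p' => B (mk p (ec k1)) (mk p' (ec k2))) (pc k1) (pc k2)
  - ((if ec k1 == ec k2 then q ^+ 2 else q) * B (mk (pc k1) (ec k2)) (mk (pc k2) (ec k1))
     + (if (ec k2 < ec k1)%N then h else 0) * B k1 k2).

Definition isR2 (B : int -> int -> K) := forall k1 k2, RR B k1 k2 = 0.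

Lemma isR2P B : isR2 B <-> forall p1 p2 e1 e2, (e1 < N)%N -> (e2 < N)%N ->
  heck (fun p p' => B (mk p e1) (mk p' e2)) p1 p2 =
  (if e1 == e2 then q ^+ 2 else q) * B (mk p1 e2) (mk p2 e1)
  + (if (e2 < e1)%N then h else 0) * B (mk p1 e1) (mk p2 e2).
Proof.
split=> [H p1 p2 e1 e2 h1 h2|H k1 k2].
  apply/eqP; rewrite -subr_eq0; have := H (mk p1 e1) (mk p2 e2).
  by rewrite /RR !ec_mk // !pc_mk // => ->.
by rewrite /RR (H _ _ _ _ (ec_lt hN k1) (ec_lt hN k2)) !mkK ?subrr.
Qed.

Lemma RR_lin a b A B k1 k2 :
  RR (fun x y => a * A x y + b * B x y) k1 k2 = a * RR A k1 k2 + b * RR B k1 k2.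
Proof. by rewrite /RR heck_lin; ring. Qed.

Lemma RR0 k1 k2 : RR (fun _ _ => 0) k1 k2 = 0.
Proof.
have := RR_lin 0 0 (fun _ _ => 0) (fun _ _ => 0) k1 k2.
by rewrite !mul0r !addr0.
Qed.

Lemma rhoN_mk p e : (e < N)%N ->
  rhoN N L (mk p e) = mk (if e == 0%N then p + L%:Z else p) (if e == 0%N then N.-1 else e.-1).
Proof. by move=> he; rewrite /rhoN ec_mk ?pc_mk //; case: eqP. Qed.
Lemma rhoN'_mk p e : (e < N)%N ->
  rhoN' N L (mk p e) = mk (if e == N.-1 then p - L%:Z else p) (if e == N.-1 then 0%N else e.+1).
Proof. by move=> he; rewrite /rhoN' ec_mk ?pc_mk //; case: eqP. Qed.

(** The rotation symmetry of the affine Dynkin diagram. Moving bar 1 past all the others flips the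
    (q^2 - 1)-term of T^s on mixed pairs; the correction which [heck_z1] or [heck_z2] attaches to
    the accompanying factor z compensates it exactly. *)
Lemma isR2_rho B : isR2 B -> isR2 (fun a b => B (rhoN N L a) (rhoN N L b)).
Proof.
move=> /isR2P H; apply/isR2P => p1 p2 e1 e2 h1 h2.
rewrite (@eq_heck _ q L _ (fun p p' => B (mk (if e1 == 0%N then p + L%:Z else p) (if e1 == 0%N then N.-1 else e1.-1))
   (mk (if e2 == 0%N then p' + L%:Z else p') (if e2 == 0%N then N.-1 else e2.-1)))); last first.
  by move=> p p'; rewrite !rhoN_mk.
rewrite !rhoN_mk //; have [z1|z1] := eqVneq e1 0%N; have [z2|z2] := eqVneq e2 0%N.
- rewrite (heck_z12 q hL (fun p p' => B (mk p N.-1) (mk p' N.-1))) H; try by lia.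
  by decide_ifs.
- rewrite (heck_z1 q hL (fun p p' => B (mk p N.-1) (mk p' e2.-1))) H; try by lia.
  by decide_ifs; ring.
- rewrite (heck_z2 q hL (fun p p' => B (mk p e1.-1) (mk p' N.-1))) H; try by lia.
  by decide_ifs; ring.
- rewrite H; try by lia.
  have -> : (e1.-1 == e2.-1) = (e1 == e2) by lia.
  by have -> : (e2.-1 < e1.-1)%N = (e2 < e1)%N by lia.
Qed.

Lemma isR2_rho' B : isR2 B -> isR2 (fun a b => B (rhoN' N L a) (rhoN' N L b)).
Proof.
move=> /isR2P H; apply/isR2P => p1 p2 e1 e2 h1 h2.
rewrite (@eq_heck _ q L _ (fun p p' => B (mk (if e1 == N.-1 then p - L%:Z else p) (if e1 == N.-1 then 0%N else e1.+1))
   (mk (if e2 == N.-1 then p' - L%:Z else p') (if e2 == N.-1 then 0%N else e2.+1)))); last first.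
  by move=> p p'; rewrite !rhoN'_mk.
rewrite !rhoN'_mk //; have [z1|z1] := eqVneq e1 N.-1; have [z2|z2] := eqVneq e2 N.-1.
- rewrite (heck_z12' q hL (fun p p' => B (mk p 0%N) (mk p' 0%N))) H; try by lia.
  by decide_ifs.
- rewrite (heck_z1' q hL (fun p p' => B (mk p 0%N) (mk p' e2.+1))) H; try by lia.
  by decide_ifs; ring.
- rewrite (heck_z2' q hL (fun p p' => B (mk p e1.+1) (mk p' 0%N))) H; try by lia.
  by decide_ifs; ring.
- by rewrite H //; lia.
Qed.

Definition kw (n : nat) (cl : int -> nat) (i : nat) (x : int) : K :=
  q ^ (ind (cl x == i) - ind (cl x == nx n i)).

Definition cop2 (g : int -> bool) (t : int -> int) (l r : int -> K) (B : int -> int -> K) a b : K :=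
  (if g a then r b * B (t a) b else 0) + l a * (if g b then B a (t b) else 0).

Lemma kwN i p e : (i.+1 < N)%N -> (e < N)%N -> kw N (clN N) i.+1 (mk p e) =
  if e == i then q else if e == i.+1 then q^-1 else 1.
Proof.
move=> hi he; rewrite /kw clN_nx ?clN_eq // ec_mk //= /ind.
by do 2 case: eqP; try lia; move=> *; rewrite ?subr0 ?sub0r ?expr1z ?exprN1 ?subrr ?expr0z.
Qed.

(** A nonzero index changes bars only, so T^c passes through by linearity; what remains is the
    commutation of T^s with U_q(sl_N), checked on the positions of the two bars relative to i and i
    + 1. *)
Lemma isR2_E i B : (i.+1 < N)%N -> isR2 B ->
  isR2 (cop2 (fun x => clN N x == nx N i.+1) (rhoN N L) (fun _ => 1) (kw N (clN N) i.+1) B).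
Proof.
move=> hi /isR2P H; apply/isR2P => p1 p2 e1 e2 h1 h2.
have F p p' x y : (x < N)%N -> (y < N)%N ->
    cop2 (fun x => clN N x == nx N i.+1) (rhoN N L) (fun _ => 1) (kw N (clN N) i.+1) B (mk p x) (mk p' y)
    = (if x == i.+1 then (if y == i then q else if y == i.+1 then q^-1 else 1) else 0) * B (mk p i) (mk p' y)
    + (if y == i.+1 then 1 else 0) * B (mk p x) (mk p' i).
  move=> hx hy; rewrite /cop2 !clN_nx // !ec_mk // kwN // !rhoN_mk // mul1r.
  by case: (eqVneq x i.+1) => [->|_]; case: (eqVneq y i.+1) => [->|_] /=; rewrite ?mul0r ?mul1r.
rewrite (eq_heck q L _ _ (fun p p' => F p p' _ _ h1 h2)) heck_lin !F //.
have hi' : (i < N)%N by lia.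
rewrite !H //.
case: (ltngtP e1 i) => c1; case: (ltngtP e2 i) => c2;
case: (ltngtP e1 i.+1) => d1; case: (ltngtP e2 i.+1) => d2; try lia; subst; decide_ifs;
by field.
Qed.

Lemma isR2_F i B : (i.+1 < N)%N -> isR2 B ->
  isR2 (cop2 (fun x => clN N x == i.+1) (rhoN' N L) (fun x => (kw N (clN N) i.+1 x)^-1) (fun _ => 1) B).
Proof.
move=> hi /isR2P H; apply/isR2P => p1 p2 e1 e2 h1 h2.
have F p p' x y : (x < N)%N -> (y < N)%N ->
    cop2 (fun x => clN N x == i.+1) (rhoN' N L) (fun x => (kw N (clN N) i.+1 x)^-1) (fun _ => 1) B
      (mk p x) (mk p' y)
    = (if x == i then 1 else 0) * B (mk p i.+1) (mk p' y)
    + (if y == i then (if x == i then q^-1 else if x == i.+1 then q else 1) else 0)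
      * B (mk p x) (mk p' i.+1).
  move=> hx hy; rewrite /cop2 !clN_eq // !ec_mk // kwN // !rhoN'_mk //=.
  case: (eqVneq x i) => [->|_]; case: (eqVneq y i) => [->|_] /=; decide_ifs;
    rewrite ?mul0r ?mul1r ?mulr0 ?addr0 ?add0r //.
  by case: (eqVneq x i.+1); rewrite ?invrK ?invr1.
rewrite (eq_heck q L _ _ (fun p p' => F p p' _ _ h1 h2)) heck_lin !F // !H //.
case: (ltngtP e1 i) => c1; case: (ltngtP e2 i) => c2;
case: (ltngtP e1 i.+1) => d1; case: (ltngtP e2 i.+1) => d2; try lia; subst; decide_ifs;
by field.
Qed.

End TwoSites.

Section TwoSitesL.
Variables (K : fieldType) (q : K) (N L : nat).
Hypotheses (hN : (1 < N)%N) (hL : (1 < L)%N) (q0 : q != 0).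
Local Notation h := (q ^+ 2 - 1).
Local Notation mk := (mk N).
Local Notation ec := (ec N).
Local Notation pc := (pc N).
Local Notation dcp := (dcp L).
Local Notation SS := (SS L).
Local Notation heck := (heck q L).
Local Notation isR2 := (isR2 q N L).
Local Notation kw := (kw q).

Lemma SS_pred1 (H : int -> int -> K) p1 p2 : SS H (p1 - 1) p2 =
  SS (fun p p' => H (p - 1) p') p1 p2 + (if dcp p1 == dcp p2 then H (p2 - 1) p1 else 0).
Proof.
have := SS_succ1 hL (fun p p' => H (p - 1) p') (p1 - 1) p2; rewrite !subrK => ->.
rewrite subrK /SS; congr osum.
by apply: functional_extensionality => j; rewrite addrK.
Qed.

Lemma SS_pred2 (H : int -> int -> K) p1 p2 : SS H p1 (p2 - 1) =
  SS (fun p p' => H p (p' - 1)) p1 p2 - (if dcp p1 == dcp (p2 - 1) then H (p2 - 1) p1 else 0).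
Proof.
have := SS_succ2 hL (fun p p' => H p (p' - 1)) p1 (p2 - 1); rewrite !subrK => ->.
rewrite !addrK /SS; congr osum.
by apply: functional_extensionality => j; rewrite addrK.
Qed.

(** With d = L - a - 1, the residues d and [sd d] are those moved by the dotted E_a and F_a, and
    [kd d] is the eigenvalue of K_a. *)
Definition sd (d : nat) := if d == L.-1 then 0%N else d.+1.
Definition gd (d : nat) (p : int) : K := if dcp p == d then 1 else 0.
Definition kd (d : nat) (p : int) : K :=
  if dcp p == sd d then q else if dcp p == d then q^-1 else 1.

Lemma SS_comb (a b a' b' : int -> K) (G H : int -> int -> K) p1 p2 :
  (forall p c, a (p + L%:Z * c) = a p) -> (forall p c, b (p + L%:Z * c) = b p) ->
  (forall p c, a' (p + L%:Z * c) = a' p) -> (forall p c, b' (p + L%:Z * c) = b' p) ->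
  SS (fun p p' => a p * b p' * G p p' + a' p * b' p' * H p p') p1 p2 =
  a p1 * b p2 * SS G p1 p2 + a' p1 * b' p2 * SS H p1 p2.
Proof.
move=> ha hb ha' hb'; rewrite -(SS_per G p1 p2 ha hb) -(SS_per H p1 p2 ha' hb').
rewrite -[X in _ = X + _]mul1r -[X in _ = _ + X]mul1r -SS_lin /SS; congr osum.
by apply: functional_extensionality => j; rewrite !mul1r.
Qed.

Lemma gd_per d p c : gd d (p + L%:Z * c) = gd d p.
Proof. by rewrite /gd dcpM. Qed.
Lemma kd_per d p c : kd d (p + L%:Z * c) = kd d p.
Proof. by rewrite /kd dcpM. Qed.

(** The terms of the oriented sum keep both residues, so the periodic factors come out of it. A step
    of one column changes its range only when the residues meet, and these boundary terms are
    absorbed by the coefficients [ne] and the weights [kd]. *)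
Lemma heck_Ed d (G : int -> int -> K) p1 p2 : (d < L)%N ->
  heck (fun p p' => gd d p * 1 * G (p + 1) p' + kd d p * gd d p' * G p (p' + 1)) p1 p2 =
  gd d p1 * heck G (p1 + 1) p2 + kd d p1 * gd d p2 * heck G p1 (p2 + 1).
Proof.
move=> hd; rewrite /heck SS_comb //; try exact: gd_per; try exact: kd_per.
rewrite SS_succ1 // SS_succ2 // /ne !dcpS // /kd /gd /sd.
have h1 := dcp_lt hL p1; have h2 := dcp_lt hL p2.
case: (eqVneq (dcp p1) d) => e1; case: (eqVneq (dcp p2) d) => e2;
  rewrite ?e1 ?e2; case: (eqVneq d L.-1) => e3; decide_ifs;
  repeat (case: ifP => ?; decide_ifs); try lia; by rewrite ?invrK ?invr1; field.
Qed.

Lemma heck_Fd d (G : int -> int -> K) p1 p2 : (d < L)%N ->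
  heck (fun p p' => gd (sd d) p * (kd d p')^-1 * G (p - 1) p' + 1 * gd (sd d) p' * G p (p' - 1)) p1 p2 =
  gd (sd d) p1 * (kd d p2)^-1 * heck G (p1 - 1) p2 + gd (sd d) p2 * heck G p1 (p2 - 1).
Proof.
move=> hd; rewrite /heck SS_comb //; try exact: gd_per; try by move=> p c; rewrite kd_per.
rewrite SS_pred1 // SS_pred2 // /ne !dcpP // /kd /gd /sd.
have h1 := dcp_lt hL p1; have h2 := dcp_lt hL p2.
case: (eqVneq d L.-1) => e3; [have hs: sd d = 0%N by rewrite /sd e3 eqxx|
  have hs : sd d = d.+1 by rewrite /sd; case: eqP e3];
case: (eqVneq (dcp p1) (sd d)) => e1; case: (eqVneq (dcp p2) (sd d)) => e2;
  rewrite hs in e1 e2; rewrite ?e1 ?e2; decide_ifs;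
  repeat (case: ifP => ?; decide_ifs); try lia; by rewrite ?invrK ?invr1; field.
Qed.

Lemma dc_dcp k : dc N L k = dcp (pc k).
Proof. by []. Qed.

Lemma kwL a p e : (a < L)%N -> (e < N)%N -> kw L (clL N L) a (mk p e) = kd (L - a.+1) p.
Proof.
move=> ha he; rewrite /kw clL_nx // clL_eq // dc_dcp pc_mk // /kd /ind.
have -> : sd (L - a.+1) = (if a == 0 then 0 else L - a)%N.
  by rewrite /sd; case: (eqVneq a 0%N) => h0; decide_ifs; lia.
have hne : (if a == 0 then 0 else L - a)%N != (L - a.+1)%N by case: (eqVneq a 0%N); lia.
move: hne; set d := (if _ then _ else _); move=> hne.
case: (eqVneq (dcp p) d) => [->|h1].
  by rewrite (negbTE hne) subr0 expr1z.
by case: eqP; rewrite ?sub0r ?exprN1 ?subrr ?expr0z.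
Qed.

Lemma mk_sub p e : mk p e - N%:Z = mk (p + 1) e.
Proof. by rewrite /mk; ring. Qed.
Lemma mk_add p e : mk p e + N%:Z = mk (p - 1) e.
Proof. by rewrite /mk; ring. Qed.

Lemma isR2_Ed a B : (a < L)%N -> isR2 B ->
  isR2 (cop2 (fun x => clL N L x == nx L a) (fun x => x - N%:Z) (kw L (clL N L) a) (fun _ => 1) B).
Proof.
move=> ha /(isR2P q L hN _) H; apply/(isR2P q L hN _) => p1 p2 e1 e2 h1 h2.
have F p p' x y : (x < N)%N -> (y < N)%N ->
    cop2 (fun x => clL N L x == nx L a) (fun x => x - N%:Z) (kw L (clL N L) a) (fun _ => 1) B
     (mk p x) (mk p' y)
    = gd (L - a.+1) p * 1 * B (mk (p + 1) x) (mk p' y)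
      + kd (L - a.+1) p * gd (L - a.+1) p' * B (mk p x) (mk (p' + 1) y).
  move=> hx hy; rewrite /cop2 !clL_nx // !dc_dcp !pc_mk // kwL // !mk_sub /gd.
  by do 2 case: eqP => _; rewrite ?mul0r ?mul1r ?mulr1 ?mulr0 ?mul0r.
rewrite (eq_heck q L _ _ (fun p p' => F p p' _ _ h1 h2)) !F //.
rewrite (heck_Ed (fun p p' => B (mk p e1) (mk p' e2))); last by lia.
by rewrite !H //; ring.
Qed.

Lemma isR2_Fd a B : (a < L)%N -> isR2 B ->
  isR2 (cop2 (fun x => clL N L x == a) (fun x => x + N%:Z) (fun _ => 1)
    (fun x => (kw L (clL N L) a x)^-1) B).
Proof.
move=> ha /(isR2P q L hN _) H; apply/(isR2P q L hN _) => p1 p2 e1 e2 h1 h2.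
have hs : sd (L - a.+1) = (if a == 0 then 0 else L - a)%N.
  by rewrite /sd; case: (eqVneq a 0%N) => h0; decide_ifs; lia.
have F p p' x y : (x < N)%N -> (y < N)%N ->
    cop2 (fun x => clL N L x == a) (fun x => x + N%:Z) (fun _ => 1)
    (fun x => (kw L (clL N L) a x)^-1) B (mk p x) (mk p' y)
    = gd (sd (L - a.+1)) p * (kd (L - a.+1) p')^-1 * B (mk (p - 1) x) (mk p' y)
      + 1 * gd (sd (L - a.+1)) p' * B (mk p x) (mk (p' - 1) y).
  move=> hx hy; rewrite /cop2 !clL_eq // !dc_dcp !pc_mk // kwL // !mk_add /gd hs.
  by do 2 case: eqP => _; rewrite ?mul0r ?mul1r ?mulr1 ?mulr0 ?mul0r.
rewrite (eq_heck q L _ _ (fun p p' => F p p' _ _ h1 h2)) !F //.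
rewrite (heck_Fd (fun p p' => B (mk p e1) (mk p' e2))); last by lia.
by rewrite !H //; ring.
Qed.

Lemma ec_rho1 x : (ec (rhoN' N L x) == 1%N) = (ec x == 0%N).
Proof. by rewrite ec_rhoN' //; have := ec_lt hN x; case: (eqVneq (ec x) N.-1); lia. Qed.

Lemma kw_rho1 x : kw N (clN N) 1 (rhoN' N L x) = kw N (clN N) 0 x.
Proof.
have hx := ec_lt hN x; rewrite /kw !clN_nx // ?clN_eq //=; try lia.
by rewrite ec_rhoN' //; congr (q ^ (ind _ - ind _)); case: (eqVneq (ec x) N.-1); lia.
Qed.

(** E_0 is the conjugate of E_1 by the rotation [rhoN]; index 1 is a nonzero index because N >=
    2. *)
Lemma isR2_E0 B : isR2 B ->
  isR2 (cop2 (fun x => clN N x == nx N 0) (rhoN N L) (fun _ => 1) (kw N (clN N) 0) B).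
Proof.
move=> H; have := isR2_rho' hN hL q0 (isR2_E hN hL q0 hN (isR2_rho hN hL q0 H)).
move=> H' k1 k2; rewrite -[RHS](H' k1 k2); congr RR.
do 2 apply: functional_extensionality => ?; rewrite /cop2 !clN_nx //; try lia.
by rewrite !ec_rho1 !rhoNK' // kw_rho1.
Qed.

Lemma isR2_F0 B : isR2 B ->
  isR2 (cop2 (fun x => clN N x == 0%N) (rhoN' N L) (fun x => (kw N (clN N) 0 x)^-1) (fun _ => 1) B).
Proof.
move=> H; have := isR2_rho' hN hL q0 (isR2_F hN hL q0 hN (isR2_rho hN hL q0 H)).
move=> H' k1 k2; rewrite -[RHS](H' k1 k2); congr RR.
do 2 apply: functional_extensionality => ?; rewrite /cop2 !clN_eq //; try lia.
have E x : (ec (rhoN' N L x) == 0%N) = (ec x == N.-1).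
  by rewrite ec_rhoN' //; have := ec_lt hN x; case: (eqVneq (ec x) N.-1); lia.
by rewrite /= !E !rhoNK' // kw_rho1.
Qed.

Lemma isR2_EN i B : (i < N)%N -> isR2 B ->
  isR2 (cop2 (fun x => clN N x == nx N i) (rhoN N L) (fun _ => 1) (kw N (clN N) i) B).
Proof. by case: i => [|i] hi; [apply: isR2_E0|apply: isR2_E]. Qed.

Lemma isR2_FN i B : (i < N)%N -> isR2 B ->
  isR2 (cop2 (fun x => clN N x == i) (rhoN' N L) (fun x => (kw N (clN N) i x)^-1) (fun _ => 1) B).
Proof. by case: i => [|i] hi; [apply: isR2_F0|apply: isR2_F]. Qed.

(** * Vanishing and exchange inside blocks *)

(** Equal powers of z leave at most the term j = 0 in the oriented sum, so the relation stays inside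
    the block. *)
Lemma heck_block (G : int -> int -> K) m d1 d2 : (d1 < L)%N -> (d2 < L)%N ->
  let p1 := L%:Z * m + d1%:Z + 1 in let p2 := L%:Z * m + d2%:Z + 1 in
  heck G p1 p2 = - (if d1 == d2 then 1 else q) * G p2 p1 + (if (d1 < d2)%N then h else 0) * G p1 p2.
Proof.
move=> h1 h2 p1 p2.
have e1 : dcp p1 = d1 by apply: (dcp_uniq (c := m)); rewrite // /p1 mulrC.
have e2 : dcp p2 = d2 by apply: (dcp_uniq (c := m)); rewrite // /p2 mulrC.
rewrite /heck /ne e1 e2 /SS.
rewrite (@cnt_dcp _ hL _ _ m m) ?e1 ?e2; try by rewrite /p1 /p2 mulrC.
have o1 (g : int -> K) : osum g 1 = g 0 by rewrite -[1]add0r osumS osum0 add0r.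
rewrite subrr add0r; case: (d1 < d2)%N.
  by rewrite o1 mulr0 addr0 subr0.
by rewrite osum0 mulr0 mul0r.
Qed.

(** One power of z apart, the sum consists of the term j = 0 and, when d1 < d2, of the term j = 1,
    which exchanges the two powers of z. *)
Lemma heck_block2 (G : int -> int -> K) m d1 d2 : (d1 < L)%N -> (d2 < L)%N ->
  let p1 := L%:Z * m + d1%:Z + 1 in let p2 := L%:Z * (m + 1) + d2%:Z + 1 in
  heck G p1 p2 = - (if d1 == d2 then 1 else q) * G p2 p1 + h * G p1 p2
    + (if (d1 < d2)%N then h else 0) * G (L%:Z * (m + 1) + d1%:Z + 1) (L%:Z * m + d2%:Z + 1).
Proof.
move=> h1 h2 p1 p2.
have e1 : dcp p1 = d1 by apply: (dcp_uniq (c := m)); rewrite // /p1 mulrC.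
have e2 : dcp p2 = d2 by apply: (dcp_uniq (c := m + 1)); rewrite // /p2 mulrC.
rewrite /heck /ne e1 e2 /SS.
rewrite (@cnt_dcp _ hL _ _ m (m + 1)) ?e1 ?e2; try by rewrite /p1 /p2 mulrC.
have -> : m + 1 - m = 1 by ring.
have o1 (g : int -> K) : osum g 1 = g 0 by rewrite -[1]add0r osumS osum0 add0r.
case: (d1 < d2)%N.
  rewrite osumS o1 mulr0 addr0 subr0 mulr1 mulrDr.
  have -> : p1 + L%:Z = L%:Z * (m + 1) + d1%:Z + 1 by rewrite /p1; ring.
  have -> : p2 - L%:Z = L%:Z * m + d2%:Z + 1 by rewrite /p2; ring.
  by rewrite addrA.
by rewrite addr0 o1 mulr0 addr0 subr0 mul0r addr0.
Qed.

End TwoSitesL.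

Section Blocks.
Variables (K : fieldType) (q : K) (N L : nat).
Hypotheses (hN : (1 < N)%N) (hL : (1 < L)%N) (q0 : q != 0) (q2 : 1 + q ^+ 2 != 0).
Local Notation h := (q ^+ 2 - 1).
Local Notation mk := (mk N).
Local Notation ec := (ec N).
Local Notation pc := (pc N).
Local Notation dc := (dc N L).
Local Notation bk := (bk N L).
Local Notation heck := (heck q L).
Local Notation isR2 := (isR2 q N L).

Definition lt3 (m : int) (d e : nat) : int := mk (L%:Z * m + d%:Z + 1) e.

Lemma lt3K k : lt3 (bk k) (dc k) (ec k) = k.
Proof. by rewrite /lt3 -pcE // mkK. Qed.

Lemma rel_block B m d1 d2 e1 e2 : isR2 B -> (d1 < L)%N -> (d2 < L)%N -> (e1 < N)%N -> (e2 < N)%N ->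
  - (if d1 == d2 then 1 else q) * B (lt3 m d2 e1) (lt3 m d1 e2)
  + (if (d1 < d2)%N then h else 0) * B (lt3 m d1 e1) (lt3 m d2 e2)
  = (if e1 == e2 then q ^+ 2 else q) * B (lt3 m d1 e2) (lt3 m d2 e1)
    + (if (e2 < e1)%N then h else 0) * B (lt3 m d1 e1) (lt3 m d2 e2).
Proof.
move=> /(isR2P q L hN) H hd1 hd2 he1 he2.
have := H (L%:Z * m + d1%:Z + 1) (L%:Z * m + d2%:Z + 1) e1 e2 he1 he2.
by rewrite (heck_block q hL).
Qed.

Lemma rel_block2 B m d1 d2 e1 e2 : isR2 B -> (d1 < L)%N -> (d2 < L)%N -> (e1 < N)%N -> (e2 < N)%N ->
  - (if d1 == d2 then 1 else q) * B (lt3 (m + 1) d2 e1) (lt3 m d1 e2)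
  + h * B (lt3 m d1 e1) (lt3 (m + 1) d2 e2)
  + (if (d1 < d2)%N then h else 0) * B (lt3 (m + 1) d1 e1) (lt3 m d2 e2)
  = (if e1 == e2 then q ^+ 2 else q) * B (lt3 m d1 e2) (lt3 (m + 1) d2 e1)
    + (if (e2 < e1)%N then h else 0) * B (lt3 m d1 e1) (lt3 (m + 1) d2 e2).
Proof.
move=> /(isR2P q L hN) H hd1 hd2 he1 he2.
have := H (L%:Z * m + d1%:Z + 1) (L%:Z * (m + 1) + d2%:Z + 1) e1 e2 he1 he2.
by rewrite (heck_block2 q hL).
Qed.

Lemma ec_lt3 m d e : (e < N)%N -> ec (lt3 m d e) = e.
Proof. by move=> he; rewrite ec_mk. Qed.
Lemma dc_lt3 m d e : (e < N)%N -> (d < L)%N -> dc (lt3 m d e) = d.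
Proof. by move=> he hd; rewrite dc_mk. Qed.
Lemma bk_lt3 m d e : (e < N)%N -> (d < L)%N -> bk (lt3 m d e) = m.
Proof. by move=> he hd; rewrite bk_mk. Qed.

(** What is needed to sort the letters of one block by class. The rules only transfer vanishing, so
    the coefficients of the relations never have to be followed. *)
Definition exch_class (c : int -> nat) :=
  forall B, isR2 B ->
  [/\ forall x y, bk x = bk y -> c x != c y ->
        (forall x' y', bk x' = bk x -> bk y' = bk x -> c x' = c x -> c y' = c y -> B y' x' = 0) ->
        B x y = 0,
      forall x y, bk x = bk y -> c x = c y -> B y x = 0 -> B x y = 0
    & forall x, B x x = 0].

(** On a repeated letter T^c is -1 and T^s is q^2. *)
Lemma rel_diag B x : isR2 B -> B x x = 0.
Proof.
move=> H; have := rel_block (bk x) H (dc_lt hN hL x) (dc_lt hN hL x) (ec_lt hN x) (ec_lt hN x).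
rewrite !lt3K !eqxx !ltnn !mul0r !addr0 mulN1r => /eqP.
by rewrite eq_sym -addr_eq0 addrC -[X in X + _]mul1r -mulrDl mulf_eq0 (negbTE q2) => /eqP.
Qed.

Lemma exch_ec : exch_class ec.
Proof.
move=> B H; split=> [x y hb hne hv|x y hb he hv|x]; last exact: rel_diag.
  have ex : lt3 (bk x) (dc x) (ec x) = x by rewrite lt3K.
  have ey : lt3 (bk x) (dc y) (ec y) = y by rewrite hb lt3K.
  have v1 : B y x = 0 by apply: hv.
  have v2 : B (lt3 (bk x) (dc x) (ec y)) (lt3 (bk x) (dc y) (ec x)) = 0.
    by apply: hv; rewrite ?bk_lt3 ?ec_lt3 ?dc_lt ?ec_lt.
  have := rel_block (bk x) H (dc_lt hN hL x) (dc_lt hN hL y) (ec_lt hN y) (ec_lt hN x).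
  rewrite ex ey v1 v2 !mulr0 !addr0 eq_sym (negbTE hne) => /esym/eqP.
  by rewrite mulf_eq0 (negbTE q0) => /eqP.
have [e|hd] := eqVneq (dc x) (dc y).
  by have -> : x = y; [rewrite -(lt3K x) hb e he lt3K|apply: rel_diag].
have ex : lt3 (bk x) (dc x) (ec x) = x by rewrite lt3K.
have ey : lt3 (bk x) (dc y) (ec x) = y by rewrite hb he lt3K.
have [hlt|hle] := ltnP (dc x) (dc y).
  have := rel_block (bk x) H (dc_lt hN hL x) (dc_lt hN hL y) (ec_lt hN x) (ec_lt hN x).
  rewrite ex ey eqxx ltnn (negbTE hd) hlt hv mulr0 add0r mul0r addr0 => /eqP.
  by rewrite eq_sym -subr_eq0 -mulrBl mulf_eq0 opprB addrC subrK oner_eq0 => /eqP.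
have := rel_block (bk x) H (dc_lt hN hL y) (dc_lt hN hL x) (ec_lt hN x) (ec_lt hN x).
rewrite ex ey hv eqxx ltnn eq_sym (negbTE hd) !mul0r !mulr0 !addr0 => /eqP.
by rewrite mulf_eq0 oppr_eq0 (negbTE q0) => /eqP.
Qed.

Lemma exch_dc : exch_class dc.
Proof.
move=> B H; split=> [x y hb hne hv|x y hb hd hv|x]; last exact: rel_diag.
  have := rel_block (bk x) H (dc_lt hN hL y) (dc_lt hN hL x) (ec_lt hN x) (ec_lt hN y).
  have ex : lt3 (bk x) (dc x) (ec x) = x by rewrite lt3K.
  have ey : lt3 (bk x) (dc y) (ec y) = y by rewrite hb lt3K.
  have v1 : B y x = 0 by apply: hv.
  have v2 : B (lt3 (bk x) (dc y) (ec x)) (lt3 (bk x) (dc x) (ec y)) = 0.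
    by apply: hv; rewrite ?bk_lt3 ?dc_lt3 ?dc_lt ?ec_lt.
  rewrite ex ey eq_sym (negbTE hne) v1 v2 !mulr0 !addr0 => /eqP.
  by rewrite mulf_eq0 oppr_eq0 (negbTE q0) => /eqP.
have [e|he] := eqVneq (ec x) (ec y).
  by have -> : x = y; [rewrite -(lt3K x) hb e hd lt3K|apply: rel_diag].
have ex : lt3 (bk x) (dc x) (ec x) = x by rewrite lt3K.
have ey : lt3 (bk x) (dc x) (ec y) = y by rewrite hb hd lt3K.
have [hlt|hle] := ltnP (ec x) (ec y).
  have := rel_block (bk x) H (dc_lt hN hL x) (dc_lt hN hL x) (ec_lt hN x) (ec_lt hN y).
  rewrite ex ey hv eqxx ltnn (negbTE he) ltnNge (ltnW hlt) /= !mul0r mulr0 !addr0 => /eqP.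
  by rewrite mulf_eq0 oppr_eq0 oner_eq0 => /eqP.
have := rel_block (bk x) H (dc_lt hN hL x) (dc_lt hN hL x) (ec_lt hN y) (ec_lt hN x).
rewrite ex ey hv eqxx ltnn eq_sym (negbTE he) ltnNge hle /= !mul0r mulr0 !addr0 => /esym/eqP.
by rewrite mulf_eq0 (negbTE q0) => /eqP.
Qed.

Lemma exch_eq_class c c' : (forall x y, (c x == c y) = (c' x == c' y)) -> exch_class c -> exch_class c'.
Proof.
move=> e H B /H [H1 H2 H3]; split=> // x y hb hc.
  move=> hv; apply: H1 => //; first by rewrite e.
  by move=> x' y' hx hy /eqP; rewrite e => /eqP ex /eqP; rewrite e => /eqP ey; apply: hv.
by apply: H2 => //; apply/eqP; rewrite e hc.
Qed.

Lemma exch_clN : exch_class (clN N).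
Proof. exact: exch_eq_class (clN_inj hN) exch_ec. Qed.
Lemma exch_clL : exch_class (clL N L).
Proof. exact: exch_eq_class (clL_inj hN hL) exch_dc. Qed.

Definition isR (f : seq int -> K) :=
  forall pre post, isR2 (fun a b => f (pre ++ a :: b :: post)).

Definition inblk (m : int) (b : seq int) := all (fun x => bk x == m) b.

Section CountClass.
Variables (c : int -> nat) (l : nat).
Hypothesis hc : exch_class c.
Hypothesis hl : forall m g s, uniq s -> inblk m s -> all (fun x => c x == g) s -> (size s <= l)%N.

(** One copy of x travels across the letters of its own class until it meets the other copy. *)
Lemma same_class_dup f m g x u : isR f -> bk x = m -> c x = g -> inblk m u ->
  all (fun y => c y == g) u -> forall p s, f (p ++ x :: u ++ x :: s) = 0.
Proof.
move=> Hf hx cx; elim: u => [|y u IH] /=.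
  by move=> _ _ p s; have [_ _] := hc (Hf p s); apply.
move=> /andP [/eqP hy hu] /andP [/eqP cy cu] p s.
have [_ H _] := hc (Hf p (u ++ x :: s)).
apply: H; rewrite ?hx ?cx //.
by rewrite -cat_rcons; apply: IH.
Qed.

Lemma not_uniq_split (s : seq int) : ~~ uniq s -> exists x s1 s2 s3, s = s1 ++ x :: s2 ++ x :: s3.
Proof.
elim: s => //= y s IH; rewrite negb_and negbK => /orP [|/IH].
  by case/splitPr=> s2 s3; exists y, [::], s2, s3.
by move=> [x [s1 [s2 [s3 ->]]]]; exists x, (y :: s1), s2, s3.
Qed.

(** Pigeonhole: once the letters of class g are gathered in front, more than l of them cannot be
    distinct, and a repetition among letters of one class gives zero. *)
Lemma count_class f m g b p s : isR f -> inblk m b -> (l < count (fun x => c x == g) b)%N ->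
  f (p ++ b ++ s) = 0.
Proof.
move=> Hf.
(* An exchange of classes may replace the letters themselves, so the sorting is done on class
   patterns, treating all words of the block with a given pattern together. *)
pose Z (G : seq nat) := forall p s b, inblk m b -> map c b = G -> f (p ++ b ++ s) = 0.
have swap G1 g1 g2 G2 : Z (G1 ++ g2 :: g1 :: G2) -> Z (G1 ++ g1 :: g2 :: G2).
  move=> HZ p1 s1 b1; have [e|hne] := eqVneq g1 g2 => hb hm; first by apply: HZ hb _; rewrite hm e.
  have : [/\ b1 = take (size G1) b1 ++ drop (size G1) b1, map c (take (size G1) b1) = G1 &
    map c (drop (size G1) b1) = g1 :: g2 :: G2].
    by split; rewrite ?cat_take_drop ?map_take ?map_drop ?hm ?take_size_cat ?drop_size_cat.
  move: (take _ _) (drop _ _) => u v [e hu hv]; move: v e hv hb.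
  case=> [|x [|y v]] //= -> [hx hy hv]; rewrite /inblk all_cat /= => /and4P [bu /eqP bx /eqP by' bv].
  have [H _ _] := hc (Hf (p1 ++ u) (v ++ s1)).
  rewrite -catA /= catA; apply: H; rewrite ?bx ?by' ?hx ?hy // => x' y' ex ey cx cy.
  rewrite -catA -[y' :: x' :: v ++ s1]/((y' :: x' :: v) ++ s1) (catA u); apply: HZ.
    by rewrite /inblk all_cat /= bu ex ey !eqxx.
  by rewrite map_cat /= hu cx cy hv.
have mv k G0 x r : Z (G0 ++ nseq k g ++ x :: r) -> Z (G0 ++ x :: nseq k g ++ r).
  elim: k G0 => //= k IH G0 HZ; apply: swap; rewrite -cat_rcons; apply: IH.
  by rewrite cat_rcons.
have sortG G : forall G0, Z (G0 ++ nseq (count_mem g G) g ++ [seq x <- G | x != g]) -> Z (G0 ++ G).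
  elim: G => [|x G IH] G0 /=; first by rewrite cats0.
  have [->|hne] := eqVneq x g; first by move=> HZ; rewrite -cat_rcons; apply: IH; rewrite cat_rcons.
  by move=> /mv HZ; rewrite -cat_rcons; apply: IH; rewrite cat_rcons.
move=> hb hcount; have : Z (map c b); last by apply.
rewrite -[map c b]cat0s; apply: sortG => p1 s1 b1 hb1 /= hm.
set k := count_mem g (map c b) in hm.
have hk : (l < k)%N by move: hcount; rewrite /k count_map; congr (_ < _)%N; apply: eq_count.
have ht : map c (take k b1) = nseq k g by rewrite map_take hm take_size_cat ?size_nseq.
have hall : all (fun x => c x == g) (take k b1).
  by have : all (pred1 g) (map c (take k b1)) by [rewrite ht all_pred1_nseq]; rewrite all_map.
have hsz : size (take k b1) = k by have := congr1 size ht; rewrite size_map size_nseq.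
have hbt : inblk m (take k b1) by apply/allP => x /mem_take; move/allP: hb1; apply.
have : ~~ uniq (take k b1).
  by apply/negP => hu; have := hl hu hbt hall; rewrite hsz leqNgt hk.
move=> /not_uniq_split [x [s2 [s3 [s4 e]]]].
rewrite -{1}(cat_take_drop k b1) e -!catA /= -catA /= catA.
move: hall hbt; rewrite e /inblk !all_cat /= !all_cat /=.
move=> /and3P [_ /eqP cx /and3P [c3 _ _]] /and3P [_ /eqP bx /and3P [b3 _ _]].
exact: (same_class_dup Hf bx cx).
Qed.

End CountClass.

(** In a given block and with a given bar, a letter is determined by its dot index. *)
Lemma size_class_ec m g s : uniq s -> inblk m s -> all (fun x => clN N x == g) s -> (size s <= L)%N.
Proof.
move=> hu hb hg; have := @uniq_leq_size _ (map dc s) (iota 0 L).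
rewrite size_map size_iota; apply.
  rewrite map_inj_in_uniq // => x y hx hy e.
  rewrite -(lt3K x) -(lt3K y) e; have /eqP -> := allP hb _ hx; have /eqP -> := allP hb _ hy.
  by congr lt3; apply/eqP; rewrite (clN_inj hN) (eqP (allP hg _ hx)) (eqP (allP hg _ hy)).
by move=> d /mapP [x hx ->]; rewrite mem_iota /= add0n dc_lt.
Qed.

Lemma size_class_dc m g s : uniq s -> inblk m s -> all (fun x => clL N L x == g) s -> (size s <= N)%N.
Proof.
move=> hu hb hg; have := @uniq_leq_size _ (map ec s) (iota 0 N).
rewrite size_map size_iota; apply.
  rewrite map_inj_in_uniq // => x y hx hy e.
  rewrite -(lt3K x) -(lt3K y) e; have /eqP -> := allP hb _ hx; have /eqP -> := allP hb _ hy.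
  by congr lt3; apply/eqP; rewrite (clL_inj hN hL) (eqP (allP hg _ hx)) (eqP (allP hg _ hy)).
by move=> d /mapP [x hx ->]; rewrite mem_iota /= add0n ec_lt.
Qed.

(** Once the pairs with block m in front are killed, the relation between neighbouring blocks is
    triangular in the dot indices: the pairs whose first dot index is at most the second vanish by
    themselves, and the others follow from them. *)
Lemma exch_blocks B m x y : isR2 B -> bk x = m -> bk y = m + 1 ->
  (forall a b, bk a = m -> bk b = m + 1 ->
     (ec a = ec x /\ ec b = ec y) \/ (ec a = ec y /\ ec b = ec x) ->
     (dc a = dc x /\ dc b = dc y) \/ (dc a = dc y /\ dc b = dc x) -> B a b = 0) ->
  B y x = 0.
Proof.
move=> H bx by' hv.
pose U d d' := B (lt3 (m + 1) d (ec y)) (lt3 m d' (ec x)).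
have he := ec_lt hN x; have he' := ec_lt hN y; have hd := dc_lt hN hL x; have hd' := dc_lt hN hL y.
have R d1 d2 : (d1 = dc x /\ d2 = dc y) \/ (d1 = dc y /\ d2 = dc x) ->
    - (if d1 == d2 then 1 else q) * U d2 d1 + (if (d1 < d2)%N then h else 0) * U d1 d2 = 0.
  move=> hdd; have [h1 h2] : (d1 < L)%N /\ (d2 < L)%N by case: hdd => [] [-> ->].
  have := rel_block2 m H h1 h2 he' he.
  rewrite !(hv (lt3 m d1 _) (lt3 (m + 1) d2 _)) ?bk_lt3 ?ec_lt3 ?dc_lt3 //; try (by [left|right]);
    try (by case: hdd => [] [-> ->]; [left|right]).
  by rewrite !mulr0 !addr0.
have U0 d d' : (d' = dc x /\ d = dc y) \/ (d' = dc y /\ d = dc x) -> (d <= d')%N -> U d d' = 0.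
  move=> hdd hle; have := R d' d hdd; rewrite ltnNge hle /= mul0r addr0 => /eqP.
  rewrite mulf_eq0 oppr_eq0 => /orP [|/eqP //].
  by case: ifP; rewrite ?oner_eq0 ?(negbTE q0).
have -> : B y x = U (dc y) (dc x) by rewrite /U -by' -bx !lt3K.
have [hle|hlt] := leqP (dc y) (dc x); first by apply: U0 => //; left.
have := R (dc x) (dc y) (or_introl (conj erefl erefl)).
rewrite (U0 (dc x) (dc y)) ?mulr0 ?addr0; last by apply: ltnW.
  move=> /eqP; rewrite mulf_eq0 oppr_eq0 => /orP [|/eqP //].
  by case: ifP; rewrite ?oner_eq0 ?(negbTE q0).
by right.
Qed.

(** When dot and bar index increase together, T^c and T^s contribute the same (q^2 - 1)-term, which
    cancels. *)
Lemma clean_swap B x y : isR2 B -> bk x = bk y -> (dc x < dc y)%N -> (ec x < ec y)%N -> B x y = - B y x.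
Proof.
move=> H hb hd he.
have := rel_block (bk x) H (dc_lt hN hL x) (dc_lt hN hL y) (ec_lt hN y) (ec_lt hN x).
have ex : lt3 (bk x) (dc x) (ec x) = x by rewrite lt3K.
have ey : lt3 (bk x) (dc y) (ec y) = y by rewrite hb lt3K.
rewrite ex ey hd he; have -> : (dc x == dc y) = false by lia.
have -> : (ec y == ec x) = false by lia.
move=> /addIr /eqP; rewrite mulNr -mulrN => /eqP /(mulfI q0) <-.
by [].
Qed.

End Blocks.

(** * Coproduct operators on words *)

Section Coproduct.
Variables (K : fieldType).
Implicit Types (g : int -> bool) (t : int -> int) (l r : int -> K) (f : seq int -> K).

Definition pr r (w : seq int) : K := \prod_(y <- w) r y.

Lemma pr_nil r : pr r [::] = 1. Proof. by rewrite /pr big_nil. Qed.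
Lemma pr_cons r x w : pr r (x :: w) = r x * pr r w. Proof. by rewrite /pr big_cons. Qed.
Lemma pr_cat r u v : pr r (u ++ v) = pr r u * pr r v. Proof. by rewrite /pr big_cat. Qed.

(* Transpose of an operator acting through an iterated coproduct: the letter map is [t] on the
   letters satisfying [g], weighted by [l] on the letters to the left and [r] on those to the right. *)
Fixpoint cop g t l r (w : seq int) f : K :=
  if w is x :: w' then
    (if g x then pr r w' * f (t x :: w') else 0) + l x * cop g t l r w' (fun v => f (x :: v))
  else 0.

Lemma cop_lin g t l r a b f f' w :
  cop g t l r w (fun v => a * f v + b * f' v) = a * cop g t l r w f + b * cop g t l r w f'.
Proof.
elim: w f f' => [|x w IH] f f' /=; first by rewrite !mulr0 addr0.
by rewrite IH; case: ifP => _; ring.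
Qed.

Lemma cop_cat g t l r u v f : cop g t l r (u ++ v) f =
  pr r v * cop g t l r u (fun u' => f (u' ++ v)) + pr l u * cop g t l r v (fun v' => f (u ++ v')).
Proof.
elim: u f => [|x u IH] f /=; first by rewrite mulr0 add0r pr_nil mul1r.
by rewrite IH pr_cat pr_cons; case: ifP => _; ring.
Qed.

(** Only the words really produced from w are compared, so f and f' may be related merely on words
    of one length, or by an eigenvalue that depends on the letter moved. *)
Lemma cop_scale g t l r c f f' w :
  (forall u x v, w = u ++ x :: v -> g x -> f (u ++ t x :: v) = c * f' (u ++ t x :: v)) ->
  cop g t l r w f = c * cop g t l r w f'.
Proof.
elim: w f f' => [|x w IH] f f' H /=; first by rewrite mulr0.
rewrite (IH _ (fun v => f' (x :: v))); last by move=> u y v e gy; apply: (H (x :: u)); rewrite ?e.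
by case: ifP => gx; rewrite ?(H [::] x w) //=; ring.
Qed.

Lemma cop_eq0 g t l r w f :
  (forall u x v, w = u ++ x :: v -> g x -> f (u ++ t x :: v) = 0) -> cop g t l r w f = 0.
Proof.
elim: w f => [|x w IH] f H //=.
rewrite IH ?mulr0 ?addr0; last by move=> u y v e gy; apply: (H (x :: u)); rewrite ?e.
by case: ifP => gx //; rewrite (H [::]) ?mulr0.
Qed.

End Coproduct.

(** * Vacuum blocks as words *)

Section VacuumBlocks.
Variables (N L : nat).
Hypotheses (hN : (1 < N)%N) (hL : (1 < L)%N).
Local Notation bk := (bk N L).

Lemma mem_vbar m k : bk k = m%:Z -> k \in vbar N L m.
Proof.
move=> hb; have he := ec_lt hN k; have hd := dc_lt hN hL k.
apply/mapP; exists (N * dc N L k + (N.-1 - ec N k))%N.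
  by rewrite mem_iota /= add0n; nia.
by rewrite -{1}(lt3K hN hL k) hb /lt3 /mk; nia.
Qed.

Lemma vbar_blk m k : k \in vbar N L m -> bk k = m%:Z.
Proof.
case/mapP=> j; rewrite mem_iota /= add0n => hj ->.
have -> : - (N * L * m)%:Z - j%:Z = lt3 N L m%:Z (j %/ N) (N.-1 - j %% N).
  by rewrite /lt3 /mk; have := divn_eq j N; have := ltn_pmod j (ltnW hN); nia.
by rewrite bk_lt3 //; first lia; rewrite ltn_divLR; lia.
Qed.

Lemma vbar_sorted m : pairwise (fun x y : int => y < x) (vbar N L m).
Proof.
rewrite /vbar pairwise_map.
have := iota_ltn_sorted 0 (N * L); rewrite sorted_pairwise; last exact: ltn_trans.
by apply: sub_pairwise => i j hij /=; lia.
Qed.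

Lemma vbar_uniq m : uniq (vbar N L m).
Proof.
apply: (pairwise_uniq (r := fun x y : int => y < x)) (vbar_sorted m) => x.
by rewrite ltxx.
Qed.

(** The word [vbar m] lists every letter of block m once, so it attains the maximal number of
    letters of each class. *)
Lemma vbar_count (c : int -> nat) l m g :
  (forall s, uniq s -> inblk N L m%:Z s -> all (fun x => c x == g) s -> (size s <= l)%N) ->
  (exists s, [/\ uniq s, inblk N L m%:Z s, all (fun x => c x == g) s & size s = l]) ->
  count (fun x => c x == g) (vbar N L m) = l.
Proof.
move=> hle [s [us bs cs es]]; rewrite -size_filter; apply/eqP; rewrite eqn_leq; apply/andP; split.
  apply: hle; rewrite ?filter_uniq ?vbar_uniq ?filter_all //.
  by apply/allP => x; rewrite mem_filter => /andP [_ /vbar_blk ->].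
rewrite -es; apply: uniq_leq_size => // x hx; rewrite mem_filter (allP cs _ hx) /=.
by apply: mem_vbar; apply/eqP/(allP bs).
Qed.

Lemma vbar_count_clN m g : (g < N)%N -> count (fun x => clN N x == g) (vbar N L m) = L.
Proof.
move=> hg; apply: vbar_count => [s|]; first exact: size_class_ec.
pose e := if g == 0%N then N.-1 else g.-1.
have he : (e < N)%N by rewrite /e; case: eqP; lia.
exists [seq lt3 N L m%:Z d e | d <- iota 0 L]; split; last by rewrite size_map size_iota.
- rewrite map_inj_in_uniq ?iota_uniq // => d d'; rewrite !mem_iota /= !add0n => hd hd' /(congr1 (dc N L)).
  by rewrite !dc_lt3.
- by apply/allP => x /mapP [d]; rewrite mem_iota /= add0n => hd ->; rewrite bk_lt3.
- by apply/allP => x /mapP [d hd ->]; rewrite clN_eq // ec_lt3 // eqxx.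
Qed.

Lemma vbar_count_clL m g : (g < L)%N -> count (fun x => clL N L x == g) (vbar N L m) = N.
Proof.
move=> hg; apply: vbar_count => [s|]; first exact: size_class_dc.
pose d := (if g == 0 then 0 else L - g)%N.
have hd : (d < L)%N by rewrite /d; case: eqP; lia.
exists [seq lt3 N L m%:Z d e | e <- iota 0 N]; split; last by rewrite size_map size_iota.
- rewrite map_inj_in_uniq ?iota_uniq // => e e'; rewrite !mem_iota /= !add0n => he he' /(congr1 (ec N)).
  by rewrite !ec_lt3.
- by apply/allP => x /mapP [e]; rewrite mem_iota /= add0n => he ->; rewrite bk_lt3.
- apply/allP => x /mapP [e]; rewrite mem_iota /= add0n => he ->.
  by rewrite clL_eq // dc_lt3 // eqxx.
Qed.

End VacuumBlocks.

Section CoproductR.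
Variables (K : fieldType) (q : K) (N L : nat).
Hypotheses (hN : (1 < N)%N) (hL : (1 < L)%N) (q0 : q != 0) (q2 : 1 + q ^+ 2 != 0).
Local Notation isR2 := (isR2 q N L).
Local Notation isR := (isR q N L).
Local Notation RR := (RR q N L).
Local Notation bk := (bk N L).

(** The diagonal operator u (x) u commutes with T^c - T^s; the K_i and their inverses are of this
    kind. *)
Definition RRconst (u : int -> K) := forall B k1 k2,
  RR (fun a b => u a * u b * B a b) k1 k2 = u k1 * u k2 * RR B k1 k2.

Lemma RR_cop g t l r w (F : int -> int -> seq int -> K) k1 k2 :
  (forall v, RR (fun a b => F a b v) k1 k2 = 0) -> RR (fun a b => cop g t l r w (F a b)) k1 k2 = 0.
Proof.
elim: w F => [|x w IH] F H /=; first exact: RR0.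
have := IH (fun a b v => F a b (x :: v)) (fun v => H (x :: v)).
case: (g x) => IH'; last first.
  have := RR_lin q N L 0 (l x) (fun a b => 0) (fun a b => cop g t l r w (fun v => F a b (x :: v))) k1 k2.
  by rewrite !mul0r IH' mulr0 addr0.
have := RR_lin q N L (pr r w) (l x) (fun a b => F a b (t x :: w))
  (fun a b => cop g t l r w (fun v => F a b (x :: v))) k1 k2.
by rewrite IH' H !mulr0 addr0.
Qed.

(** The letter acted on lies before, inside or after the pair of the relation. Outside, the pair
    only meets a grouplike factor; inside, the two-letter statement [cop2] decides. *)
Lemma isR_cop g t l r f : RRconst l -> RRconst r ->
  (forall B, isR2 B -> isR2 (cop2 g t l r B)) -> isR f -> isR (fun w => cop g t l r w f).
Proof.
move=> hl hr h2 Hf pre post k1 k2.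
have E a b : cop g t l r (pre ++ a :: b :: post) f =
    pr r post * (r a * r b * cop g t l r pre (fun u => f (u ++ a :: b :: post)))
    + pr l pre * (pr r post * cop2 g t l r (fun a b => f (pre ++ a :: b :: post)) a b
      + 1 * (l a * l b * cop g t l r post (fun v => f (pre ++ a :: b :: v)))).
  rewrite cop_cat !pr_cons /= !pr_cons /cop2.
  by case: ifP => _; case: ifP => _; ring.
rewrite (functional_extensionality _ _ (fun a => functional_extensionality _ _ (E a))).
rewrite RR_lin RR_lin hr hl (h2 _ (Hf pre post)) (@RR_cop g t l r pre _ k1 k2 (fun v => Hf v post k1 k2)).
by rewrite (@RR_cop g t l r post _ k1 k2 (fun v => Hf pre v k1 k2)) !(mulr0, addr0).
Qed.

Lemma RRconst_ec (u : nat -> K) : RRconst (fun x => u (ec N x)).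
Proof.
move=> B k1 k2; have h1 := ec_lt hN k1; have h2 := ec_lt hN k2; rewrite /RR !ec_mk //.
rewrite (@eq_heck _ q L _ (fun p p' => (u (ec N k1) * u (ec N k2)) * B (mk N p (ec N k1)) (mk N p' (ec N k2))
   + 0 * 0)); last by move=> p p'; rewrite !ec_mk // mul0r addr0.
by rewrite heck_lin; ring.
Qed.

Lemma RRconst_dc (u : nat -> K) : RRconst (fun x => u (dc N L x)).
Proof.
move=> B k1 k2; have h1 := ec_lt hN k1; have h2 := ec_lt hN k2.
have E p e : (e < N)%N -> dc N L (mk N p e) = dcp L p by move=> he; rewrite dc_dcp pc_mk.
rewrite /RR !E //.
rewrite (@eq_heck _ q L _ (fun p p' => u (dcp L p) * u (dcp L p') * B (mk N p (ec N k1)) (mk N p' (ec N k2))));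
  last by move=> p p'; rewrite !E.
rewrite /heck (SS_per (fun p p' => B (mk N p (ec N k1)) (mk N p' (ec N k2)))
   (pc N k1) (pc N k2) (a := fun p => u (dcp L p)) (b := fun p => u (dcp L p))); try by move=> p c; rewrite dcpM.
by rewrite /dc -/(dcp L _) -/(dcp L _); ring.
Qed.

Lemma RRconst1 : RRconst (fun _ => 1).
Proof.
move=> B k1 k2; rewrite !mul1r; congr RR.
by do 2 apply: functional_extensionality => ?; rewrite !mul1r.
Qed.

(** All the exchanges involved are plain anticommutations. The scalar comes before the functional,
    so that it expresses an identity between words. *)
Lemma reorder (P : int -> bool) m b : inblk N L m b -> pairwise (fun x y : int => y < x) b ->
  (forall B x y, isR2 B -> bk x = m -> bk y = m -> y < x -> ~~ P x -> P y -> B x y = - B y x) ->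
  exists2 c : K, c != 0 & forall f p s, isR f ->
    f (p ++ b ++ s) = c * f (p ++ filter P b ++ filter (predC P) b ++ s).
Proof.
move=> hb hs hsw; elim: b hb hs => [|x b IH] /=.
  by move=> _ _; exists 1; rewrite ?oner_eq0 // => f p s _; rewrite mul1r.
move=> /andP [/eqP bx bb] /andP [hx hs]; have [c c0 Hc] := IH bb hs.
case: ifP => Px /=; first by exists c => // f p s Hf; rewrite -!cat_rcons; apply: Hc.
exists (c * (-1) ^+ size (filter P b)); first by rewrite mulf_neq0 // signr_eq0.
move=> f p s Hf; rewrite -cat_rcons Hc // cat_rcons -mulrA; congr (_ * _).
have hA : all (fun y => [&& bk y == m, y < x & P y]) (filter P b).
  apply/allP => y; rewrite mem_filter => /andP [Py hy]; rewrite Py (allP hx _ hy).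
  by rewrite (eqP (allP bb _ hy)) eqxx.
elim: (filter P b) hA p => [|y A IHA] /=; first by move=> _ p; rewrite expr0 mul1r.
move=> /andP [/and3P [/eqP by' hyx Py] hA] p.
rewrite (hsw _ x y (Hf p (A ++ filter (predC P) b ++ s))) ?Px //.
by rewrite -cat_rcons IHA // cat_rcons exprS mulN1r mulNr.
Qed.

End CoproductR.

(** * The two commuting families, treated uniformly *)

(* [sn] is the rank of the affine algebra, [sl] its level on the Fock space, [scl] the residue class
   of a letter, [stp] (inverse [stp']) the one-letter action of the E_i, which sends the class i + 1
   to the class i; [ss] tells Delta^- from Delta^+. *)
Record side := Side { sn : nat; sl : nat; scl : int -> nat; stp : int -> int; stp' : int -> int; ss : bool }.

Section Sides.
Variables (K : fieldType) (q : K) (N L : nat).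
Hypotheses (hN : (1 < N)%N) (hL : (1 < L)%N) (q0 : q != 0) (q2 : 1 + q ^+ 2 != 0).
Local Notation isR2 := (isR2 q N L).
Local Notation isR := (isR q N L).
Local Notation RR := (RR q N L).
Local Notation bk := (bk N L).
Local Notation inblk := (inblk N L).
Local Notation vbar := (vbar N L).
Implicit Type S : side.

Definition kk S i x : K := kw q (sn S) (scl S) i x.
Definition gE S i x := scl S x == nx (sn S) i.
Definition gF S i x := scl S x == i.
Definition lE S i x : K := if ss S then kk S i x else 1.
Definition rE S i x : K := if ss S then 1 else kk S i x.
Definition lF S i x : K := if ss S then 1 else (kk S i x)^-1.
Definition rF S i x : K := if ss S then (kk S i x)^-1 else 1.
Definition copE S i w f : K := cop (gE S i) (stp S) (lE S i) (rE S i) w f.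
Definition copF S i w f : K := cop (gF S i) (stp' S) (lF S i) (rF S i) w f.

(** The facts whose proof depends on the algebra; from here on both share one argument. [s_exch] is
    the exchange between blocks with its condition weakened to classes, and [s_reord] moves the
    class 0 letters of a vacuum block to its front. *)
Record sideP S : Prop := SideP {
  s_n : (1 < sn S)%N;
  s_lt : forall x, (scl S x < sn S)%N;
  s_K : cancel (stp S) (stp' S);
  s_K' : cancel (stp' S) (stp S);
  s_clE : forall x i, (i < sn S)%N -> scl S x = nx (sn S) i -> scl S (stp S x) = i;
  s_bk1 : forall x, scl S x = 1%N -> bk (stp S x) = bk x + 1;
  s_bk : forall x, scl S x != 1%N -> bk (stp S x) = bk x;
  s_RE : forall i f, (i < sn S)%N -> isR f -> isR (fun w => copE S i w f);
  s_RF : forall i f, (i < sn S)%N -> isR f -> isR (fun w => copF S i w f);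
  s_Rk : forall i, RRconst q N L (kk S i);
  s_count : forall f m g b p s, isR f -> inblk m b ->
    (sl S < count (fun x => scl S x == g) b)%N -> f (p ++ b ++ s) = 0;
  s_exch : forall B m x y, isR2 B -> bk x = m -> bk y = m + 1 ->
    (forall a b, bk a = m -> bk b = m + 1 ->
      (scl S a = scl S x /\ scl S b = scl S y) \/ (scl S a = scl S y /\ scl S b = scl S x) ->
      B a b = 0) -> B y x = 0;
  s_V : forall m g, (g < sn S)%N -> count (fun x => scl S x == g) (vbar m) = sl S;
  s_reord : forall m, exists2 c : K, c != 0 & forall f p s, isR f ->
    f (p ++ vbar m ++ s) = c * f (p ++ filter (fun x => scl S x == 0%N) (vbar m)
      ++ filter (fun x => scl S x != 0%N) (vbar m) ++ s) }.

Definition sideN := Side N L (clN N) (rhoN N L) (rhoN' N L) false.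
Definition sideL := Side L N (clL N L) (fun k => k - N%:Z) (fun k => k + N%:Z) true.

Lemma sideNP : sideP sideN.
Proof.
have hkk i : RRconst q N L (kk sideN i).
  exact: (RRconst_ec q L hN (fun e => q ^ (ind ((e.+1 %% N)%N == i) - ind ((e.+1 %% N)%N == nx N i)))).
have hkV i : RRconst q N L (fun x => (kk sideN i x)^-1).
  exact: (RRconst_ec q L hN (fun e => (q ^ (ind ((e.+1 %% N)%N == i) - ind ((e.+1 %% N)%N == nx N i)))^-1)).
split=> //.
- by move=> x; apply: clN_lt.
- exact: rhoNK.
- exact: rhoNK'.
- move=> x i hi /= /eqP; rewrite clN_nx // => /eqP e.
  by apply/eqP; rewrite clN_eq // ec_rhoN // e.
- move=> x /= /eqP; rewrite clN_eq //= bk_rhoN // => ->.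
  by [].
- move=> x /= ; rewrite clN_eq //= bk_rhoN // => /negbTE ->.
  by [].
- by move=> i f hi; apply: isR_cop; [exact: RRconst1|exact: (hkk i)|move=> B; exact: isR2_EN].
- by move=> i f hi; apply: isR_cop; [exact: (hkV i)|exact: RRconst1|move=> B; exact: isR2_FN].
- move=> f m g b p s; exact: (count_class (exch_clN hN hL q0 q2) (size_class_ec hN hL)).
- move=> B m x y hB hx hy hv; apply: (exch_blocks hN hL q0 hB hx hy) => a b ha hb he _.
  by apply: hv => //; rewrite /= /clN; case: he => [] [-> ->]; [left|right].
- by move=> m g hg; apply: vbar_count_clN.
move=> m; have hb : inblk m%:Z (vbar m) by apply/allP => x /(vbar_blk hN hL) ->.
(* Class 0 is the last bar. A larger letter with a smaller bar lies in a smaller column, so dot and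
   bar increase together and [clean_swap] applies. *)
apply: (reorder (P := fun x => clN N x == 0%N) hb (vbar_sorted hN hL m)) => B x y hB bx by' hyx; rewrite !clN_eq ?(ltnW hN) //= => ex ey.
have hx := ec_lt hN x; have hlt : (ec N x < ec N y)%N by lia.
apply: (clean_swap hN hL q0 q2 hB) => //; first by rewrite bx.
have := pcE hN hL x; have := pcE hN hL y; rewrite bx by' => py px.
have kx := mkK hN x; have ky := mkK hN y; rewrite /mk in kx ky.
have : N%:Z * pc N x < N%:Z * pc N y by lia.
by rewrite ltr_pM2l; lia.
Qed.

Lemma sideLP : sideP sideL.
Proof.
have hkk i : RRconst q N L (kk sideL i).
  exact: (RRconst_dc q L hN (fun e => q ^ (ind (((L - e) %% L)%N == i) - ind (((L - e) %% L)%N == nx L i)))).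
have hkV i : RRconst q N L (fun x => (kk sideL i x)^-1).
  exact: (RRconst_dc q L hN (fun e => (q ^ (ind (((L - e) %% L)%N == i) - ind (((L - e) %% L)%N == nx L i)))^-1)).
split=> //.
- by move=> x; apply: clL_lt.
- by move=> x /=; rewrite subrK.
- by move=> x /=; rewrite addrK.
- move=> x i /= hi /eqP; rewrite clL_nx // => /eqP e.
  by apply/eqP; rewrite clL_eq // dcS // e; case: (eqVneq i 0%N) => hi0; decide_ifs; lia.
- move=> x /= /eqP; rewrite clL_eq //= bkS // subn1 => ->.
  by [].
- move=> x /= ; rewrite clL_eq //= bkS // subn1 => /negbTE ->.
  by [].
- by move=> i f hi; apply: isR_cop; [exact: (hkk i)|exact: RRconst1|move=> B; exact: isR2_Ed].
- by move=> i f hi; apply: isR_cop; [exact: RRconst1|exact: (hkV i)|move=> B; exact: isR2_Fd].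
- move=> f m g b p s; exact: (count_class (exch_clL hN hL q0 q2) (size_class_dc hN hL)).
- move=> B m x y hB hx hy hv; apply: (exch_blocks hN hL q0 hB hx hy) => a b ha hb _ he.
  by apply: hv => //; rewrite /= /clL; case: he => [] [-> ->]; [left|right].
- by move=> m g hg; apply: vbar_count_clL.
move=> m; have hb : inblk m%:Z (vbar m) by apply/allP => x /(vbar_blk hN hL) ->.
apply: (reorder (P := fun x => clL N L x == 0%N) hb (vbar_sorted hN hL m)) => B x y hB bx by' hyx; rewrite !clL_eq ?(ltnW hL) //= => ex ey.
have := pcE hN hL x; have := pcE hN hL y; rewrite bx by' => py px.
have kx := mkK hN x; have ky := mkK hN y; rewrite /mk in kx ky.
have hx := ec_lt hN x; have hy := ec_lt hN y.
(* Class 0 is the first dot index, and those letters already come first in the decreasing order: no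
   exchange ever occurs. *)
have : pc N y + 1 <= pc N x by lia.
by move=> hp; exfalso; nia.
Qed.

End Sides.

(** * Functionals on the Fock space *)

Section Words.
Variables (N L : nat).
Local Notation vbar := (vbar N L).
Implicit Types (M : int) (m : nat) (w : seq int).

Lemma tailS_S M n P : (n < P)%N -> tailS M n P = (M - n%:Z) :: tailS M n.+1 P.
Proof.
move=> h; rewrite /tailS; have -> : (P - n = (P - n.+1).+1)%N by lia.
rewrite /= subr0; congr cons; rewrite (iotaDl 1 0) -map_comp; apply: eq_map => j /=.
by lia.
Qed.

Lemma tailS_nil M n P : (P <= n)%N -> tailS M n P = [::].
Proof. by move=> h; rewrite /tailS (eqP (_ : P - n == 0)%N). Qed.

Lemma size_tailS M n P : size (tailS M n P) = (P - n)%N.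
Proof. by rewrite size_map size_iota. Qed.

Lemma tailS_cat M n P P' : (n <= P)%N -> (P <= P')%N -> tailS M n P' = tailS M n P ++ tailS M P P'.
Proof.
move=> h1 h2; rewrite /tailS; have -> : (P' - n = (P - n) + (P' - P))%N by lia.
rewrite iotaD map_cat; congr cat; rewrite add0n -[(P - n)%N]addn0 iotaDl -map_comp.
by apply: eq_map => j /=; lia.
Qed.

(** The cut at |-NLm> is admissible: w stops before this vacuum begins, and [ext] fills the gap with
    vacuum letters. *)
Definition ok M m w := ((size w)%:Z <= M + (N * L * m)%:Z).
Definition ext M m w := w ++ tailS M (size w) (absz (M + (N * L * m)%:Z)).

Lemma vbarE M m P : P%:Z = M + (N * L * m)%:Z -> tailS M P (P + N * L) = vbar m.
Proof.
move=> h; rewrite /tailS /Defs.vbar addKn; apply: eq_map => j.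
by rewrite h; ring.
Qed.

Lemma size_vbar m : size (vbar m) = (N * L)%N.
Proof. by rewrite size_map size_iota. Qed.

Lemma ext_size M m w : ok M m w -> (size (ext M m w))%:Z = M + (N * L * m)%:Z.
Proof. by rewrite /ok /ext size_cat size_tailS; lia. Qed.

Lemma ext_id M m w : (size w)%:Z = M + (N * L * m)%:Z -> ext M m w = w.
Proof. by move=> h; rewrite /ext tailS_nil ?cats0 // -h. Qed.

Lemma ext_S M m w : ok M m w -> ext M m.+1 w = ext M m w ++ vbar m.
Proof.
rewrite /ok => h; rewrite /ext -catA; congr cat.
have h2 : absz (M + (N * L * m.+1)%:Z) = (absz (M + (N * L * m)%:Z)%R + N * L)%N by rewrite mulnS; lia.
by rewrite h2 (@tailS_cat M _ (absz (M + (N * L * m)%:Z))) ?(vbarE (m := m)) //; lia.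
Qed.

Lemma ok_mono M m k w : ok M m w -> ok M (m + k) w.
Proof. by rewrite /ok mulnDr; lia. Qed.

(** Prefixing a letter raises the charge and leaves the infinite tail in place, so the same cut
    serves both words. *)
Lemma ext_cons M m x w : ok M m w -> ext (M + 1) m (x :: w) = x :: ext M m w.
Proof.
rewrite /ok /ext /= => h; congr (_ :: _ ++ _).
have -> : absz (M + 1 + (N * L * m)%:Z) = (absz (M + (N * L * m)%:Z)).+1 by lia.
by rewrite /tailS subSS; apply: eq_map => j; lia.
Qed.

Lemma ok_cons M m x w : ok (M + 1) m (x :: w) = ok M m w.
Proof. by rewrite /ok /=; lia. Qed.

Lemma ext_rcons M m (s : seq int) : ok M m (s ++ [:: M - (size s)%:Z]) ->
  ext M m (s ++ [:: M - (size s)%:Z]) = ext M m s /\ ok M m s.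
Proof.
rewrite /ok size_cat /= addn1 => h; split; last by lia.
rewrite /ext -catA; congr cat.
rewrite (@tailS_S M (size s)) //; last by lia.
by rewrite size_cat addn1.
Qed.

Lemma mch_size M w w' : size w = size w' -> mch M w = mch M w'.
Proof. by rewrite /mch => ->. Qed.

Lemma ext_ctx M pre post : exists tl, forall a b m, m = mch M (pre ++ a :: b :: post) ->
  ext M m (pre ++ a :: b :: post) = pre ++ a :: b :: (post ++ tl).
Proof.
exists (tailS M (size (pre ++ 0 :: 0 :: post)) (absz (M + (N * L * mch M (pre ++ 0 :: 0 :: post))%:Z))).
by move=> a b m ->; rewrite /ext -catA /= (@mch_size M _ (pre ++ 0 :: 0 :: post)) !size_cat.
Qed.

Lemma size_upd (u v : seq int) x y : size (u ++ x :: v) = size (u ++ y :: v).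
Proof. by rewrite !size_cat. Qed.

End Words.

Section Stable.
Variables (K : fieldType) (q : K) (N L : nat).
Local Notation isR := (isR q N L).
Local Notation vbar := (vbar N L).
Local Notation ext := (ext N L).
Implicit Types (f : seq int -> K) (M : int) (m : nat) (w : seq int).

Definition stab M f := forall s : seq int, f (s ++ [:: M - (size s)%:Z]) = f s.
(* The linear functionals on the Fock space of charge [M]. *)
Definition inPsi M f := isR f /\ stab M f.
(** The transpose of u_x /\ -, which maps F_M to F_{M+1}. *)
Definition cn x f : seq int -> K := fun v => f (x :: v).

Lemma stab_tail M f w P : stab M f -> f (w ++ tailS M (size w) P) = f w.
Proof.
move=> hT; have [k] := ubnP (P - size w)%N; elim: k w => // k IH w hk.
have [hle|hlt] := leqP P (size w); first by rewrite tailS_nil ?cats0.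
have := IH (w ++ [:: M - (size w)%:Z]); rewrite size_cat /= addn1 -catA /= hT.
by rewrite (@tailS_S M (size w)) //; apply; lia.
Qed.

Lemma stab_ext M m w f : stab M f -> f (ext M m w) = f w.
Proof. exact: stab_tail. Qed.

Lemma stab_vbar M m w f : stab M f -> (size w)%:Z = M + (N * L * m)%:Z -> f (w ++ vbar m) = f w.
Proof.
move=> hT hs; rewrite -[RHS](stab_tail w (size w + N * L) hT).
by rewrite (vbarE hs).
Qed.

Lemma cn_psi M x f : inPsi (M + 1) f -> inPsi M (cn x f).
Proof.
move=> [hR hT]; split; first by move=> pre post; exact: (hR (x :: pre) post).
by move=> s; rewrite /cn -(hT (x :: s)) /=; congr (f (_ :: _ ++ [:: _])); lia.
Qed.

Lemma isR_lin a b f f' : isR f -> isR f' -> isR (fun v => a * f v + b * f' v).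
Proof. by move=> h h' pre post k1 k2; rewrite RR_lin h h' !mulr0 addr0. Qed.

Lemma psi_lin M a b f f' : inPsi M f -> inPsi M f' -> inPsi M (fun v => a * f v + b * f' v).
Proof.
by move=> [h1 h2] [h1' h2']; split; [exact: isR_lin|move=> s; rewrite h2 h2'].
Qed.

End Stable.

Section Functionals.
Variables (K : fieldType) (q : K) (N L : nat).
Hypotheses (hN : (1 < N)%N) (hL : (1 < L)%N) (q0 : q != 0) (q2 : 1 + q ^+ 2 != 0).
Local Notation isR2 := (isR2 q N L).
Local Notation isR := (isR q N L).
Local Notation RR := (RR q N L).
Local Notation bk := (bk N L).
Local Notation inblk := (inblk N L).
Local Notation vbar := (vbar N L).
Local Notation inPsi := (inPsi q N L).
Local Notation ok := (ok N L).
Local Notation ext := (ext N L).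
Implicit Types (f : seq int -> K) (M : int) (m : nat) (w : seq int).

Lemma NLgt0 : (0 < N * L)%N. Proof. by rewrite muln_gt0; lia. Qed.

Lemma ok_mch M w : ok M (mch M w) w.
Proof. by rewrite /ok /mch; have := NLgt0; nia. Qed.

Section OneSide.
Variables (S : side) (HS : sideP q N L S).
Local Notation n := (sn S).
Local Notation l := (sl S).
Local Notation cl := (scl S).
Local Notation kk := (kk q S).
Local Notation copE := (copE q S).
Local Notation copF := (copF q S).
Local Notation lE := (lE q S).
Local Notation rE := (rE q S).
Local Notation lF := (lF q S).
Local Notation rF := (rF q S).

Lemma nx_lt i : (nx n i < n)%N.
Proof. by rewrite ltn_mod; have := s_n HS; lia. Qed.

Lemma nxE i : (i < n)%N -> nx n i = if i == n.-1 then 0%N else i.+1.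
Proof.
move=> hi; rewrite /nx; case: eqP => [->|h]; first by rewrite prednK ?modnn //; lia.
by rewrite modn_small //; lia.
Qed.

Lemma nx_inj i j : (i < n)%N -> (j < n)%N -> nx n i = nx n j -> i = j.
Proof. by move=> hi hj; rewrite !nxE //; case: (eqVneq i n.-1); case: (eqVneq j n.-1); lia. Qed.

Lemma nx_neq i : (i < n)%N -> (nx n i == i) = false.
Proof. by have := s_n HS => h hi; rewrite nxE //; case: (eqVneq i n.-1); lia. Qed.

Lemma nx0 : nx n 0 = 1%N.
Proof. by have := s_n HS => h; rewrite nxE; decide_ifs; lia. Qed.

Lemma clF x i : (i < n)%N -> cl x = i -> cl (stp' S x) = nx n i.
Proof.
move=> hi hx; have h := s_n HS; have hlt := s_lt HS (stp' S x).
pose j := if cl (stp' S x) == 0%N then n.-1 else (cl (stp' S x)).-1.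
have hj : (j < n)%N by rewrite /j; case: eqP; lia.
have e : cl (stp' S x) = nx n j by rewrite nxE // /j; case: (eqVneq (cl (stp' S x)) 0%N) => ?; decide_ifs; lia.
by have := s_clE HS hj e; rewrite (s_K' HS) hx => ->.
Qed.

Lemma bkF0 x : cl x = 0%N -> bk (stp' S x) = bk x - 1.
Proof.
move=> hx; have hc := clF (ltnW (s_n HS)) hx; rewrite nx0 in hc.
by have := s_bk1 HS hc; rewrite (s_K' HS) => ->; rewrite addrK.
Qed.
Lemma bkF x : cl x != 0%N -> bk (stp' S x) = bk x.
Proof.
move=> hx; have hlt := s_lt HS x; have hc := clF hlt erefl.
have hc1 : cl (stp' S x) != 1%N by rewrite hc nxE //; case: (eqVneq (cl x) n.-1); lia.
by rewrite -(s_bk HS hc1) (s_K' HS).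
Qed.

Lemma kkE i x : kk i x = q ^ (ind (cl x == i) - ind (cl x == nx n i)). Proof. by []. Qed.
Lemma kk_neq0 i x : kk i x != 0. Proof. by rewrite kkE expfz_neq0. Qed.
Lemma pr_kk i w : pr (kk i) w =
  q ^ ((count (fun x => cl x == i) w)%:Z - (count (fun x => cl x == nx n i) w)%:Z).
Proof.
elim: w => [|x w IH]; first by rewrite pr_nil expr0z.
rewrite pr_cons IH kkE -expfzDr //; congr (q ^ _); rewrite /= /ind.
by case: (cl x == i); case: (cl x == nx n i); lia.
Qed.
Lemma pr_neq0 i w : pr (kk i) w != 0. Proof. by rewrite pr_kk expfz_neq0. Qed.
Lemma pr_one w : pr (fun _ => 1 : K) w = 1.
Proof. by rewrite /pr big1_eq. Qed.
Lemma pr_inv i w : pr (fun x => (kk i x)^-1) w = (pr (kk i) w)^-1.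
Proof. by rewrite /pr prodfV. Qed.

Lemma pr_kk_vbar i m : (i < n)%N -> pr (kk i) (vbar m) = 1.
Proof. by move=> hi; rewrite pr_kk !(s_V HS) ?nx_lt // subrr expr0z. Qed.

Lemma pr_rE i w : pr (rE i) w = if ss S then 1 else pr (kk i) w.
Proof. by rewrite /rE; case: (ss S); rewrite ?pr_one. Qed.
Lemma pr_rF i w : pr (rF i) w = if ss S then (pr (kk i) w)^-1 else 1.
Proof. by rewrite /rF; case: (ss S); rewrite ?pr_one ?pr_inv. Qed.

Lemma vbar_in m : inblk m%:Z (vbar m).
Proof. by apply/allP => x /(vbar_blk hN hL) ->. Qed.

(** The letter y moves right, across letters of block m, into the full block m + 1, where its class
    then occurs once too often. *)
Lemma push_right f m p y v s : isR f -> bk y = m%:Z + 1 -> inblk m%:Z v ->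
  f (p ++ y :: v ++ vbar m.+1 ++ s) = 0.
Proof.
move=> Hf hy; elim: v p y hy => [|x v IH] p y hy /=.
  move=> _; rewrite -[y :: vbar m.+1 ++ s]/((y :: vbar m.+1) ++ s).
  apply: (s_count HS (m := m.+1%:Z) (g := cl y)) => //.
    by apply/andP; split; [rewrite hy; lia|exact: vbar_in].
  by rewrite /= eqxx (s_V HS) // (s_lt HS).
move=> /andP [/eqP hx hv].
apply: (s_exch HS (Hf p (v ++ vbar m.+1 ++ s)) hx hy) => a b ha hb _.
by rewrite -cat_rcons; apply: IH.
Qed.

(** The mirror image: x moves left, across letters of block m + 1, into the full block m. *)
Lemma pull_left f m p u x s : isR f -> bk x = m%:Z -> inblk (m%:Z + 1) u ->
  f (p ++ vbar m ++ u ++ x :: s) = 0.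
Proof.
move=> Hf; elim/last_ind: u x s => [|u y IH] x s hx /=.
  move=> _; rewrite -[x :: s]/([:: x] ++ s) (catA (vbar m)).
  apply: (s_count HS (m := m%:Z) (g := cl x)) => //.
    by rewrite /inblk all_cat /= hx eqxx !andbT; exact: vbar_in.
  by rewrite count_cat /= eqxx (s_V HS) ?(s_lt HS) // addn1.
rewrite /inblk all_rcons => /andP [/eqP hy hu].
rewrite cat_rcons (catA (vbar m)) catA.
apply: (s_exch HS (Hf _ _) hx hy) => a b ha hb _.
by rewrite -!catA; apply: IH.
Qed.

Lemma count_upd (P : pred int) (u v : seq int) x y : (count P (u ++ y :: v) + P x = count P (u ++ x :: v) + P y)%N.
Proof. by rewrite !count_cat /=; lia. Qed.

Lemma inblk_upd m (u v : seq int) x y : inblk m (u ++ x :: v) -> bk y = bk x -> inblk m (u ++ y :: v).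
Proof. by rewrite /inblk !all_cat /= => /and3P [-> /eqP <- ->] ->; rewrite eqxx. Qed.

(** For i <> 0 the block receives one letter of class i too many. For i = 0 the letter gains a
    factor z and belongs to block m + 1, which stability of f allows to append. *)
Lemma copE_vac i M m p f : (i < n)%N -> inPsi M f -> (size p)%:Z = M + (N * L * m)%:Z ->
  copE i (vbar m) (fun v => f (p ++ v)) = 0.
Proof.
move=> hi [hR hT] hs; apply: cop_eq0 => u x v e /eqP gx.
have hin := vbar_in m; rewrite e in hin.
have hbx : bk x = m%:Z by apply/eqP/(allP hin); rewrite mem_cat inE eqxx orbT.
have [i0|i0] := eqVneq i 0%N.
  have hc : cl x = 1%N by rewrite gx i0 nx0.
  have hsz : (size (p ++ u ++ stp S x :: v))%:Z = M + (N * L * m.+1)%:Z.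
    have := size_vbar N L m; rewrite e !size_cat /= mulnS; lia.
  rewrite -(stab_vbar hT hsz) -!catA catA /= -[vbar m.+1]cats0.
  apply: push_right => //; first by rewrite (s_bk1 HS) // hbx.
  by move: hin; rewrite /inblk all_cat /= => /and3P [].
have hc : cl x != 1%N by rewrite gx -nx0; apply/eqP => /nx_inj h; move: i0; rewrite h //; have := s_n HS; lia.
rewrite -[u ++ _]cats0; apply: (s_count HS (m := m%:Z) (g := i)) => //.
  by apply: inblk_upd hin _; rewrite (s_bk HS).
have := count_upd (fun x => cl x == i) u v x (stp S x).
by rewrite (s_clE HS hi gx) gx eqxx nx_neq // -e (s_V HS) //; lia.
Qed.

Lemma copF_vac i m p f : (i < n)%N -> isR f -> i != 0%N ->
  copF i (vbar m) (fun v => f (p ++ v)) = 0.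
Proof.
move=> hi hR i0; apply: cop_eq0 => u x v e /eqP gx.
have hin := vbar_in m; rewrite e in hin.
rewrite -[u ++ _]cats0; apply: (s_count HS (m := m%:Z) (g := nx n i)) => //.
  by apply: inblk_upd hin _; rewrite bkF // gx.
have := count_upd (fun x => cl x == nx n i) u v x (stp' S x).
by rewrite (clF hi gx) gx eqxx eq_sym nx_neq // -e (s_V HS) ?nx_lt //; lia.
Qed.

(** F_0 lowers the power of z, so the letter falls back into the full block in front. [XF] keeps one
    vacuum block more than [XE] so that such a block is always present. *)
Lemma copF_vac0 m p f : isR f -> copF 0 (vbar m.+1) (fun v => f (p ++ vbar m ++ v)) = 0.
Proof.
move=> hR; apply: cop_eq0 => u x v e /eqP gx.
have hin := vbar_in m.+1; rewrite e in hin.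
have hbx : bk x = m.+1%:Z by apply/eqP/(allP hin); rewrite mem_cat inE eqxx orbT.
apply: pull_left => //; first by rewrite bkF0 // hbx; lia.
move: hin; rewrite /inblk all_cat /= => /and3P [h _ _].
by have -> : m%:Z + 1 = m.+1%:Z by lia.
Qed.

(* Eigenvalue of K_i on the vacua |-NLm>. *)
Definition lam i : K := q ^ (l%:Z * ind (i == 0%N)).
(** Delta^+ puts K_i on the vacuum to the right of E_i, and Delta^- puts its inverse there for F_i;
    in the other two cases the right factor is 1. *)
Definition muE i : K := if ss S then 1 else lam i.
Definition muF i : K := if ss S then (lam i)^-1 else 1.

Definition XE M i f w : K := muE i * copE i (ext M (mch M w) w) f.
(** The additional block carries the action of F_0 on |-NLm>, which is defined through the first
    block of this vacuum. *)
Definition XF M i f w : K := muF i * copF i (ext M (mch M w) w ++ vbar (mch M w)) f.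
Definition KH M i w : K := lam i * pr (kk i) (ext M (mch M w) w).

Lemma stable_any (T : Type) M w (F : nat -> T) : (forall m, ok M m w -> F m.+1 = F m) ->
  forall m m', ok M m w -> ok M m' w -> F m = F m'.
Proof.
move=> H; have A m k : ok M m w -> F (m + k)%N = F m.
  by move=> hm; elim: k => [|k IH]; rewrite ?addn0 // addnS H ?IH //; apply: ok_mono.
by move=> m m' hm hm'; rewrite -(A m m') // addnC A.
Qed.

Lemma XE_any M i f w m : (i < n)%N -> inPsi M f -> ok M m w ->
  XE M i f w = muE i * copE i (ext M m w) f.
Proof.
move=> hi hf hm; congr (_ * _).
apply: (@stable_any _ M w (fun m => copE i (ext M m w) f)) => //; last exact: ok_mch.
move=> k hk; have hsz := ext_size hk.
rewrite ext_S // /copE cop_cat -/(copE i _ _) -/(copE i _ _) (copE_vac _ hf) // mulr0 addr0.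
rewrite pr_rE pr_kk_vbar // if_same mul1r -[RHS]mul1r.
apply: cop_scale => u x v e _; rewrite mul1r (stab_vbar hf.2) //.
by rewrite -hsz e (size_upd u v _ x).
Qed.

Lemma XF_any M i f w m : (i < n)%N -> inPsi M f -> ok M m w ->
  XF M i f w = muF i * copF i (ext M m w ++ vbar m) f.
Proof.
move=> hi hf hm; congr (_ * _).
apply: (@stable_any _ M w (fun m => copF i (ext M m w ++ vbar m) f)) => //; last exact: ok_mch.
move=> k hk; have hsz := ext_size hk.
rewrite ext_S // /copF cop_cat -/(copF i _ _) -/(copF i _ _).
have -> : copF i (vbar k.+1) (fun v => f ((ext M k w ++ vbar k) ++ v)) = 0.
  have [->|i0] := eqVneq i 0%N; last by apply: copF_vac => //; case: hf.
  rewrite -[RHS](copF_vac0 k (ext M k w) hf.1); congr copF.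
  by apply: functional_extensionality => v; rewrite catA.
rewrite mulr0 addr0 pr_rF pr_kk_vbar // invr1 if_same mul1r -[RHS]mul1r.
apply: cop_scale => u x v e _; rewrite mul1r (stab_vbar hf.2) //.
have := congr1 size e; rewrite (size_upd u v x (stp' S x)) => <-.
by rewrite size_cat size_vbar mulnS; lia.
Qed.

Lemma KH_any M i w m : (i < n)%N -> ok M m w -> KH M i w = lam i * pr (kk i) (ext M m w).
Proof.
move=> hi hm; congr (_ * _).
apply: (@stable_any _ M w (fun m => pr (kk i) (ext M m w))) => //; last exact: ok_mch.
by move=> k hk; rewrite ext_S // pr_cat pr_kk_vbar // mulr1.
Qed.

Lemma lam_neq0 i : lam i != 0. Proof. by rewrite expfz_neq0. Qed.
Lemma KH_neq0 M i w : KH M i w != 0.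
Proof. by rewrite mulf_neq0 ?lam_neq0 ?pr_neq0. Qed.

Lemma KH_cons M i x v : (i < n)%N -> KH (M + 1) i (x :: v) = kk i x * KH M i v.
Proof.
move=> hi; have hm := ok_mch M v; rewrite (@KH_any _ _ _ (mch M v)) ?ok_cons // ext_cons // pr_cons.
by rewrite /KH; ring.
Qed.

Lemma KH_T M i : (i < n)%N -> stab M (KH M i).
Proof.
move=> hi s; have hm := ok_mch M (s ++ [:: M - (size s)%:Z]); have [e h2] := ext_rcons hm.
by rewrite (KH_any hi hm) (KH_any hi h2) e.
Qed.

Lemma isR_scal c f : isR f -> isR (fun w => c * f w).
Proof.
move=> hf; have := isR_lin c 0 hf hf.
by congr isR; apply: functional_extensionality => w; rewrite mul0r addr0.
Qed.

Lemma XE_psi M i f : (i < n)%N -> inPsi M f -> inPsi M (XE M i f).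
Proof.
move=> hi hf; split.
  move=> pre post; have [tl Htl] := ext_ctx N L M pre post.
  have H := isR_scal (muE i) (s_RE HS hi hf.1) pre (post ++ tl).
  congr isR2: H; do 2 apply: functional_extensionality => ?.
  by rewrite /XE (Htl _ _ _ erefl).
move=> s; have hm := ok_mch M (s ++ [:: M - (size s)%:Z]); have [e h2] := ext_rcons hm.
by rewrite (XE_any hi hf hm) (XE_any hi hf h2) e.
Qed.

Lemma XF_psi M i f : (i < n)%N -> inPsi M f -> inPsi M (XF M i f).
Proof.
move=> hi hf; split.
  move=> pre post; have [tl Htl] := ext_ctx N L M pre post.
  have H := isR_scal (muF i) (s_RF HS hi hf.1) pre (post ++ tl ++ vbar (mch M (pre ++ 0 :: 0 :: post))).
  congr isR2: H; apply: functional_extensionality => a; apply: functional_extensionality => b.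
  rewrite /XF (Htl _ _ _ erefl) -catA /= -catA; congr (_ * copF _ (_ ++ _ :: _ :: _ ++ _ ++ vbar _) _).
  by apply: mch_size; rewrite !size_cat.
move=> s; have hm := ok_mch M (s ++ [:: M - (size s)%:Z]); have [e h2] := ext_rcons hm.
by rewrite (XF_any hi hf hm) (XF_any hi hf h2) e.
Qed.

Lemma RRconst_inv (u : int -> K) : (forall x, u x != 0) -> RRconst q N L u ->
  RRconst q N L (fun x => (u x)^-1).
Proof.
move=> u0 H B k1 k2; have := H (fun a b => (u a)^-1 * (u b)^-1 * B a b) k1 k2.
have -> : (fun a b => u a * u b * ((u a)^-1 * (u b)^-1 * B a b)) = B.
  do 2 apply: functional_extensionality => ?; rewrite mulrA mulrACA !divff ?mul1r //.
move=> ->; rewrite mulrA mulrACA !mulVf ?mul1r //.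
Qed.

Lemma psi_diag M (Q : seq int -> K) f (u : int -> K) : RRconst q N L u -> stab M Q ->
  (forall pre post, exists c, forall a b, Q (pre ++ a :: b :: post) = c * (u a * u b)) ->
  inPsi M f -> inPsi M (fun v => Q v * f v).
Proof.
move=> hu hQ hc [hR hT]; split; last by move=> s; rewrite hQ hT.
move=> pre post k1 k2; have [c Hc] := hc pre post.
have := RR_lin q N L c 0 (fun a b => u a * u b * f (pre ++ a :: b :: post)) (fun _ _ => 0) k1 k2.
rewrite hu hR !mulr0 mul0r addr0 => E; rewrite -[RHS]E; congr RR.
by do 2 apply: functional_extensionality => ?; rewrite Hc addr0; ring.
Qed.

Lemma KH_ctx M i pre post : exists c, forall a b, KH M i (pre ++ a :: b :: post) = c * (kk i a * kk i b).
Proof.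
have [tl Htl] := ext_ctx N L M pre post; exists (lam i * pr (kk i) pre * pr (kk i) (post ++ tl)) => a b.
by rewrite /KH (Htl _ _ _ erefl) pr_cat !pr_cons; ring.
Qed.

Lemma psi_KH M i f : (i < n)%N -> inPsi M f -> inPsi M (fun v => KH M i v * f v).
Proof.
move=> hi; apply: (psi_diag (s_Rk HS i)); first exact: KH_T.
exact: KH_ctx.
Qed.

Lemma psi_KHV M i f : (i < n)%N -> inPsi M f -> inPsi M (fun v => (KH M i v)^-1 * f v).
Proof.
move=> hi; apply: (psi_diag (u := fun x => (kk i x)^-1)).
- by apply: RRconst_inv => [x|]; [exact: kk_neq0|exact: (s_Rk HS)].
- by move=> s; rewrite (KH_T M hi).
- move=> pre post; have [c Hc] := KH_ctx M i pre post; exists c^-1 => a b.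
  by rewrite Hc !invfM.
Qed.

(** The affine Cartan matrix; for n = 2 the two neighbours of an index coincide and the off-diagonal
    entry is -2. *)
Definition cart i j : int := 2 * ind (i == j) - ind (i == nx n j) - ind (j == nx n i).

Lemma kk_stp i j x : (i < n)%N -> (j < n)%N -> cl x = nx n j -> kk i (stp S x) = q ^ cart i j * kk i x.
Proof.
move=> hi hj hx; rewrite !kkE (s_clE HS hj hx) hx -expfzDr //; congr (q ^ _).
rewrite /cart /ind (eq_sym i (nx n j)) (eq_sym j i).
have -> : (nx n j == nx n i) = (i == j).
  by apply/eqP/eqP => [/nx_inj ->|->].
by case: (i == j); case: (nx n j == i); case: (j == nx n i); lia.
Qed.

Lemma kk_stp' i j x : (i < n)%N -> (j < n)%N -> cl x = j -> kk i (stp' S x) = q ^ (- cart i j) * kk i x.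
Proof.
move=> hi hj hx; have := kk_stp hi hj (clF hj hx); rewrite (s_K' HS) => ->.
by rewrite mulrA -expfzDr // addNr expr0z mul1r.
Qed.

Lemma pr_upd (r : int -> K) u v x y c : r y = c * r x -> pr r (u ++ y :: v) = c * pr r (u ++ x :: v).
Proof. by move=> e; rewrite !pr_cat !pr_cons e; ring. Qed.

Lemma XE_KH M i j f w : (i < n)%N -> (j < n)%N ->
  XE M j (fun v => KH M i v * f v) w = q ^ cart i j * KH M i w * XE M j f w.
Proof.
move=> hi hj; have hm := ok_mch M w; have hsz := ext_size hm.
rewrite /XE [RHS]mulrCA; congr (_ * _); apply: cop_scale => u x v e /eqP gx.
rewrite (@KH_any _ _ _ (mch M w)) // ?ext_id; last 2 first.
- by rewrite (size_upd u v _ x) -e.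
- by rewrite /ok (size_upd u v _ x) -e hsz.
by rewrite /KH e (pr_upd _ _ (kk_stp hi hj gx)); ring.
Qed.

Lemma XF_KH M i j f w : (i < n)%N -> (j < n)%N ->
  XF M j (fun v => KH M i v * f v) w = q ^ (- cart i j) * KH M i w * XF M j f w.
Proof.
move=> hi hj; have hm := ok_mch M w; have hsz := ext_size (ok_mono 1 hm).
rewrite addn1 ext_S // in hsz.
rewrite /XF [RHS]mulrCA; congr (_ * _); apply: cop_scale => u x v e /eqP gx.
have hm1 : ok M (mch M w).+1 w by have := ok_mono 1 hm; rewrite addn1.
have hz : (size (u ++ stp' S x :: v))%:Z = M + (N * L * (mch M w).+1)%:Z by rewrite (size_upd u v _ x) -e.
rewrite (KH_any hi hm1) ext_S // e (@KH_any _ _ (u ++ _) (mch M w).+1) // ?ext_id //; last by rewrite /ok hz.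
by rewrite (pr_upd _ _ (kk_stp' hi hj gx)); ring.
Qed.

(* The factors produced by E_i, F_i acting on the first letter: the K_i^{+-1} of Delta^{+-}. *)
Definition kE M i v : K := if ss S then 1 else KH M i v.
Definition kF M i v : K := if ss S then (KH M i v)^-1 else 1.

(** Both words are cut at the same vacuum, so this is the coproduct rule of finite words, the vacuum
    factor [muE] being absorbed in [kE]. *)
Lemma XE_cons M i f x v : (i < n)%N -> inPsi (M + 1) f ->
  XE (M + 1) i f (x :: v) = (if gE S i x then kE M i v * f (stp S x :: v) else 0)
    + lE i x * XE M i (cn x f) v.
Proof.
move=> hi hf; have hm := ok_mch M v.
rewrite (@XE_any _ _ _ _ (mch M v)) // ?ok_cons // ext_cons // /XE /copE /=.
have -> : f (stp S x :: ext M (mch M v) v) = f (stp S x :: v).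
  by rewrite -ext_cons // (stab_ext _ _ _ _ hf.2).
rewrite -/(cn x f) pr_rE /kE /KH /muE.
by case: (gE S i x); case: (ss S); ring.
Qed.

Lemma XF_cons M i f x v : (i < n)%N -> inPsi (M + 1) f ->
  XF (M + 1) i f (x :: v) = (if gF S i x then kF M i v * f (stp' S x :: v) else 0)
    + lF i x * XF M i (cn x f) v.
Proof.
move=> hi hf; have hm := ok_mch M v.
rewrite (@XF_any _ _ _ _ (mch M v)) // ?ok_cons // ext_cons // /XF /copF /=.
have -> : f (stp' S x :: ext M (mch M v) v ++ vbar (mch M v)) = f (stp' S x :: v).
  rewrite -cat_cons -ext_cons // (stab_vbar hf.2) ?(stab_ext _ _ _ _ hf.2) //.
  by rewrite ext_size // ok_cons.
rewrite -/(cn x f) pr_rF pr_cat pr_kk_vbar // mulr1 /kF /KH /muF invfM.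
by case: (gF S i x); case: (ss S); ring.
Qed.

Lemma XE_lin M i a b f f' w : XE M i (fun v => a * f v + b * f' v) w = a * XE M i f w + b * XE M i f' w.
Proof. by rewrite /XE /copE cop_lin; ring. Qed.
Lemma XF_lin M i a b f f' w : XF M i (fun v => a * f v + b * f' v) w = a * XF M i f w + b * XF M i f' w.
Proof. by rewrite /XF /copF cop_lin; ring. Qed.

Definition Am m := filter (fun x => cl x == 0%N) (vbar m).
Definition Bm m := filter (fun x => cl x != 0%N) (vbar m).
(* The vacuum-like words killed by E_i and F_i, with trivial K_i, and their charge. *)
Definition tl i m := if i == 0%N then Bm m else [::].
Definition ch i m : int := - (N * L * m)%:Z - (if i == 0%N then l%:Z else 0).

Lemma size_Am m : size (Am m) = l.
Proof. by rewrite size_filter (s_V HS) //; have := s_n HS; lia. Qed.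
Lemma size_Bm m : (size (Bm m) + l = N * L)%N.
Proof.
rewrite -(size_Am m) addnC !size_filter -(size_vbar N L m) -(count_predC (fun x => cl x == 0%N) (vbar m)).
by [].
Qed.
Lemma count_Bm m g : (g < n)%N -> g != 0%N -> count (fun x => cl x == g) (Bm m) = l.
Proof.
move=> hg g0; rewrite -(s_V HS m hg) count_filter; apply: eq_count => x /=.
by case: (eqVneq (cl x) g) => [->|].
Qed.
Lemma Bm_in m : inblk m%:Z (Bm m).
Proof. by apply/allP => x; rewrite mem_filter => /andP [_ /(allP (vbar_in m))]. Qed.
Lemma Am_in m : inblk m%:Z (Am m).
Proof. by apply/allP => x; rewrite mem_filter => /andP [_ /(allP (vbar_in m))]. Qed.

(** Every E_j kills the tail, not only the one of its index: for i = 0 the nonzero classes of [Bm m]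
    are still full, and E_0 sends a letter into the full block m + 1 behind. *)
Lemma XE_tl i j m f : (i < n)%N -> (j < n)%N -> inPsi (ch i m) f -> XE (ch i m) j f (tl i m) = 0.
Proof.
rewrite /ch /tl => hi hj; case: eqP => [i0|_] hf.
  set M := _ - _ in hf *.
  have hsz : (size (Bm m))%:Z = M + (N * L * m.+1)%:Z by rewrite /M mulnS; have := size_Bm m; lia.
  rewrite (@XE_any _ _ _ _ m.+1) // ?ext_id // /ok ?hsz //.
  rewrite /copE cop_eq0 ?mulr0 // => u x v e /eqP gx.
  have hin := Bm_in m; rewrite e in hin.
  have hx : x \in Bm m by rewrite e mem_cat inE eqxx orbT.
  have hbx : bk x = m%:Z by apply/eqP/(allP (Bm_in m)).
  have cx : cl x != 0%N by move: hx; rewrite mem_filter => /andP [].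
  have [j0|j0] := eqVneq j 0%N.
    have hc : cl x = 1%N by rewrite gx j0 nx0.
    have hsz' : (size (u ++ stp S x :: v))%:Z = M + (N * L * m.+1)%:Z by rewrite (size_upd u v _ x) -e.
    rewrite -(stab_vbar hf.2 hsz') -catA /= -[vbar m.+1]cats0.
    apply: push_right; first exact: hf.1; first by rewrite (s_bk1 HS) // hbx.
    by move: hin; rewrite /inblk all_cat /= => /and3P [].
  have hc : cl x != 1%N by rewrite gx -nx0; apply/eqP => /nx_inj h; move: j0; rewrite h //; have := s_n HS; lia.
  rewrite -[u ++ _]cats0 -[_ ++ [::]]cat0s; apply: (s_count HS (m := m%:Z) (g := j)); first exact: hf.1.
    by apply: inblk_upd hin _; rewrite (s_bk HS).
  have := count_upd (fun x => cl x == j) u v x (stp S x).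
  by rewrite (s_clE HS hj gx) gx eqxx nx_neq // -e count_Bm //; lia.
by rewrite (@XE_any _ _ _ _ m) // ?ext_id /ok //=; try lia; rewrite /copE /= mulr0.
Qed.

(** The letter x travels left across class 0 letters of block m + 1. An exchange either keeps the
    classes, and finally a class 1 letter of block m reaches [Bm m], already full in class 1; or it
    swaps them, and a class 1 letter of block m + 1 overfills [Bm m.+1]. *)
Lemma slide f m a1 x a2 p : isR f -> all (fun y => (bk y == m.+1%:Z) && (cl y == 0%N)) a1 ->
  bk x = m%:Z -> cl x = 1%N -> inblk m.+1%:Z a2 ->
  f (p ++ Bm m ++ a1 ++ x :: a2 ++ Bm m.+1) = 0.
Proof.
have h1 := s_n HS.
move=> hR; elim/last_ind: a1 x a2 => [|a1 y IH] x a2.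
  move=> _ hx cx ha /=; rewrite -[x :: _]/([:: x] ++ _) (catA (Bm m)).
  apply: (s_count HS (m := m%:Z) (g := 1%N)) => //.
    by rewrite /inblk all_cat /= hx eqxx !andbT; exact: Bm_in.
  by rewrite count_cat /= cx count_Bm //; lia.
rewrite all_rcons => /andP [/andP [/eqP hy /eqP cy] h] hx cx ha.
rewrite cat_rcons (catA (Bm m)) catA.
have hy' : bk y = m%:Z + 1 by lia.
apply: (s_exch HS (hR _ _) hx hy') => a b ha' hb'.
have hb2 : bk b = m.+1%:Z by lia.
rewrite cx cy => [] [] [ca cb]; last first.
  rewrite -cat_rcons -[b :: _]/((b :: a2) ++ _) -[Bm m.+1]cats0 (catA (b :: a2)).
  apply: (s_count HS (m := m.+1%:Z) (g := 1%N)) => //.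
    by rewrite /inblk all_cat /= hb2 eqxx -!/(inblk _ _) ha Bm_in.
  by rewrite count_cat /= cb count_Bm //; lia.
rewrite -!catA; apply: (IH a (b :: a2)) => //.
by rewrite /inblk /= hb2 eqxx.
Qed.

Lemma XF_tl i m f : (i < n)%N -> inPsi (ch i m) f -> XF (ch i m) i f (tl i m) = 0.
Proof.
rewrite /ch /tl => hi; case: (eqVneq i 0%N) hi => [->|i0] hi hf; last first.
  rewrite (@XF_any _ _ _ _ m) // ?ext_id /ok //=; try lia.
  by have /= -> := copF_vac m [::] hi hf.1 i0; rewrite mulr0.
set M := _ - _ in hf *.
have hsz : (size (Bm m))%:Z = M + (N * L * m.+1)%:Z by rewrite /M mulnS; have := size_Bm m; lia.
rewrite (@XF_any _ _ _ _ m.+1) // ?ext_id // /ok ?hsz //.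
have [c _ Hc] := s_reord HS m.+1.
(* The reordering is applied to the functional [copF 0], itself compatible with the relations,
   before the coproduct is expanded. F_0 then acts on the class 0 letters only, and a letter it
   lowers is separated from [Bm m] by class 0 letters alone. *)
have := Hc _ (Bm m) [::] (s_RF HS hi hf.1); rewrite !cats0 => ->.
rewrite -/(Am m.+1) -/(Bm m.+1) /copF !cop_cat.
have B0 k g : cop (gF S 0) (stp' S) (lF 0) (rF 0) (Bm k) g = 0.
  apply: cop_eq0 => u x v e; have : x \in Bm k by rewrite e mem_cat inE eqxx orbT.
  by rewrite mem_filter /gF => /andP [/negbTE ->].
rewrite !B0 cop_eq0 ?(mulr0, addr0) // => u x v e /eqP gx.
have hin := Am_in m.+1.
have hx : bk x = m.+1%:Z by apply/eqP/(allP hin); rewrite e mem_cat inE eqxx orbT.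
rewrite -catA; apply: (@slide _ _ _ _ _ [::]); first exact: hf.1.
- apply/allP => y hy; have : y \in Am m.+1 by rewrite e mem_cat hy.
  by rewrite mem_filter => /andP [-> /(allP (vbar_in m.+1)) ->].
- by rewrite bkF0 // hx; lia.
- by rewrite (clF (ltnW (s_n HS)) gx) nx0.
- by move: hin; rewrite e /inblk all_cat /= => /and3P [].
Qed.

(** For i = 0 the l letters of class 1 in [Bm m] give q^(-l), against q^l from the vacuum behind
    them. *)
Lemma KH_tl i m : (i < n)%N -> KH (ch i m) i (tl i m) = 1.
Proof.
rewrite /ch /tl => hi; case: (eqVneq i 0%N) hi => [->|i0] hi; last first.
  rewrite (@KH_any _ _ _ m) // ?ext_id /ok //=; try lia.
  by rewrite pr_nil mulr1 /lam (negbTE i0) mulr0 expr0z.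
set M := _ - _.
have hsz : (size (Bm m))%:Z = M + (N * L * m.+1)%:Z by rewrite /M mulnS; have := size_Bm m; lia.
rewrite (@KH_any _ _ _ m.+1) // ?ext_id // /ok ?hsz // pr_kk nx0 (@count_Bm m 1) ?(s_n HS) //.
have -> : count (fun x => cl x == 0%N) (Bm m) = 0%N.
  apply/eqP; rewrite -leqn0 leqNgt -has_count; apply/hasPn => x.
  by rewrite mem_filter => /andP [].
by rewrite /lam -expfzDr // /ind /=; have -> : l%:Z * 1 + (0%:Z - l%:Z) = 0 by lia.
Qed.

(** For i = 0 the class 0 letters of the first vacuum block are moved to its front and absorbed in
    u; c is the scalar of this reordering. *)
Lemma tail_reach i M w : (i < n)%N -> exists m u (c : K),
  M = ch i m + (size u)%:Z /\ forall f, inPsi M f -> f w = c * f (u ++ tl i m).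
Proof.
move=> hi; set m := mch M w; have hm : ok M m w := ok_mch M w; have hz := ext_size hm.
exists m; rewrite /ch /tl; have [i0|i0] := eqVneq i 0%N; last first.
  exists (ext M m w), 1; split=> [|f [_ hT]]; first by lia.
  by rewrite cats0 mul1r stab_ext.
have [c _ Hc] := s_reord HS m; exists (ext M m w ++ Am m), c; split.
  by rewrite size_cat size_Am; lia.
move=> f [hR hT]; rewrite -(stab_ext N L m w hT) -(stab_vbar hT hz) -[vbar m]cats0 Hc //.
by rewrite cats0 catA.
Qed.

(* A family of identities between functionals holds as soon as it is inherited by prefixing a letter
   and holds on the tails of index [i]. *)
Lemma tail_ind i (R : int -> (seq int -> K) -> seq int -> K) : (i < n)%N ->
  (forall M f, inPsi M f -> inPsi M (R M f)) ->
  (forall M x v, (forall f, inPsi M f -> R M f v = 0) ->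
     forall f, inPsi (M + 1) f -> R (M + 1) f (x :: v) = 0) ->
  (forall m f, inPsi (ch i m) f -> R (ch i m) f (tl i m) = 0) ->
  forall M f w, inPsi M f -> R M f w = 0.
Proof.
move=> hi hP hs hb M f w hf; have [m [u [c [eM H]]]] := tail_reach M w hi.
rewrite (H _ (hP _ _ hf)); suff -> : R M f (u ++ tl i m) = 0 by rewrite mulr0.
rewrite {}eM in hf *; elim: u f hf {H} => [|x u IH] f /=; first by rewrite addr0; apply: hb.
have -> : ch i m + (size u).+1%:Z = ch i m + (size u)%:Z + 1 by lia.
exact: hs IH f.
Qed.

End OneSide.
End Functionals.

(** * Operators satisfying a coproduct rule *)

Section Letops.
Variables (K : fieldType) (q : K) (N L : nat).
Hypotheses (hN : (1 < N)%N) (hL : (1 < L)%N) (q0 : q != 0) (q2 : 1 + q ^+ 2 != 0).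
Local Notation Phi := (seq int -> K).
Local Notation inPsi := (inPsi q N L).

Definition fadd (f g : Phi) : Phi := fun v => f v + g v.
Definition fscl (a : K) (f : Phi) : Phi := fun v => a * f v.
Definition fmul (k f : Phi) : Phi := fun v => k v * f v.

(** [ll x] is the factor when the operator passes over the first letter x, and [lk] the diagonal
    factor on the remaining word when it hits that letter. The latter depends on the charge because
    it includes the vacuum. *)
Record letop := Letop { lg : int -> bool; lt : int -> int; ll : int -> K; lk : int -> Phi;
  lX : int -> Phi -> Phi }.

Record letopP (X : letop) : Prop := LetopP {
  lo_psi : forall M f, inPsi M f -> inPsi M (lX X M f);
  lo_lin : forall M a b f f' w, lX X M (fun v => a * f v + b * f' v) w = a * lX X M f w + b * lX X M f' w;
  lo_cons : forall M f x v, inPsi (M + 1) f -> lX X (M + 1) f (x :: v) =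
    (if lg X x then lk X M v * f (lt X x :: v) else 0) + ll X x * lX X M (cn x f) v }.

Lemma fscl1 f : f = fscl 1 f.
Proof. by apply: functional_extensionality => v; rewrite /fscl mul1r. Qed.

Section One.
Variables (X : letop) (HX : letopP X).

Lemma loD M f g : lX X M (fadd f g) = fadd (lX X M f) (lX X M g).
Proof.
apply: functional_extensionality => w; have := lo_lin HX M 1 1 f g w; rewrite !mul1r => E; rewrite [RHS]/fadd -E.
by congr lX; apply: functional_extensionality => v; rewrite !mul1r.
Qed.

Lemma loZ M a f : lX X M (fscl a f) = fscl a (lX X M f).
Proof.
apply: functional_extensionality => w; have := lo_lin HX M a 0 f f w; rewrite !mul0r addr0 => E; rewrite [RHS]/fscl -E.
by congr lX; apply: functional_extensionality => v; rewrite !mul0r addr0.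
Qed.

Lemma lo_cn M f x : inPsi (M + 1) f -> cn x (lX X (M + 1) f) =
  if lg X x then fadd (fmul (lk X M) (cn (lt X x) f)) (fscl (ll X x) (lX X M (cn x f)))
  else fscl (ll X x) (lX X M (cn x f)).
Proof.
move=> hf; apply: functional_extensionality => v; rewrite {1}/cn (lo_cons HX) //.
by case: ifP => _ //; rewrite add0r.
Qed.

Definition lo_pow M k f := iter k (lX X M) f.

Lemma lo_pow_psi M k f : inPsi M f -> inPsi M (lo_pow M k f).
Proof. by move=> hf; elim: k => //= k IH; apply: (lo_psi HX). Qed.

(** The letter x can be hit only once, so the power k + 1 on x :: v splits, up to scalars, into the
    powers k + 1 and k on v; v0 is the cost of moving [lk] through the operator. *)
Lemma nil_step (v0 : K) M k v x :
  (forall x, lg X x -> lg X (lt X x) = false) ->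
  (forall M f, lX X M (fmul (lk X M) f) = fscl v0 (fmul (lk X M) (lX X M f))) ->
  (forall f, inPsi M f -> lo_pow M k f v = 0) ->
  forall f, inPsi (M + 1) f -> lo_pow (M + 1) k.+1 f (x :: v) = 0.
Proof.
move=> hg hk hv f hf.
have N0 y j : lg X y = false -> exists a, cn y (lo_pow (M + 1) j f) = fscl a (lo_pow M j (cn y f)).
  move=> gy; elim: j => [|j [a IH]]; first by exists 1; rewrite -fscl1.
  exists (ll X y * a); rewrite /lo_pow /= -/(lo_pow _ _ _) lo_cn ?gy; last exact: lo_pow_psi.
  by rewrite IH loZ; apply: functional_extensionality => w; rewrite /fscl mulrA.
have hpow g : inPsi M g -> lo_pow M k.+1 g v = 0.
  by move=> hg'; rewrite /lo_pow iterSr; apply: hv; apply: (lo_psi HX).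
rewrite -/(cn x (lo_pow (M + 1) k.+1 f) v).
case gx : (lg X x); last first.
  by have [a ->] := N0 x k.+1 gx; rewrite /fscl hpow ?mulr0 //; apply: cn_psi.
have : exists a c, cn x (lo_pow (M + 1) k.+1 f) =
    fadd (fscl a (lo_pow M k.+1 (cn x f))) (fscl c (fmul (lk X M) (lo_pow M k (cn (lt X x) f)))).
  elim: (k) => [|j [a [c IH]]].
    exists (ll X x), 1; rewrite /lo_pow /= lo_cn // gx.
    by apply: functional_extensionality => w; rewrite /fadd /fscl mul1r addrC.
  have [b Hb] := N0 (lt X x) j.+1 (hg _ gx).
  exists (ll X x * a), (b + ll X x * c * v0).
  rewrite {1}/lo_pow iterS -/(lo_pow _ _ _) lo_cn ?gx; last exact: lo_pow_psi.
  rewrite Hb IH loD !loZ hk; apply: functional_extensionality => w.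
  by rewrite /fadd /fscl /fmul /lo_pow /=; ring.
move=> [a [c ->]]; rewrite /fadd /fscl /fmul hpow ?hv ?mulr0 ?addr0 //; exact: cn_psi.
Qed.

End One.

Section Commute.
Variables (X Y : letop) (HX : letopP X) (HY : letopP Y).
Hypotheses (ht : forall x, lt X (lt Y x) = lt Y (lt X x))
  (hgX : forall x, lg Y x -> lg X (lt Y x) = lg X x) (hgY : forall x, lg X x -> lg Y (lt X x) = lg Y x).

Definition lo_comm M f w := lX X M (lX Y M f) w - lX Y M (lX X M f) w.

Lemma lo_comm_psi M f : inPsi M f -> inPsi M (lo_comm M f).
Proof.
move=> hf; have := psi_lin 1 (-1) (lo_psi HX (lo_psi HY hf)) (lo_psi HY (lo_psi HX hf)).
by congr inPsi; apply: functional_extensionality => w; rewrite mul1r mulN1r.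
Qed.

Hypotheses (hlX : forall x, lg Y x -> ll X (lt Y x) = ll X x)
  (hlY : forall x, lg X x -> ll Y (lt X x) = ll Y x)
  (hkX : forall M f, lX X M (fmul (lk Y M) f) = fmul (lk Y M) (lX X M f))
  (hkY : forall M f, lX Y M (fmul (lk X M) f) = fmul (lk X M) (lX Y M f)).

(** The terms where at least one operator hits x match pairwise; the remaining one is the commutator
    on v. *)
Lemma comm_step M x v : (forall f, inPsi M f -> lo_comm M f v = 0) ->
  forall f, inPsi (M + 1) f -> lo_comm (M + 1) f (x :: v) = 0.
Proof.
move=> hv f hf; have hXf := lo_psi HX hf; have hYf := lo_psi HY hf.
have := hv _ (cn_psi x hf); rewrite /lo_comm => /eqP; rewrite subr_eq0 => /eqP E.
rewrite -/(cn x (lX X _ (lX Y _ _)) v) -/(cn x (lX Y _ (lX X _ _)) v).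
have cX y g : inPsi (M + 1) g -> _ := @lo_cn _ HX M g y.
have cY y g : inPsi (M + 1) g -> _ := @lo_cn _ HY M g y.
rewrite (cX x) // (cY x _ hXf) (cX x _ hf) (cY x _ hf) (cX (lt Y x)) // (cY (lt X x)) //.
case gx : (lg X x); case gy : (lg Y x).
- rewrite hgX // hgY // gx gy !(loD HX) !(loD HY) !(loZ HX) !(loZ HY) hkX hkY ht hlX // hlY //.
  by rewrite /fadd /fscl /fmul E; ring.
- rewrite hgY // gy !(loD HY) !(loZ HX) !(loZ HY) hkY hlY //.
  by rewrite /fadd /fscl /fmul E; ring.
- rewrite hgX // gx !(loD HX) !(loZ HX) !(loZ HY) hkX hlX //.
  by rewrite /fadd /fscl /fmul E; ring.
- by rewrite !(loZ HX) !(loZ HY) /fscl E; ring.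
Qed.

End Commute.

(** * Inheritance of the Serre relations by prefixing a letter *)

Section SerreStep.
Variables (X Y : letop) (HX : letopP X) (HY : letopP Y).
Variables (t : int -> int) (z : bool) (a : int).
Local Notation uu b := (if z then q ^ b else 1).
Local Notation vv b := (if z then 1 else q ^ b).
Hypotheses (htX : lt X = t) (htY : lt Y = t).
Hypotheses (hXX : forall x, lg X x -> lg X (t x) = false) (hXY : forall x, lg X x -> lg Y x = false).
Hypotheses
  (hlXX : forall x, lg X x -> ll X (t x) = uu 2 * ll X x)
  (hlXY : forall x, lg X x -> ll Y (t x) = uu a * ll Y x)
  (hlYX : forall x, lg Y x -> ll X (t x) = uu a * ll X x)
  (hkXX : forall M f, lX X M (fmul (lk X M) f) = fscl (vv 2) (fmul (lk X M) (lX X M f)))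
  (hkXY : forall M f, lX X M (fmul (lk Y M) f) = fscl (vv a) (fmul (lk Y M) (lX X M f)))
  (hkYX : forall M f, lX Y M (fmul (lk X M) f) = fscl (vv a) (fmul (lk X M) (lX Y M f))).

(** The Serre expressions for a = 0, -1 and -2, with coefficients [2] and [3]; the last occurs only
    for affine sl_2. The boolean [z] tells which factor of the coproduct, the left one [ll] or the
    right one [lk], carries the powers of q. *)
Definition serre1 M f w := lX X M (lX Y M f) w - lX Y M (lX X M f) w.
Definition serre2 M f w := lX X M (lX X M (lX Y M f)) w
  - (q + q^-1) * lX X M (lX Y M (lX X M f)) w + lX Y M (lX X M (lX X M f)) w.
Definition serre3 M f w := lX X M (lX X M (lX X M (lX Y M f))) w
  - (q ^+ 2 + 1 + q ^- 2) * lX X M (lX X M (lX Y M (lX X M f))) w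
  + (q ^+ 2 + 1 + q ^- 2) * lX X M (lX Y M (lX X M (lX X M f))) w
  - lX Y M (lX X M (lX X M (lX X M f))) w.

Lemma fmulD k f g : fmul k (fadd f g) = fadd (fmul k f) (fmul k g).
Proof. by apply: functional_extensionality => v; rewrite /fmul /fadd mulrDr. Qed.
Lemma fmulZ k c f : fmul k (fscl c f) = fscl c (fmul k f).
Proof. by apply: functional_extensionality => v; rewrite /fmul /fscl; ring. Qed.
Lemma fsclD c f g : fscl c (fadd f g) = fadd (fscl c f) (fscl c g).
Proof. by apply: functional_extensionality => v; rewrite /fscl /fadd mulrDr. Qed.
Lemma fsclZ c d f : fscl c (fscl d f) = fscl (c * d) f.
Proof. by apply: functional_extensionality => v; rewrite /fscl mulrA. Qed.

Lemma cnX M f x : lg X x -> inPsi (M + 1) f -> cn x (lX X (M + 1) f) =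
  fadd (fmul (lk X M) (cn (t x) f)) (fscl (ll X x) (lX X M (cn x f))).
Proof. by move=> gx hf; rewrite (lo_cn HX) // gx htX. Qed.
Lemma cnX0 M f x : lg X x = false -> inPsi (M + 1) f -> cn x (lX X (M + 1) f) =
  fscl (ll X x) (lX X M (cn x f)).
Proof. by move=> gx hf; rewrite (lo_cn HX) // gx. Qed.
Lemma cnY M f x : lg Y x -> inPsi (M + 1) f -> cn x (lX Y (M + 1) f) =
  fadd (fmul (lk Y M) (cn (t x) f)) (fscl (ll Y x) (lX Y M (cn x f))).
Proof. by move=> gx hf; rewrite (lo_cn HY) // gx htY. Qed.
Lemma cnY0 M f x : lg Y x = false -> inPsi (M + 1) f -> cn x (lX Y (M + 1) f) =
  fscl (ll Y x) (lX Y M (cn x f)).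
Proof. by move=> gx hf; rewrite (lo_cn HY) // gx. Qed.

Ltac psi := repeat first [assumption | apply: (lo_psi HX) | apply: (lo_psi HY)].
Ltac expand := repeat (first
  [ rewrite cnX; [|assumption|by psi] | rewrite cnX0; [|assumption|by psi]
  | rewrite cnY; [|assumption|by psi] | rewrite cnY0; [|assumption|by psi] ]).
Ltac normal := rewrite ?(loD HX, loD HY, loZ HX, loZ HY, hkXX, hkXY, hkYX, fmulD, fmulZ, fsclD, fsclZ).

Ltac finish e2 ea em E := rewrite ?ea; move: E; rewrite /fadd /fscl /fmul => E;
  case: (z); rewrite ?e2 ?em E; by field.

Lemma serre1_step M x v : a = 0 -> (forall x, lg X x -> lg Y (t x) = false) ->
  (forall x, lg Y x -> lg X (t x) = false) ->
  (forall f, inPsi M f -> serre1 M f v = 0) ->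
  forall f, inPsi (M + 1) f -> serre1 (M + 1) f (x :: v) = 0.
Proof.
move=> ea h1 h2 hv f hf; have := hv _ (cn_psi x hf); rewrite /serre1.
move=> /eqP; rewrite subr_eq0 => /eqP E.
have e2 : q ^ (2 : int) = q ^+ 2 by []; have em : q ^ (0 : int) = 1 by [].
rewrite -/(cn x (lX X _ (lX Y _ _)) v) -/(cn x (lX Y _ (lX X _ _)) v).
case gx : (lg X x).
  have gx' := hXX gx; have gy := hXY gx; have gy' := h1 _ gx; expand; normal.
  rewrite (hlXY gx); finish e2 ea em E.
case gy : (lg Y x).
  have gx' := h2 _ gy; expand; normal.
  rewrite (hlYX gy); finish e2 ea em E.
expand; normal; finish e2 ea em E.
Qed.

(** The terms that hit x are grouped by the image of x, and their coefficients cancel by the q-Serre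
    identity. The chain X, Y, X on one letter is excluded since it would need a = -2. *)
Lemma serre2_step M x v : a = -1 -> (forall x, lg X x -> lg Y (t x) -> lg X (t (t x)) = false) ->
  (forall f, inPsi M f -> serre2 M f v = 0) ->
  forall f, inPsi (M + 1) f -> serre2 (M + 1) f (x :: v) = 0.
Proof.
move=> ea h3 hv f hf; have := hv _ (cn_psi x hf); rewrite /serre2.
move=> /eqP; rewrite addr_eq0 subr_eq => /eqP E.
have e2 : q ^ (2 : int) = q ^+ 2 by []; have em : q ^ (-1 : int) = q^-1 by [].
rewrite -/(cn x (lX X _ (lX X _ (lX Y _ _))) v) -/(cn x (lX X _ (lX Y _ (lX X _ _))) v)
  -/(cn x (lX Y _ (lX X _ (lX X _ _))) v).
case gx : (lg X x).
  have gx' := hXX gx; have gy := hXY gx; case gy' : (lg Y (t x)).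
    have g3 := h3 _ gx gy'; expand; normal.
    rewrite (hlXX gx) (hlXY gx) (hlYX gy') (hlXX gx); finish e2 ea em E.
  expand; normal; rewrite (hlXX gx) (hlXY gx); finish e2 ea em E.
case gy : (lg Y x).
  case gx' : (lg X (t x)).
    have gx2 := hXX gx'; expand; normal.
    rewrite (hlXX gx') (hlYX gy); finish e2 ea em E.
  expand; normal; rewrite (hlYX gy); finish e2 ea em E.
expand; normal; finish e2 ea em E.
Qed.

(** With two classes only, X, Y, X may act in turn on one letter, so the longest chains are expanded
    too. *)
Lemma serre3_step M x v : a = -2 ->
  (forall f, inPsi M f -> serre3 M f v = 0) ->
  forall f, inPsi (M + 1) f -> serre3 (M + 1) f (x :: v) = 0.
Proof.
move=> ea hv f hf; have := hv _ (cn_psi x hf); rewrite /serre3.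
move=> /eqP; rewrite subr_eq0 => /eqP /esym E.
have e2 : q ^ (2 : int) = q ^+ 2 by []; have em : q ^ (-2 : int) = q ^- 2 by [].
rewrite -/(cn x (lX X _ (lX X _ (lX X _ (lX Y _ _)))) v) -/(cn x (lX X _ (lX X _ (lX Y _ (lX X _ _)))) v)
  -/(cn x (lX X _ (lX Y _ (lX X _ (lX X _ _)))) v) -/(cn x (lX Y _ (lX X _ (lX X _ (lX X _ _)))) v).
case gx : (lg X x).
  have gx' := hXX gx; have gy := hXY gx; case gy' : (lg Y (t x)).
    case g3 : (lg X (t (t x))).
      have g4 := hXX g3; expand; normal.
      rewrite (hlXX g3) (hlXX gx) (hlXY gx) (hlYX gy') (hlXX gx); finish e2 ea em E.
    expand; normal.
    rewrite (hlXX gx) (hlXY gx) (hlYX gy') (hlXX gx); finish e2 ea em E.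
  expand; normal; rewrite (hlXX gx) (hlXY gx); finish e2 ea em E.
case gy : (lg Y x).
  case gx' : (lg X (t x)).
    have gx2 := hXX gx'; expand; normal.
    rewrite (hlXX gx') (hlYX gy); finish e2 ea em E.
  expand; normal; rewrite (hlYX gy); finish e2 ea em E.
expand; normal; finish e2 ea em E.
Qed.

Definition serreG M f w :=
  if a == 0 then serre1 M f w else if a == -1 then serre2 M f w else serre3 M f w.

Lemma serreG_psi M f : inPsi M f -> inPsi M (serreG M f).
Proof.
move=> hf; rewrite /serreG.
have pX g : inPsi M g -> inPsi M (lX X M g) by apply: (lo_psi HX).
have pY g : inPsi M g -> inPsi M (lX Y M g) by apply: (lo_psi HY).
case: (a == 0).
  have := psi_lin 1 (-1) (pX _ (pY _ hf)) (pY _ (pX _ hf)).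
  by congr inPsi; apply: functional_extensionality => w; rewrite /serre1; ring.
case: (a == -1).
  have h1 := psi_lin 1 (- (q + q^-1)) (pX _ (pX _ (pY _ hf))) (pX _ (pY _ (pX _ hf))).
  have := psi_lin 1 1 h1 (pY _ (pX _ (pX _ hf))).
  by congr inPsi; apply: functional_extensionality => w; rewrite /serre2; ring.
have h1 := psi_lin 1 (- (q ^+ 2 + 1 + q ^- 2)) (pX _ (pX _ (pX _ (pY _ hf)))) (pX _ (pX _ (pY _ (pX _ hf)))).
have h2 := psi_lin (q ^+ 2 + 1 + q ^- 2) (-1) (pX _ (pY _ (pX _ (pX _ hf)))) (pY _ (pX _ (pX _ (pX _ hf)))).
have := psi_lin 1 1 h1 h2.
by congr inPsi; apply: functional_extensionality => w; rewrite /serre3; ring.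
Qed.

Lemma serreG_step M x v :
  (a = 0 -> forall x, (lg X x -> lg Y (t x) = false) /\ (lg Y x -> lg X (t x) = false)) ->
  (a = -1 -> forall x, lg X x -> lg Y (t x) -> lg X (t (t x)) = false) ->
  [|| a == 0, a == -1 | a == -2] ->
  (forall f, inPsi M f -> serreG M f v = 0) ->
  forall f, inPsi (M + 1) f -> serreG (M + 1) f (x :: v) = 0.
Proof.
rewrite /serreG => h0 h1.
have [e0 _|_] := eqVneq a 0.
  by apply: serre1_step => // y hy; case: (h0 e0 y) => A B; [exact: A|exact: B].
have [e1 _|_] := eqVneq a (-1); first by apply: serre2_step => //; apply: h1.
by move=> /= /eqP e2; apply: serre3_step.
Qed.

End SerreStep.
End Letops.

(** * The relations on functionals *)

Section Relations.
Variables (K : fieldType) (q : K) (N L : nat).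
Hypotheses (hN : (1 < N)%N) (hL : (1 < L)%N) (q0 : q != 0) (q2 : 1 + q ^+ 2 != 0).
Hypothesis hq : forall k, (0 < k)%N -> q ^+ k != 1.
Local Notation Phi := (seq int -> K).
Local Notation inPsi := (inPsi q N L).

(** A word has finitely many images; this turns local nilpotency word by word into a uniform
    exponent. *)
Lemma cop_supp (g : int -> bool) t l r w : exists ws : seq (seq int),
  forall f : Phi, (forall u, u \in ws -> f u = 0) -> cop g t l r w f = 0.
Proof.
elim: w => [|x w [ws IH]]; first by exists [::].
exists ((t x :: w) :: map (cons x) ws) => f hf /=.
rewrite IH; last by move=> u hu; apply: hf; rewrite inE map_f ?orbT.
by rewrite hf ?inE ?eqxx // !mulr0 if_same addr0.
Qed.

Lemma q_qV : q - q^-1 != 0.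
Proof.
have := hq (isT : (0 < 2)%N); apply: contraNneq => /(congr1 (fun z => z * q)).
by rewrite mulrBl mulVf // mul0r -expr2 => /eqP; rewrite subr_eq0.
Qed.

Section OneSide.
Variables (S : side) (HS : sideP q N L S).
Local Notation n := (sn S).
Local Notation cl := (scl S).
Local Notation kk := (kk q S).
Local Notation XE := (XE q N L S).
Local Notation XF := (XF q N L S).
Local Notation KH := (KH q N L S).
Local Notation cart := (cart S).

Definition LE i : letop K := Letop (gE S i) (stp S) (lE q S i) (fun M => kE q N L S M i) (fun M => XE M i).
Definition LF i : letop K := Letop (gF S i) (stp' S) (lF q S i) (fun M => kF q N L S M i) (fun M => XF M i).

Lemma LEP i : (i < n)%N -> letopP q N L (LE i).
Proof.
move=> hi; split=> /= [M f|M a b f f' w|M f x v]; first exact: XE_psi.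
  exact: XE_lin.
exact: XE_cons.
Qed.
Lemma LFP i : (i < n)%N -> letopP q N L (LF i).
Proof.
move=> hi; split=> /= [M f|M a b f f' w|M f x v]; first exact: XF_psi.
  exact: XF_lin.
exact: XF_cons.
Qed.

Lemma cartC i j : cart i j = cart j i.
Proof. by rewrite /cart (eq_sym i j); ring. Qed.

Lemma XE_fKH M i j f : (i < n)%N -> (j < n)%N ->
  XE M j (fmul (KH M i) f) = fscl (q ^ cart i j) (fmul (KH M i) (XE M j f)).
Proof.
by move=> hi hj; apply: functional_extensionality => w; rewrite /fscl /fmul XE_KH // mulrA.
Qed.
Lemma XF_fKH M i j f : (i < n)%N -> (j < n)%N ->
  XF M j (fmul (KH M i) f) = fscl (q ^ (- cart i j)) (fmul (KH M i) (XF M j f)).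
Proof.
by move=> hi hj; apply: functional_extensionality => w; rewrite /fscl /fmul XF_KH // mulrA.
Qed.

Lemma fmulK M i f : fmul (KH M i) (fmul (fun v => (KH M i v)^-1) f) = f.
Proof.
by apply: functional_extensionality => w; rewrite /fmul mulrA divff ?mul1r // KH_neq0.
Qed.

Lemma diag_inv (X : Phi -> Phi) M i b :
  (forall f, X (fmul (KH M i) f) = fscl (q ^ b) (fmul (KH M i) (X f))) ->
  forall f, X (fmul (fun v => (KH M i v)^-1) f) =
    fscl (q ^ (- b)) (fmul (fun v => (KH M i v)^-1) (X f)).
Proof.
move=> H f; have := H (fmul (fun v => (KH M i v)^-1) f); rewrite fmulK => ->.
apply: functional_extensionality => w; rewrite /fscl /fmul.
have := expfz_neq0 b q0; have := KH_neq0 hN hL q0 q2 S M i w.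
by rewrite -invr_expz => h1 h2; field; rewrite h1 h2.
Qed.

Lemma kE_shift M i j f : (i < n)%N -> (j < n)%N -> XE M j (fmul (kE q N L S M i) f) =
  fscl (if ss S then 1 else q ^ cart i j) (fmul (kE q N L S M i) (XE M j f)).
Proof.
move=> hi hj; rewrite /kE; case: (ss S); last exact: XE_fKH.
have e g : fmul (fun _ => 1) g = g by apply: functional_extensionality => w; rewrite /fmul mul1r.
by rewrite !e -fscl1.
Qed.

Lemma kF_shift M i j f : (i < n)%N -> (j < n)%N -> XF M j (fmul (kF q N L S M i) f) =
  fscl (if ss S then q ^ cart i j else 1) (fmul (kF q N L S M i) (XF M j f)).
Proof.
move=> hi hj; rewrite /kF; case: (ss S).
  by rewrite (@diag_inv _ M i (- cart i j)) ?opprK // => g; apply: XF_fKH.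
have e g : fmul (fun _ => 1) g = g by apply: functional_extensionality => w; rewrite /fmul mul1r.
by rewrite !e -fscl1.
Qed.

Lemma lE_stp i j x : (i < n)%N -> (j < n)%N -> cl x = nx n j ->
  lE q S i (stp S x) = (if ss S then q ^ cart i j else 1) * lE q S i x.
Proof.
by move=> hi hj hx; rewrite /lE; case: (ss S); rewrite ?mul1r // (kk_stp hN hL q0 q2 HS hi hj hx).
Qed.
Lemma lF_stp i j x : (i < n)%N -> (j < n)%N -> cl x = j ->
  lF q S i (stp' S x) = (if ss S then 1 else q ^ cart i j) * lF q S i x.
Proof.
move=> hi hj hx; rewrite /lF; case: (ss S); rewrite ?mul1r // (kk_stp' hN hL q0 q2 HS hi hj hx).
by rewrite invfM -invr_expz invrK.
Qed.
Lemma lE_stp' i j x : (i < n)%N -> (j < n)%N -> cl x = j ->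
  lE q S i (stp' S x) = (if ss S then q ^ (- cart i j) else 1) * lE q S i x.
Proof.
by move=> hi hj hx; rewrite /lE; case: (ss S); rewrite ?mul1r // (kk_stp' hN hL q0 q2 HS hi hj hx).
Qed.
Lemma lF_stpE i j x : (i < n)%N -> (j < n)%N -> cl x = nx n j ->
  lF q S i (stp S x) = (if ss S then 1 else q ^ (- cart i j)) * lF q S i x.
Proof.
move=> hi hj hx; rewrite /lF; case: (ss S); rewrite ?mul1r // (kk_stp hN hL q0 q2 HS hi hj hx).
by rewrite invfM -invr_expz.
Qed.

Lemma kE_shiftF M i j f : (i < n)%N -> (j < n)%N -> XF M j (fmul (kE q N L S M i) f) =
  fscl (if ss S then 1 else q ^ (- cart i j)) (fmul (kE q N L S M i) (XF M j f)).
Proof.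
move=> hi hj; rewrite /kE; case: (ss S); last exact: XF_fKH.
have e g : fmul (fun _ => 1) g = g by apply: functional_extensionality => w; rewrite /fmul mul1r.
by rewrite !e -fscl1.
Qed.
Lemma kF_shiftE M i j f : (i < n)%N -> (j < n)%N -> XE M j (fmul (kF q N L S M i) f) =
  fscl (if ss S then q ^ (- cart i j) else 1) (fmul (kF q N L S M i) (XE M j f)).
Proof.
move=> hi hj; rewrite /kF; case: (ss S).
  by rewrite (@diag_inv _ M i (cart i j)) // => g; apply: XE_fKH.
have e g : fmul (fun _ => 1) g = g by apply: functional_extensionality => w; rewrite /fmul mul1r.
by rewrite !e -fscl1.
Qed.

Lemma nx_eqb i j : (i < n)%N -> (j < n)%N -> (nx n i == nx n j) = (i == j).
Proof.
move=> hi hj; apply/eqP/eqP => [|-> //].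
exact: (nx_inj hN hL q0 q2).
Qed.

Definition cEF (i j : nat) : K := (i == j)%:R / (q - q^-1).
(** Transposition reverses products: [XF] of [XE f] is f evaluated after E_i F_j. *)
Definition REF i j M (f : Phi) w := XF M j (XE M i f) w - XE M i (XF M j f) w
  - cEF i j * (KH M i w - (KH M i w)^-1) * f w.

Lemma REF_psi i j M f : (i < n)%N -> (j < n)%N -> inPsi M f -> inPsi M (REF i j M f).
Proof.
move=> hi hj hf; have hE := XE_psi hN hL q0 q2 HS hi hf; have hF := XF_psi hN hL q0 q2 HS hj hf.
have h1 := psi_lin 1 (-1) (XF_psi hN hL q0 q2 HS hj hE) (XE_psi hN hL q0 q2 HS hi hF).
have h2 := psi_lin (- cEF i j) (cEF i j) (psi_KH hN hL q0 q2 HS hi hf) (psi_KHV hN hL q0 q2 HS hi hf).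
have := psi_lin 1 1 h1 h2.
by congr inPsi; apply: functional_extensionality => w; rewrite /REF; ring.
Qed.

(** For i = j and x in class i or i + 1, the terms where both operators hit x supply the change of
    K_i - K_i^-1 caused by x; all mixed terms cancel. *)
Lemma REF_step i j M x v : (i < n)%N -> (j < n)%N ->
  (forall f, inPsi M f -> REF i j M f v = 0) ->
  forall f, inPsi (M + 1) f -> REF i j (M + 1) f (x :: v) = 0.
Proof.
move=> hi hj hv f hf; have := hv _ (cn_psi x hf); rewrite /REF.
move=> /eqP; rewrite subr_eq0 subr_eq => /eqP E.
have hE := XE_psi hN hL q0 q2 HS hi hf; have hF := XF_psi hN hL q0 q2 HS hj hf.
have cX y g : inPsi (M + 1) g -> _ := @lo_cn _ _ _ _ _ (LEP hi) M g y.
have cY y g : inPsi (M + 1) g -> _ := @lo_cn _ _ _ _ _ (LFP hj) M g y.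
rewrite /= in cX cY.
have XD g g' := loD (LEP hi) M g g'; have XZ c g := loZ (LEP hi) M c g.
have YD g g' := loD (LFP hj) M g g'; have YZ c g := loZ (LFP hj) M c g.
rewrite /= in XD XZ YD YZ.
have kY g := kE_shiftF M g hi hj; have kX g := kF_shiftE M g hj hi.
have hqq : q * q - 1 != 0 by rewrite subr_eq0 -expr2 hq.
have hK := KH_neq0 hN hL q0 q2 S M i v.
rewrite (KH_cons hN hL q0 q2 HS) // -/(cn x (XF _ j (XE _ i f)) v) -/(cn x (XE _ i (XF _ j f)) v).
rewrite (cX x _ hF) (cY x _ hE) (cX x _ hf) (cY x _ hf) (cX (stp' S x) _ hf) (cY (stp S x) _ hf).
rewrite (s_K HS) (s_K' HS) /gE /gF.
have kx : kk i x = if cl x == i then q else if cl x == nx n i then q^-1 else 1.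
  rewrite kkE /ind; case: eqP => [->|_].
    by rewrite eq_sym (nx_neq hN hL q0 q2 HS hi) subr0 expr1z.
  by case: eqP => _; rewrite ?sub0r ?exprN1 ?subrr ?expr0z.
move: E; rewrite /cEF.
case hgF : (cl x == j); case hgE : (cl x == nx n i).
- have eij : (i == j) = false.
    by apply/negP => /eqP eij; move: hgE; rewrite (eqP hgF) -eij eq_sym (nx_neq hN hL q0 q2 HS hi).
  rewrite (clF hN hL q0 q2 HS hj (eqP hgF)) (s_clE HS hi (eqP hgE)) nx_eqb // (eq_sym j i) eij.
  rewrite ?(XD, XZ, YD, YZ, kX, kY) (lE_stp' hi hj (eqP hgF)) (lF_stpE hj hi (eqP hgE)) (cartC j i).
  rewrite /fadd /fscl /fmul /= !mulr0n !mul0r add0r !subr0 => ->.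
  by case: (ss S); ring.
- rewrite (clF hN hL q0 q2 HS hj (eqP hgF)) nx_eqb // (eq_sym j i) (lE_stp' hi hj (eqP hgF)).
  rewrite ?(XD, XZ, YD, YZ, kX, kY) (cartC j i) kx hgE (eqP hgF) (eq_sym j i).
  case eij : (i == j).
    rewrite /fadd /fscl /fmul /lE /lF /kE /kF -(eqP eij) kx (eqP hgF) -(eqP eij) eqxx => ->.
    rewrite /cn mulr1n; case: (ss S).
      by field; rewrite ?hK ?q0 ?hqq ?oner_eq0.
    by field; rewrite ?hK ?q0 ?hqq ?oner_eq0.
  rewrite /fadd /fscl /fmul /= !mulr0n !mul0r add0r !subr0 => ->.
  by case: (ss S); ring.
- rewrite (s_clE HS hi (eqP hgE)) (lF_stpE hj hi (eqP hgE)).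
  rewrite ?(XD, XZ, YD, YZ, kX, kY) (cartC j i) kx (eqP hgE) (nx_neq hN hL q0 q2 HS hi) eqxx.
  case eij : (i == j).
    rewrite /fadd /fscl /fmul /lE /lF /kE /kF -(eqP eij) kx (eqP hgE) (nx_neq hN hL q0 q2 HS hi) eqxx => ->.
    rewrite /cn mulr1n; case: (ss S).
      by field; rewrite ?hK ?q0 ?hqq ?oner_eq0.
    by field; rewrite ?hK ?q0 ?hqq ?oner_eq0.
  rewrite /fadd /fscl /fmul /= !mulr0n !mul0r add0r !subr0 => ->.
  by case: (ss S); ring.
- rewrite ?(XZ, YZ) kx hgE /fscl; case eij : (i == j).
    rewrite (eqP eij) hgF /lE /lF -(eqP eij) kx hgE (eqP eij) hgF => ->.
    by rewrite /cn mulr1n; case: (ss S); field; rewrite -?(eqP eij) ?hK ?q0 ?hqq ?oner_eq0.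
  by rewrite /= !mulr0n !mul0r add0r !subr0 => ->; ring.
Qed.

(** On the tail of index j both products vanish, and for i = j so does the right-hand side, since
    K_i acts there by 1. *)
Lemma EF_rel i j M f w : (i < n)%N -> (j < n)%N -> inPsi M f -> REF i j M f w = 0.
Proof.
move=> hi hj; apply: (tail_ind hN hL q0 q2 HS hj (R := REF i j)).
- by move=> M' f'; apply: REF_psi.
- by move=> M' x v; apply: REF_step.
move=> m f' hf'; have hE := XE_psi hN hL q0 q2 HS hi hf'; have hF := XF_psi hN hL q0 q2 HS hj hf'.
rewrite /REF (XF_tl hN hL q0 q2 HS hj hE) (XE_tl hN hL q0 q2 HS hj hi hF) subrr sub0r.
rewrite /cEF; case eij : (i == j); last by rewrite mulr0n !mul0r oppr0.
by rewrite (eqP eij) (KH_tl hN hL q0 q2 HS) // invr1 subrr mulr0 mul0r oppr0.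
Qed.

Lemma gE_stp i x : (i < n)%N -> gE S i x -> gE S i (stp S x) = false.
Proof.
by move=> hi /eqP hx; rewrite /gE (s_clE HS hi hx) eq_sym (nx_neq hN hL q0 q2 HS hi).
Qed.
Lemma gF_stp i x : (i < n)%N -> gF S i x -> gF S i (stp' S x) = false.
Proof.
by move=> hi /eqP hx; rewrite /gF (clF hN hL q0 q2 HS hi hx) (nx_neq hN hL q0 q2 HS hi).
Qed.

(** The exponent is one more than the number of letters in front of the tail, each of which can be
    hit once. *)
Lemma nil_any (X : letop K) i v0 : letopP q N L X -> (i < n)%N ->
  (forall x, lg X x -> lg X (lt X x) = false) ->
  (forall M f, lX X M (fmul (lk X M) f) = fscl v0 (fmul (lk X M) (lX X M f))) ->
  (forall m f, inPsi (ch N L S i m) f -> lX X (ch N L S i m) f (tl N L S i m) = 0) ->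
  forall M w, exists k, forall f, inPsi M f -> iter k (lX X M) f w = 0.
Proof.
move=> HX hi hg hk h0 M w; have [m [u [c [eM H]]]] := tail_reach hN hL q0 q2 HS M w hi.
exists (size u).+1 => f hf.
rewrite -/(lo_pow X M (size u).+1 f) (H _ (lo_pow_psi HX (size u).+1 hf)); suff -> : lo_pow X M (size u).+1 f (u ++ tl N L S i m) = 0.
  by rewrite mulr0.
rewrite {}eM in hf *; elim: u f hf {H} => [|x u IH] f /=; first by rewrite addr0; apply: h0.
have -> : ch N L S i m + (size u).+1%:Z = ch N L S i m + (size u)%:Z + 1 by lia.
exact: (nil_step HX x hg hk IH).
Qed.

Lemma nilE i M w : (i < n)%N -> exists k, forall f, inPsi M f -> iter k (XE M i) f w = 0.
Proof.
move=> hi; apply: (nil_any (LEP hi) hi (v0 := if ss S then 1 else q ^ cart i i)) => [x|M' f|m f] /=.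
- exact: gE_stp.
- by rewrite kE_shift.
- exact: XE_tl.
Qed.
Lemma nilF i M w : (i < n)%N -> exists k, forall f, inPsi M f -> iter k (XF M i) f w = 0.
Proof.
move=> hi; apply: (nil_any (LFP hi) hi (v0 := if ss S then q ^ cart i i else 1)) => [x|M' f|m f] /=.
- exact: gF_stp.
- by rewrite kF_shift.
- exact: XF_tl.
Qed.

Lemma cart_diag i : (i < n)%N -> cart i i = 2.
Proof. by move=> hi; rewrite /cart eqxx eq_sym (nx_neq hN hL q0 q2 HS hi) /ind; lia. Qed.

Definition qn (k : nat) : K := (q ^+ k - q ^- k) / (q - q^-1).

(** The transpose of the quantum sl_2 formula for the commutator of E with F^(k+1), where [qn k.+1]
    is the quantum integer [k+1]. *)
Lemma EF_pow i M k f : (i < n)%N -> inPsi M f ->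
  iter k.+1 (XF M i) (XE M i f) =
  fadd (XE M i (iter k.+1 (XF M i) f))
   (fadd (fscl (qn k.+1 / (q - q^-1) * q ^- k) (fmul (KH M i) (iter k (XF M i) f)))
     (fscl (- (qn k.+1 / (q - q^-1) * q ^+ k)) (fmul (fun v => (KH M i v)^-1) (iter k (XF M i) f)))).
Proof.
move=> hi hf; have hqq : q * q - 1 != 0 by rewrite subr_eq0 -expr2 hq.
have hF k' : inPsi M (iter k' (XF M i) f) by apply: (lo_pow_psi (LFP hi)).
have rel g : inPsi M g -> XF M i (XE M i g) = fadd (XE M i (XF M i g))
    (fadd (fscl (q - q^-1)^-1 (fmul (KH M i) g))
      (fscl (- (q - q^-1)^-1) (fmul (fun v => (KH M i v)^-1) g))).
  move=> hg; apply: functional_extensionality => w; have := EF_rel w hi hi hg.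
  rewrite /REF /cEF eqxx mulr1n => /eqP; rewrite subr_eq0 subr_eq => /eqP ->.
  by rewrite /fadd /fscl /fmul; ring.
elim: k => [|k IH].
  rewrite /= rel //; apply: functional_extensionality => w; rewrite /fadd /fscl /fmul /qn.
  have hK := KH_neq0 hN hL q0 q2 S M i w.
  by field; rewrite ?hK ?q0 ?hqq ?oner_eq0.
have FD g g' := loD (LFP hi) M g g'; have FZ c g := loZ (LFP hi) M c g; rewrite /= in FD FZ.
rewrite iterS IH !FD (FZ (qn k.+1 / (q - q^-1) * q ^- k)) (FZ (- (qn k.+1 / (q - q^-1) * q ^+ k))).
rewrite (XF_fKH M _ hi hi).
rewrite (@diag_inv (XF M i) M i (- cart i i)); last by move=> g; apply: XF_fKH.
rewrite rel; last exact: (hF k.+1).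
rewrite cart_diag // opprK; apply: functional_extensionality => w; rewrite /fadd /fscl /fmul /qn.
have -> : q ^ (- 2 : int) = q ^- 2 by [].
have -> : q ^ (2 : int) = q ^+ 2 by [].
rewrite !exprS expr0 !iterS; have hK := KH_neq0 hN hL q0 q2 S M i w.
have hqk := expf_neq0 k q0; move: (q ^+ k) hqk => qk hqk.
by field; rewrite ?hK ?q0 ?hqq ?oner_eq0 ?hqk.
Qed.

Lemma qn_neq0 k : qn k.+1 != 0.
Proof.
rewrite mulf_neq0 ?invr_eq0 ?q_qV // subr_eq0; apply/eqP => /(congr1 (fun z => z * q ^+ k.+1)).
rewrite mulVf ?expf_neq0 // -exprD => /eqP; apply/negP; apply: hq; lia.
Qed.

Lemma nil_list i M (ws : seq (seq int)) : (i < n)%N -> exists k0, forall k f u, (k0 <= k)%N ->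
  inPsi M f -> u \in ws -> iter k (XF M i) f u = 0.
Proof.
move=> hi; elim: ws => [|w ws [k0 IH]]; first by exists 0%N.
have [k1 H1] := nilF M w hi; exists (maxn k0 k1) => k f u hk hf; rewrite inE => /orP [/eqP ->|hu].
  have -> : k = (k1 + (k - k1))%N by rewrite subnKC //; lia.
  by rewrite iterD; apply: H1; apply: (lo_pow_psi (LFP hi)).
by apply: IH => //; lia.
Qed.

(* [Y] sends the tail of index [i] to a highest weight vector of weight [b] for the quantum sl_2 of
   index [i]; since F_i is locally nilpotent, that vector is killed by F_i^(b + 1). *)
Lemma hw_vanish i (Y : letop K) (b : nat) : letopP q N L Y -> (i < n)%N ->
  (forall M f w, inPsi M f -> lX Y M (XE M i f) w = XE M i (lX Y M f) w) ->
  (forall M f, lX Y M (fmul (KH M i) f) = fscl (q ^+ b) (fmul (KH M i) (lX Y M f))) ->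
  (forall M w, exists ws : seq (seq int), forall f, (forall u, u \in ws -> f u = 0) -> lX Y M f w = 0) ->
  forall m k f, (b < k)%N -> inPsi (ch N L S i m) f ->
    lX Y (ch N L S i m) (iter k (XF (ch N L S i m) i) f) (tl N L S i m) = 0.
Proof.
move=> HY hi hE hK hsup m; set M := ch N L S i m; set tt := tl N L S i m.
have [ws Hws] := hsup M tt; have [k0 Hk0] := nil_list M ws hi.
have big k f : (k0 <= k)%N -> inPsi M f -> lX Y M (iter k (XF M i) f) tt = 0.
  by move=> hk hf; apply: Hws => u hu; apply: Hk0.
(* E_i applied to F_i^(k+1) Y(tail) = 0 gives [k+1] (q^(b-k) - q^(k-b)) F_i^k Y(tail) = 0 up to a
   nonzero factor, and the coefficient is nonzero for k > b. This allows a descent from the uniform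
   exponent k0. *)
have step k : (b < k)%N -> (forall f, inPsi M f -> lX Y M (iter k.+1 (XF M i) f) tt = 0) ->
    forall f, inPsi M f -> lX Y M (iter k (XF M i) f) tt = 0.
  move=> hk hs f hf; have hF k' : inPsi M (iter k' (XF M i) f) by apply: (lo_pow_psi (LFP hi)).
  have := hs _ (XE_psi hN hL q0 q2 HS hi hf); rewrite EF_pow // (loD HY) (loD HY).
  rewrite (loZ HY M (qn k.+1 / (q - q^-1) * q ^- k)) (loZ HY M (- (qn k.+1 / (q - q^-1) * q ^+ k))) hK.
  rewrite (@diag_inv (lX Y M) M i b%:Z); last by move=> g; rewrite hK exprnP.
  rewrite /fadd /fscl /fmul hE; last exact: (hF k.+1).
  rewrite (XE_tl hN hL q0 q2 HS hi hi); last exact: (lo_psi HY (hF k.+1)).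
  rewrite add0r (KH_tl hN hL q0 q2 HS) // invr1 !mul1r.
  set y := lX Y M _ tt; rewrite -exprnN.
  have -> : qn k.+1 / (q - q^-1) * q ^- k * (q ^+ b * y) + - (qn k.+1 / (q - q^-1) * q ^+ k) * (q ^- b * y) =
    qn k.+1 / (q - q^-1) * (q ^- k * q ^+ b - q ^+ k * q ^- b) * y by ring.
  have c0 : qn k.+1 / (q - q^-1) != 0 by rewrite mulf_neq0 ?qn_neq0 ?invr_eq0 ?q_qV.
  move: (_ / _) c0 => c c0 /eqP; rewrite mulf_eq0 mulf_eq0 (negbTE c0) /= => /orP [|/eqP //].
  rewrite subr_eq0 => /eqP /(congr1 (fun z => z * (q ^+ k * q ^+ b))).
  have -> : q ^- k * q ^+ b * (q ^+ k * q ^+ b) = q ^+ (b + b).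
    by rewrite exprD; field; rewrite expf_neq0.
  have -> : q ^+ k * q ^- b * (q ^+ k * q ^+ b) = q ^+ (k + k).
    by rewrite exprD; field; rewrite expf_neq0.
  have -> : (k + k = b + b + (k - b + (k - b)))%N by lia.
  rewrite [RHS]exprD -[LHS]mulr1 => /(mulfI (expf_neq0 _ q0)) /esym/eqP.
  by rewrite (negbTE (hq _)) //; lia.
move=> k f hk hf; have [e he] : exists e, (k0 <= k + e)%N by exists k0; lia.
elim: e k he hk f hf => [|e IHe] k he hk; first by move=> f; apply: big; lia.
by apply: step => //; apply: IHe; lia.
Qed.

Lemma cart_off i j : (i < n)%N -> (j < n)%N -> i != j ->
  cart i j = - (ind (i == nx n j) + ind (j == nx n i)).
Proof. by move=> hi hj hij; rewrite /cart (negbTE hij) /ind; do 2 case: eqP; lia. Qed.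

Lemma cart_cases i j : (i < n)%N -> (j < n)%N -> i != j ->
  [|| cart i j == 0, cart i j == -1 | cart i j == -2].
Proof.
by move=> hi hj hij; rewrite cart_off // /ind; case: (i == nx n j); case: (j == nx n i).
Qed.

Lemma serreE i j M f w : (i < n)%N -> (j < n)%N -> i != j -> inPsi M f ->
  serreG q (LE i) (LE j) (cart i j) M f w = 0.
Proof.
move=> hi hj hij; have ca := cart_off hi hj hij.
have G k k' x : (k < n)%N -> gE S k x -> gE S k' (stp S x) = (k == nx n k').
  by move=> hk /eqP hx; rewrite /gE (s_clE HS hk hx).
apply: (tail_ind hN hL q0 q2 HS hi (R := serreG q (LE i) (LE j) (cart i j))).
- by move=> M' f'; apply: serreG_psi; apply: LEP.
- move=> M' x v; apply: (serreG_step q0 (LEP hi) (LEP hj) (t := stp S) (z := ss S)) => //=.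
  + by move=> y; apply: gE_stp.
  + by move=> y; rewrite /gE => /eqP ->; rewrite nx_eqb // (negbTE hij).
  + by move=> y /eqP hy; rewrite (lE_stp hi hi hy) cart_diag.
  + by move=> y /eqP hy; rewrite (lE_stp hj hi hy) cartC.
  + by move=> y /eqP hy; rewrite (lE_stp hi hj hy).
  + by move=> M1 g; rewrite kE_shift // cart_diag.
  + by move=> M1 g; rewrite kE_shift // cartC.
  + by move=> M1 g; rewrite kE_shift.
  + move=> c0 y; move: c0; rewrite ca /ind => c0; split=> hy; rewrite (G _ _ _ _ hy) //.
      by move: c0; case: (i == nx n j) => //; case: (j == nx n i).
    by move: c0; case: (i == nx n j) => //; case: (j == nx n i).
  + move=> c1 y hy hy'; rewrite (G _ _ _ _ hy') //; move: c1; rewrite ca /ind.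
    by move: hy'; rewrite (G _ _ _ _ hy) // => ->; case: (j == nx n i).
  + exact: cart_cases.
move=> m f' hf'; have pE k g : (k < n)%N -> inPsi (ch N L S i m) g -> inPsi (ch N L S i m) (XE (ch N L S i m) k g).
  by move=> hk; apply: (XE_psi hN hL q0 q2 HS hk).
have z k g : (k < n)%N -> inPsi (ch N L S i m) g -> XE (ch N L S i m) k g (tl N L S i m) = 0.
  by move=> hk; apply: (XE_tl hN hL q0 q2 HS hi hk).
rewrite /serreG /serre1 /serre2 /serre3 /=.
by rewrite !z ?(mulr0, subr0, addr0, if_same) //; repeat first [assumption | apply pE].
Qed.

Lemma serreF i j M f w : (i < n)%N -> (j < n)%N -> i != j -> inPsi M f ->
  serreG q (LF i) (LF j) (cart i j) M f w = 0.
Proof.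
move=> hi hj hij; have ca := cart_off hi hj hij.
have G k k' x : (k < n)%N -> gF S k x -> gF S k' (stp' S x) = (nx n k == k').
  by move=> hk /eqP hx; rewrite /gF (clF hN hL q0 q2 HS hk hx).
apply: (tail_ind hN hL q0 q2 HS hi (R := serreG q (LF i) (LF j) (cart i j))).
- by move=> M' f'; apply: serreG_psi; apply: LFP.
- move=> M' x v; apply: (serreG_step q0 (LFP hi) (LFP hj) (t := stp' S) (z := ~~ ss S)) => //=.
  + by move=> y; apply: gF_stp.
  + by move=> y; rewrite /gF => /eqP ->; rewrite (negbTE hij).
  + by move=> y /eqP hy; rewrite (lF_stp hi hi hy) cart_diag // if_neg.
  + by move=> y /eqP hy; rewrite (lF_stp hj hi hy) cartC if_neg.
  + by move=> y /eqP hy; rewrite (lF_stp hi hj hy) if_neg.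
  + by move=> M1 g; rewrite kF_shift // cart_diag // if_neg.
  + by move=> M1 g; rewrite kF_shift // cartC if_neg.
  + by move=> M1 g; rewrite kF_shift // if_neg.
  + move=> c0 y; move: c0; rewrite ca /ind => c0; split=> hy; rewrite (G _ _ _ _ hy) // eq_sym.
      by move: c0; case: (i == nx n j) => //; case: (j == nx n i).
    by move: c0; case: (i == nx n j) => //; case: (j == nx n i).
  + move=> c1 y hy hy'; rewrite (G _ _ _ _ hy') // eq_sym; move: c1; rewrite ca /ind.
    by move: hy'; rewrite (G _ _ _ _ hy) // eq_sym => ->; case: (i == nx n j).
  + exact: cart_cases.
move=> m f' hf'; have pF k g : (k < n)%N -> inPsi (ch N L S i m) g -> inPsi (ch N L S i m) (XF (ch N L S i m) k g).
  by move=> hk; apply: (XF_psi hN hL q0 q2 HS hk).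
have z g : inPsi (ch N L S i m) g -> XF (ch N L S i m) i g (tl N L S i m) = 0.
  exact: (XF_tl hN hL q0 q2 HS hi).
(* K_i is trivial on the tail, so F_j of the tail has weight - a_ij for index i. *)
pose b := absz (cart i j).
have hb : - cart i j = b%:Z.
  by rewrite /b ca; rewrite /ind; case: (i == nx n j); case: (j == nx n i).
have hw := hw_vanish (b := b) (LFP hj) hi _ _ _ (m := m).
have {}hw k : (b < k)%N -> XF (ch N L S i m) j (iter k (XF (ch N L S i m) i) f') (tl N L S i m) = 0.
  move=> hk; apply: hw => //.
  - move=> M1 g w1 hg; have := EF_rel w1 hi hj hg; rewrite /REF /cEF (negbTE hij) mulr0n !mul0r subr0.
    by move=> /eqP; rewrite subr_eq0 => /eqP.
  - by move=> M1 g /=; rewrite XF_fKH // hb exprnP.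
  - move=> M1 w1; have [ws Hws] := cop_supp (gF S j) (stp' S) (lF q S j) (rF q S j) (ext N L M1 (mch M1 w1) w1 ++ vbar N L (mch M1 w1)).
    by exists ws => g hg /=; rewrite /XF /copF Hws ?mulr0.
(* The terms where F_i meets the tail first vanish; the remaining one is F_i^(1 - a_ij) applied to
   F_j of the tail, with exponent b + 1. *)
rewrite /serreG; move: (cart_cases hi hj hij) hb; case/or3P => /eqP -> hb /=.
- rewrite /serre1 /= (hw 1%N) ?z ?subrr //; first exact: pF.
  by lia.
- rewrite /serre2 /= (hw 2%N) ?addr0; last by lia.
  by rewrite !z ?mulr0 ?subr0 //; repeat first [assumption | apply pF].
- rewrite /serre3 /= (hw 3%N) ?subr0; last by lia.
  by rewrite !z ?mulr0 ?subr0 ?addr0 //; repeat first [assumption | apply pF].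
Qed.

End OneSide.

(** * Commutation of the two families on functionals *)

Definition crossP (S S' : side) := [/\ forall x, scl S (stp S' x) = scl S x,
  forall x, scl S' (stp S x) = scl S' x & forall x, stp S (stp S' x) = stp S' (stp S x)].

Lemma crossP_sym S S' : crossP S S' -> crossP S' S.
Proof. by move=> [h1 h2 h3]; split. Qed.

Section Cross.
Variables (S S' : side) (HS : sideP q N L S) (HS' : sideP q N L S') (HC : crossP S S').
Local Notation XE := (XE q N L).
Local Notation XF := (XF q N L).
Local Notation KH := (KH q N L).

Lemma cr_cl x : scl S (stp S' x) = scl S x. Proof. by case: HC. Qed.
Lemma cr_cl' x : scl S (stp' S' x) = scl S x.
Proof. by rewrite -{2}(s_K' HS' x) cr_cl. Qed.
Lemma cr_kk i x : kk q S i (stp S' x) = kk q S i x.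
Proof. by rewrite !kkE cr_cl. Qed.
Lemma cr_kk' i x : kk q S i (stp' S' x) = kk q S i x.
Proof. by rewrite !kkE cr_cl'. Qed.
Lemma cr_t x : stp S (stp S' x) = stp S' (stp S x). Proof. by case: HC. Qed.
Lemma cr_t' x : stp S (stp' S' x) = stp' S' (stp S x).
Proof. by apply: (can_inj (s_K HS')); rewrite -cr_t !(s_K' HS'). Qed.
Lemma cr_t'' x : stp' S (stp' S' x) = stp' S' (stp' S x).
Proof. by apply: (can_inj (s_K HS)); rewrite cr_t' !(s_K' HS). Qed.

Lemma XE_crossKH M i a f : (i < sn S)%N ->
  XE S' M a (fmul (KH S M i) f) = fmul (KH S M i) (XE S' M a f).
Proof.
move=> hi; apply: functional_extensionality => w; have hm := ok_mch hN hL q0 q2 M w; have hsz := ext_size hm.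
rewrite /fmul /XE [RHS]mulrCA; congr (_ * _); apply: cop_scale => u x v e _.
have hz : (size (u ++ stp S' x :: v))%:Z = M + (N * L * mch M w)%:Z by rewrite (size_upd u v _ x) -e.
rewrite (@KH_any _ _ _ _ hN hL q0 q2 _ HS _ _ (u ++ _) (mch M w)) // ?ext_id //; last by rewrite /ok hz.
rewrite /KH e (@pr_upd _ _ u v x _ 1) ?mul1r //.
exact: cr_kk.
Qed.

Lemma XF_crossKH M i a f : (i < sn S)%N ->
  XF S' M a (fmul (KH S M i) f) = fmul (KH S M i) (XF S' M a f).
Proof.
move=> hi; apply: functional_extensionality => w; have hm := ok_mch hN hL q0 q2 M w.
have hm1 : ok N L M (mch M w).+1 w by have := ok_mono 1 hm; rewrite addn1.
have hsz := ext_size hm1; rewrite ext_S // in hsz.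
rewrite /fmul /XF [RHS]mulrCA; congr (_ * _); apply: cop_scale => u x v e _.
have hz : (size (u ++ stp' S' x :: v))%:Z = M + (N * L * (mch M w).+1)%:Z by rewrite (size_upd u v _ x) -e.
rewrite (KH_any hN hL q0 q2 HS hi hm1) ext_S // e.
rewrite (@KH_any _ _ _ _ hN hL q0 q2 _ HS _ _ (u ++ _) (mch M w).+1) // ?ext_id //; last by rewrite /ok hz.
rewrite (@pr_upd _ _ u v x _ 1) ?mul1r //.
exact: cr_kk'.
Qed.

Lemma crossKHV (X : Phi -> Phi) M i :
  (forall f, X (fmul (KH S M i) f) = fmul (KH S M i) (X f)) ->
  forall f, X (fmul (fun v => (KH S M i v)^-1) f) = fmul (fun v => (KH S M i v)^-1) (X f).
Proof.
move=> H f; rewrite (@diag_inv S X M i 0) ?oppr0 ?expr0z -?fscl1 // => g.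
rewrite H; by rewrite ?expr0z -?fscl1.
Qed.

Lemma cross_kE (X : Phi -> Phi) M i :
  (forall f, X (fmul (KH S M i) f) = fmul (KH S M i) (X f)) ->
  forall f, X (fmul (kE q N L S M i) f) = fmul (kE q N L S M i) (X f).
Proof.
move=> H f; rewrite /kE; case: (ss S) => //.
have e g : fmul (fun _ => 1) g = g by apply: functional_extensionality => w; rewrite /fmul mul1r.
by rewrite !e.
Qed.
Lemma cross_kF (X : Phi -> Phi) M i :
  (forall f, X (fmul (KH S M i) f) = fmul (KH S M i) (X f)) ->
  forall f, X (fmul (kF q N L S M i) f) = fmul (kF q N L S M i) (X f).
Proof.
move=> H f; rewrite /kF; case: (ss S); first exact: crossKHV.
have e g : fmul (fun _ => 1) g = g by apply: functional_extensionality => w; rewrite /fmul mul1r.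
by rewrite !e.
Qed.

End Cross.

Section CrossComm.
Variables (S S' : side) (HS : sideP q N L S) (HS' : sideP q N L S') (HC : crossP S S').
Let HC' := crossP_sym HC.

Lemma supp_E a M w : exists ws : seq (seq int), forall f,
  (forall u, u \in ws -> f u = 0) -> XE q N L S' M a f w = 0.
Proof.
have [ws H] := cop_supp (gE S' a) (stp S') (lE q S' a) (rE q S' a) (ext N L M (mch M w) w).
by exists ws => f hf; rewrite /XE /copE H ?mulr0.
Qed.
Lemma supp_F a M w : exists ws : seq (seq int), forall f,
  (forall u, u \in ws -> f u = 0) -> XF q N L S' M a f w = 0.
Proof.
have [ws H] := cop_supp (gF S' a) (stp' S') (lF q S' a) (rF q S' a) (ext N L M (mch M w) w ++ vbar N L (mch M w)).
by exists ws => f hf; rewrite /XF /copF H ?mulr0.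
Qed.

Lemma cross_EE i a M f w : (i < sn S)%N -> (a < sn S')%N -> inPsi M f ->
  lo_comm (LE S i) (LE S' a) M f w = 0.
Proof.
move=> hi ha; have h1 := s_n HS; have h1' := s_n HS'.
(* The tail of index 1 is the bare vacuum, the same word in the same charge for both families, and
   it is killed by the E of both. *)
apply: (tail_ind hN hL q0 q2 HS h1 (R := lo_comm (LE S i) (LE S' a))).
- by move=> M' f'; apply: lo_comm_psi; apply: LEP.
- move=> M' x v; apply: (comm_step (LEP HS hi) (LEP HS' ha)) => /=.
  + exact: cr_t.
  + by move=> y _; rewrite /gE (cr_cl HC).
  + by move=> y _; rewrite /gE (cr_cl HC').
  + by move=> y _; rewrite /lE (cr_kk HC).
  + by move=> y _; rewrite /lE (cr_kk HC').
  + by move=> M1; apply: cross_kE => g; apply: XE_crossKH.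
  + by move=> M1; apply: cross_kE => g; apply: XE_crossKH.
move=> m f' hf'; rewrite /lo_comm /=.
rewrite (XE_tl hN hL q0 q2 HS h1 hi); last exact: (XE_psi hN hL q0 q2 HS' ha).
have := XE_tl hN hL q0 q2 HS' h1' ha (XE_psi hN hL q0 q2 HS hi hf').
by move=> ->; rewrite subrr.
Qed.

(** On the tail of index i, E_a of the tail is killed by E_i, which commutes with E_a, and has
    weight 0 for index i; a highest weight vector of weight 0 is killed by F_i. *)
Lemma cross_FE i a M f w : (i < sn S)%N -> (a < sn S')%N -> inPsi M f ->
  lo_comm (LF S i) (LE S' a) M f w = 0.
Proof.
move=> hi ha.
apply: (tail_ind hN hL q0 q2 HS hi (R := lo_comm (LF S i) (LE S' a))).
- by move=> M' f'; apply: lo_comm_psi; [apply: LFP|apply: LEP].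
- move=> M' x v; apply: (comm_step (LFP HS hi) (LEP HS' ha)) => /=.
  + by move=> y; rewrite (cr_t' HS HC').
  + by move=> y _; rewrite /gF (cr_cl HC).
  + by move=> y _; rewrite /gE (cr_cl' HS HC').
  + by move=> y _; rewrite /lF (cr_kk HC).
  + by move=> y _; rewrite /lE (cr_kk' HS HC').
  + by move=> M1; apply: cross_kE => g; apply: XF_crossKH.
  + by move=> M1; apply: cross_kF => g; apply: XE_crossKH.
move=> m f' hf'; rewrite /lo_comm /=.
rewrite (XF_tl hN hL q0 q2 HS hi); last exact: (XE_psi hN hL q0 q2 HS' ha).
have := @hw_vanish S HS i (LE S' a) 0 (LEP HS' ha) hi _ _ _ m 1 f' isT hf'.
rewrite /= => ->; first by rewrite subrr.
- move=> M1 g w1 hg; apply/esym/eqP; rewrite -subr_eq0; apply/eqP.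
  exact: cross_EE.
- by move=> M1 g /=; rewrite expr0 -fscl1; apply: XE_crossKH.
- exact: supp_E.
Qed.

End CrossComm.

(** The same argument with F_a for E_a; its commutation with E_i is [cross_FE] with the two families
    exchanged. *)
Lemma cross_FF (S S' : side) i a M f w : sideP q N L S -> sideP q N L S' -> crossP S S' ->
  (i < sn S)%N -> (a < sn S')%N -> inPsi M f -> lo_comm (LF S i) (LF S' a) M f w = 0.
Proof.
move=> HS HS' HC hi ha; have HC' := crossP_sym HC.
apply: (tail_ind hN hL q0 q2 HS hi (R := lo_comm (LF S i) (LF S' a))).
- by move=> M' f'; apply: lo_comm_psi; apply: LFP.
- move=> M' x v; apply: (comm_step (LFP HS hi) (LFP HS' ha)) => /=.
  + exact: (cr_t'' HS HS' HC).
  + by move=> y _; rewrite /gF (cr_cl' HS' HC).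
  + by move=> y _; rewrite /gF (cr_cl' HS HC').
  + by move=> y _; rewrite /lF (cr_kk' HS' HC).
  + by move=> y _; rewrite /lF (cr_kk' HS HC').
  + by move=> M1; apply: cross_kF => g; apply: XF_crossKH.
  + by move=> M1; apply: cross_kF => g; apply: XF_crossKH.
move=> m f' hf'; rewrite /lo_comm /=.
rewrite (XF_tl hN hL q0 q2 HS hi); last exact: (XF_psi hN hL q0 q2 HS' ha).
have := @hw_vanish S HS i (LF S' a) 0 (LFP HS' ha) hi _ _ _ m 1 f' isT hf'.
rewrite /= => ->; first by rewrite subrr.
- move=> M1 g w1 hg; apply/eqP; rewrite -subr_eq0; apply/eqP.
  exact: (cross_FE HS' HS HC' w1 ha hi hg).
- by move=> M1 g /=; rewrite expr0 -fscl1; apply: XF_crossKH.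
- exact: supp_F.
Qed.

Lemma crossNL : crossP (sideN N L) (sideL N L).
Proof.
split=> x /=; first by rewrite /clN ecS.
  by rewrite /clL dc_rhoN.
rewrite /rhoN ecS pcS //; case: eqP => _; rewrite /mk; ring.
Qed.

End Relations.

(** * The degree operator *)

Section Degree.
Variables (K : fieldType) (q : K) (N L : nat).
Hypotheses (hN : (1 < N)%N) (hL : (1 < L)%N) (q0 : q != 0) (q2 : 1 + q ^+ 2 != 0).
Local Notation inPsi := (inPsi q N L).
Local Notation ok := (ok N L).
Local Notation ext := (ext N L).
Local Notation bk := (bk N L).
Local Notation Phi := (seq int -> K).
Implicit Types (M : int) (m : nat) (w : seq int).

Definition bsum w : int := \sum_(x <- w) bk x.
(** - NL C(m, 2) is the degree of |-NLm>, an integral form of [Dvac]. From m to m + 1 it drops by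
    NLm, the degree of the block added to the word. *)
Definition DH M w : int := bsum (ext M (mch M w) w) - (N * L * 'C(mch M w, 2))%:Z.

Lemma bsum_cat u v : bsum (u ++ v) = bsum u + bsum v.
Proof. by rewrite /bsum big_cat. Qed.

Lemma bsum_cons x v : bsum (x :: v) = bk x + bsum v.
Proof. by rewrite /bsum big_cons. Qed.

Lemma bsum_vbar m : bsum (vbar N L m) = (N * L * m)%:Z.
Proof.
have H (m' : int) s : inblk N L m' s -> bsum s = (size s)%:Z * m'.
  elim: s => [|x s IH] /=; first by rewrite /bsum big_nil mul0r.
  by move=> /andP [/eqP hx hs]; rewrite bsum_cons hx (IH hs); lia.
by rewrite (H m%:Z) ?(size_vbar N L) //; apply/allP => x /(vbar_blk hN hL) ->.
Qed.

Lemma DH_any M w m : ok M m w -> DH M w = bsum (ext M m w) - (N * L * 'C(m, 2))%:Z.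
Proof.
pose F m := bsum (ext M m w) - (N * L * 'C(m, 2))%:Z.
have H m' : ok M m' w -> F m'.+1 = F m'.
  move=> h; rewrite /F ext_S // bsum_cat bsum_vbar binS bin1 mulnDr; lia.
move=> hm; rewrite -/(F m); change (F (mch M w) = F m).
exact: (stable_any H (ok_mch hN hL q0 q2 M w) hm).
Qed.

Lemma DH_T M (s : seq int) : DH M (s ++ [:: M - (size s)%:Z]) = DH M s.
Proof.
have hm := ok_mch hN hL q0 q2 M (s ++ [:: M - (size s)%:Z]); have [e h2] := ext_rcons hm.
by rewrite (DH_any hm) e (DH_any h2).
Qed.

Definition Dmul M f : Phi := fun v => (DH M v)%:~R * f v.

(** T^c preserves the total degree in z: a term of the oriented sum moves z^j from the second letter
    to the first. *)
Lemma RR_bk (B : int -> int -> K) k1 k2 :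
  RR q N L (fun a b => (bk a + bk b)%:~R * B a b) k1 k2 = (bk k1 + bk k2)%:~R * RR q N L B k1 k2.
Proof.
have h1 := ec_lt hN k1; have h2 := ec_lt hN k2.
have E p e : (e < N)%N -> bk (mk N p e) = ((p - 1) %/ L%:Z)%Z by move=> he; rewrite /bk pc_mk.
have Ep k : bk k = ((pc N k - 1) %/ L%:Z)%Z by [].
rewrite /RR !E // -?Ep.
set c := (bk k1 + bk k2)%:~R.
have -> : heck q L (fun p p' => (bk (mk N p (ec N k1)) + bk (mk N p' (ec N k2)))%:~R *
    B (mk N p (ec N k1)) (mk N p' (ec N k2))) (pc N k1) (pc N k2) =
  c * heck q L (fun p p' => B (mk N p (ec N k1)) (mk N p' (ec N k2))) (pc N k1) (pc N k2).
  rewrite /heck !E // -!Ep mulrDr [bk k2 + _]addrC -/c; congr (_ + _); first by ring.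
  rewrite mulrCA; congr (_ * _); rewrite -[RHS]addr0 -[0](mul0r (SS L (fun _ _ => 0) (pc N k1) (pc N k2))) -SS_lin.
  rewrite /SS; congr osum; apply: functional_extensionality => j.
  rewrite !E // mul0r addr0; congr (_%:~R * _).
  rewrite !Ep.
  have -> : pc N k1 + L%:Z * j - 1 = j * L%:Z + (pc N k1 - 1) by ring.
  have -> : pc N k2 - L%:Z * j - 1 = (- j) * L%:Z + (pc N k2 - 1) by ring.
  by rewrite !divzMDl; lia.
by ring.
Qed.

Lemma DH_psi M f : inPsi M f -> inPsi M (Dmul M f).
Proof.
move=> [hR hT]; split; last by move=> s; rewrite /Dmul DH_T hT.
move=> pre post k1 k2; have [tl Htl] := ext_ctx N L M pre post.
pose m := mch M (pre ++ k1 :: k2 :: post).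
have Hm a b : mch M (pre ++ a :: b :: post) = m by apply: mch_size; rewrite !size_cat.
pose c : K := (bsum pre + bsum (post ++ tl) - (N * L * 'C(m, 2))%:Z)%:~R.
have := RR_lin q N L 1 c (fun a b => (bk a + bk b)%:~R * f (pre ++ a :: b :: post))
  (fun a b => f (pre ++ a :: b :: post)) k1 k2.
rewrite RR_bk hR !mulr0 addr0 => E; rewrite -[RHS]E; congr RR.
do 2 apply: functional_extensionality => ?.
rewrite mul1r -mulrDl /Dmul /DH (Htl _ _ _ erefl) Hm bsum_cat !bsum_cons /c -rmorphD /=.
by congr (_%:~R * _); lia.
Qed.

Section OneSide.
Variables (S : side) (HS : sideP q N L S).
Local Notation n := (sn S).

Lemma bsum_upd u v x y (d : int) : bk y = bk x + d -> bsum (u ++ y :: v) = bsum (u ++ x :: v) + d.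
Proof. by move=> e; rewrite !bsum_cat !bsum_cons e; lia. Qed.

Lemma XE_D M i f w : (i < n)%N ->
  XE q N L S M i (Dmul M f) w = (DH M w + ind (i == 0)%N)%:~R * XE q N L S M i f w.
Proof.
move=> hi; have hm := ok_mch hN hL q0 q2 M w; have hsz := ext_size hm.
rewrite /XE [RHS]mulrCA; congr (_ * _); apply: cop_scale => u x v e /eqP gx.
have hz : (size (u ++ stp S x :: v))%:Z = M + (N * L * mch M w)%:Z by rewrite (size_upd u v _ x) -e.
rewrite /Dmul (@DH_any _ (u ++ _) (mch M w)) ?ext_id //; last by rewrite /ok hz.
rewrite /DH e (bsum_upd u v (x := x) (d := ind (i == 0)%N)); first by congr (_%:~R * _); lia.
have h1 := s_n HS; case: (eqVneq i 0%N) => hi0.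
  by rewrite (s_bk1 HS) // gx hi0 (nx0 hN hL q0 q2 HS).
rewrite (s_bk HS) ?addr0 // gx (nxE hN hL q0 q2 hi); case: (eqVneq i n.-1) => ?; lia.
Qed.

Lemma XF_D M i f w : (i < n)%N ->
  XF q N L S M i (Dmul M f) w = (DH M w - ind (i == 0)%N)%:~R * XF q N L S M i f w.
Proof.
move=> hi; have hm := ok_mch hN hL q0 q2 M w.
have hm1 : ok M (mch M w).+1 w by have := ok_mono 1 hm; rewrite addn1.
have hsz := ext_size hm1; rewrite ext_S // in hsz.
rewrite /XF [RHS]mulrCA; congr (_ * _); apply: cop_scale => u x v e /eqP gx.
have hz : (size (u ++ stp' S x :: v))%:Z = M + (N * L * (mch M w).+1)%:Z by rewrite (size_upd u v _ x) -e.
rewrite /Dmul (DH_any hm1) ext_S // e (@DH_any _ (u ++ _) (mch M w).+1) ?ext_id //; last by rewrite /ok hz.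
rewrite (bsum_upd u v (x := x) (d := - ind (i == 0)%N)); first by congr (_%:~R * _); lia.
case: (eqVneq i 0%N) => hi0.
  by rewrite (bkF0 hN hL q0 q2 HS) // gx.
by rewrite (bkF hN hL q0 q2 HS) ?oppr0 ?addr0 // gx.
Qed.

End OneSide.
End Degree.

(** * The explicit form of the relations *)

Section Swap.
Variable R : idomainType.
Definition FR : fieldType := {fraction R}.
Definition tofR (p : R) : FR := FracField.tofrac p.

Lemma frac_repr (x : FR) : tofR (frac (repr x)).1 = x * tofR (frac (repr x)).2.
Proof.
have hd : (frac (repr x)).2 != 0 := denom_ratioP _.
rewrite -[X in X * _](reprK x) /tofR !piE /FracField.mulf.
apply/eqP; rewrite eqmodE /= /FracField.equivf /=.
by rewrite !numden_Ratio ?oner_eq0 ?mulr1 ?mul1r ?oner_eq0.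
Qed.

(** [swF] is computed on the chosen representative of a fraction; cross multiplication shows that
    any other gives the same result. *)
Lemma frac_morph_div (s : R -> R) : monoid_morphism s -> forall a b x, b != 0 -> x * tofR b = tofR a ->
  tofR (s (frac (repr x)).1) * tofR (s b) = tofR (s a) * tofR (s (frac (repr x)).2).
Proof.
move=> hm a b x b0 hx; have ex := frac_repr x.
move: (repr x) ex => r ex.
move: (frac r) ex => [c d] /= ex.
have : tofR (c * b) = tofR (a * d).
  by rewrite /tofR !tofracM -!/(tofR _) ex -hx mulrAC.
move=> /eqP; rewrite tofrac_eq => /eqP h.
have := congr1 (fun u => tofR (s u)) h; rewrite /= !hm.2 /tofR !tofracM.
by [].
Qed.
End Swap.

Section TwoSite.

Lemma tof_neq0 (a : {poly {poly Kf}}) : a != 0 -> tof a != 0.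
Proof. by rewrite /tof tofrac_eq0. Qed.
Lemma tofM a b : tof (a * b) = tof a * tof b. Proof. exact: tofracM. Qed.
Lemma tofD a b : tof (a + b) = tof a + tof b. Proof. exact: tofracD. Qed.
Lemma tofN a : tof (- a) = - tof a. Proof. exact: tofracN. Qed.
Lemma tof0 : tof 0 = 0. Proof. exact: tofrac0. Qed.
Lemma tof1 : tof 1 = 1. Proof. exact: tofrac1. Qed.

Lemma swap_neq0 (a : {poly {poly Kf}}) : a != 0 -> tof (swapXY a) != 0.
Proof. by move=> h; apply: tof_neq0; rewrite swapXY_eq0. Qed.

Lemma swF_div (a b : {poly {poly Kf}}) : b != 0 -> swF (tof a / tof b) = tof (swapXY a) / tof (swapXY b).
Proof.
move=> b0; rewrite /swF; have : tof a / tof b * tof b = tof a by rewrite divfK // tof_neq0.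
move: (tof a / tof b) => x hx; have hd : (frac (repr x)).2 != 0 := denom_ratioP _.
have H := frac_morph_div (swapXY_is_monoid_morphism Kf) b0 hx.
by apply/eqP; rewrite eqr_div ?swap_neq0 //; apply/eqP.
Qed.

Lemma Fr_div (x : Fr) : exists a b : {poly {poly Kf}}, b != 0 /\ x = tof a / tof b.
Proof.
have hd : (frac (repr x)).2 != 0 := denom_ratioP _.
exists (frac (repr x)).1, (frac (repr x)).2; split => //.
apply: (mulIf (tof_neq0 hd)); rewrite divfK ?tof_neq0 //.
exact: (esym (frac_repr x)).
Qed.

Lemma swF_tof a : swF (tof a) = tof (swapXY a).
Proof. by rewrite -[tof a]divr1 -tof1 swF_div ?oner_neq0 // rmorph1 tof1 divr1. Qed.

Lemma swFM x y : swF (x * y) = swF x * swF y.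
Proof.
have [a [b [b0 ->]]] := Fr_div x; have [c [d [d0 ->]]] := Fr_div y.
by rewrite mulf_div -!tofM !swF_div ?mulf_neq0 // !rmorphM /= !tofM mulf_div.
Qed.

Lemma swFD x y : swF (x + y) = swF x + swF y.
Proof.
have [a [b [b0 ->]]] := Fr_div x; have [c [d [d0 ->]]] := Fr_div y.
rewrite addf_div ?tof_neq0 // -!tofM -tofD !swF_div ?mulf_neq0 //.
by rewrite rmorphD !rmorphM /= tofD !tofM addf_div ?swap_neq0.
Qed.

Lemma swF0 : swF 0 = 0.
Proof. by have := swF_tof 0; rewrite rmorph0 tof0. Qed.
Lemma swF1 : swF 1 = 1.
Proof. by rewrite -tof1 swF_tof rmorph1. Qed.
Lemma swFV x : swF x^-1 = (swF x)^-1.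
Proof.
have [->|x0] := eqVneq x 0; first by rewrite invr0 swF0 invr0.
have E : swF x * swF x^-1 = 1 by rewrite -swFM divff // swF1.
have h : swF x != 0 by apply/eqP => h; move: E; rewrite h mul0r => /eqP; rewrite eq_sym oner_eq0.
by apply: (mulfI h); rewrite E divff.
Qed.
Lemma swF_z1 : swF z1 = z2. Proof. by rewrite /z1 swF_tof swapXY_X. Qed.
Lemma swF_z2 : swF z2 = z1. Proof. by rewrite /z2 swF_tof swapXY_Y. Qed.
Lemma swF_cst c : swF (cst c) = cst c.
Proof. by rewrite /cst swF_tof swapXY_polyC map_polyC. Qed.
Lemma swFX x (m : int) : swF (x ^ m) = swF x ^ m.
Proof.
have E k : swF (x ^+ k) = swF x ^+ k by elim: k => [|k IH]; rewrite ?expr0 ?swF1 // !exprS swFM IH.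
by case: m => k; rewrite ?NegzE -?exprnN -?exprnP ?swFV E.
Qed.
Lemma swFN x : swF (- x) = - swF x.
Proof. by apply/eqP; rewrite -subr_eq0 opprK -swFD addNr swF0. Qed.

Lemma z1_neq0 : z1 != 0. Proof. by apply: tof_neq0; rewrite polyX_eq0. Qed.
Lemma z2_neq0 : z2 != 0. Proof. by apply: tof_neq0; rewrite polyC_eq0 polyX_eq0. Qed.
Lemma lin_neq0 (c : Kf) : z1 - cst c * z2 != 0.
Proof.
rewrite /z1 /z2 /cst -tofM -tofN -tofD; apply: tof_neq0.
by rewrite -rmorphM /= polyXsubC_eq0.
Qed.

End TwoSite.

(** Here x, y, c stand for z_1, z_2, q. The swapped denominator q^2 z_2 - z_1 of R cancels the
    prefactor z_1 - q^2 z_2, and only z_1 - z_2 remains, that is, a divided difference. *)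
Lemma Tc_diag (K : fieldType) (x y c f p : K) : x - y != 0 -> c ^+ 2 * y - x != 0 ->
  (x - c ^+ 2 * y) / (x - y) * (p - (c ^+ 2 * y - x) * f / (c ^+ 2 * y - x)) - p =
  - 1 * f + (c ^+ 2 - 1) * (y * (f - p) / (x - y) + 0).
Proof. by move=> h1 h2; field; rewrite h1 h2. Qed.

Lemma Tc_offdiag (K : fieldType) (x y c f g p : K) (b : bool) : x - y != 0 -> c ^+ 2 * y - x != 0 ->
  (x - c ^+ 2 * y) / (x - y) *
    (p - (c * (y - x) * g + (if b then x else y) * (c ^+ 2 - 1) * f) / (c ^+ 2 * y - x)) - p =
  - c * g + (c ^+ 2 - 1) * (y * (f - p) / (x - y) + (if b then f else 0)).
Proof. by move=> h1 h2; case: b; field; rewrite h1 h2. Qed.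

(* A geometric sum: this is how the divided difference of T^c becomes an oriented sum. *)
Lemma osum_geom (K : fieldType) (x y : K) (m n c : int) : x != 0 -> y != 0 -> x - y != 0 ->
  osum (fun j => x ^ (m + j) * y ^ (n - j)) c = y * (x ^ (m + c) * y ^ (n - c) - x ^ m * y ^ n) / (x - y).
Proof.
move=> x0 y0 h; elim/int_rect1: c => [|c IH|c].
- by rewrite osum0 addr0 subr0 subrr mulr0 mul0r.
- rewrite osumS IH opprD !addrA !expfzDr // !expr1z exprN1; field; rewrite ?h ?y0 //.
- rewrite osumS => /(canRL (addrK _)) ->; rewrite opprD !addrA !expfzDr // !expr1z exprN1; field; rewrite ?h ?y0 //.
Qed.

Section Canonical.
Variables (N L : nat).
Hypotheses (hN : (1 < N)%N) (hL : (1 < L)%N).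
Local Notation mk := (mk N).
Local Notation ec := (ec N).
Local Notation pc := (pc N).
Local Notation dc := (dc N L).
Local Notation bk := (bk N L).

Definition olist (K : fieldType) (c : int) : seq (K * int) :=
  match c with
  | Posz n => [seq (1, j%:Z) | j <- iota 0 n]
  | Negz n => [seq (-1, - 1 - j%:Z) | j <- iota 0 n.+1]
  end.

(** A finite expansion of (T^c - T^s)(u_{k1} (x) u_{k2}): the head and the mapped list are T^c, the
    last two entries - T^s. *)
Definition rcan (K : fieldType) (q : K) (k1 k2 : int) : seq (K * (int * int)) :=
  (- ne q L (pc k1) (pc k2), (mk (pc k2) (ec k1), mk (pc k1) (ec k2))) ::
  [seq ((q ^+ 2 - 1) * p.1, (mk (pc k1 + L%:Z * p.2) (ec k1), mk (pc k2 - L%:Z * p.2) (ec k2)))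
    | p <- olist K (cnt L (pc k1) (pc k2))]
  ++ [:: (- (if ec k1 == ec k2 then q ^+ 2 else q), (mk (pc k1) (ec k2), mk (pc k2) (ec k1)));
         (- (if (ec k2 < ec k1)%N then q ^+ 2 - 1 else 0), (k1, k2))].

Lemma olist_sum (K K' : fieldType) (phi : {rmorphism K -> K'}) (g : int -> K') c :
  \sum_(p <- olist K c) phi p.1 * g p.2 = osum g c.
Proof.
case: c => n; rewrite /= ?big_cons.
  by rewrite big_map -(big_mkord xpredT (fun j => g j%:Z)) /index_iota subn0; apply: eq_bigr => j _ /=; rewrite rmorph1 mul1r.
rewrite (big_map _ _ (fun p => phi p.1 * g p.2)) /=; under eq_bigr do rewrite rmorphN rmorph1 mulN1r.
rewrite sumrN rmorphN1 mulN1r -opprD big_ord_recl; congr (- (_ + _)).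
rewrite -[iota 1 n]/(iota (1 + 0) n) iotaDl big_map -(big_mkord xpredT (fun j => g (-1 - (bump 0 j)%:Z))).
by rewrite /index_iota subn0.
Qed.

(** The morphism makes room for two uses: scalar functionals, with the identity, and the components
    of [emb2], with values in rational functions. *)
Lemma rcan_sum (K K' : fieldType) (phi : {rmorphism K -> K'}) (q : K) (B : int -> int -> K') k1 k2 :
  \sum_(p <- rcan q k1 k2) phi p.1 * B p.2.1 p.2.2 = RR (phi q) N L B k1 k2.
Proof.
rewrite /rcan big_cons big_cat /= big_map !big_cons big_nil /= addr0 /RR /heck /SS.
rewrite -(olist_sum phi) mulr_sumr -!addrA; congr (_ + (_ + _)).
- by rewrite rmorphN /ne; case: ifP; rewrite ?rmorph1.
- by apply: eq_bigr => p _; rewrite rmorphM rmorphB rmorphXn rmorph1 mulrA.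
by rewrite !rmorphN opprD !mulNr; congr (- (_ * _) - (_ * _)); case: ifP; rewrite ?rmorphB ?rmorphXn ?rmorph1 ?rmorph0.
Qed.

Section Ops.
Local Notation q := (cst (qq N)).
Implicit Types (P : 'I_L -> 'I_L -> Fr) (b : 'I_L).

Lemma big_pick (I : finType) (b : I) (F : I -> Fr) : \sum_(a : I) (if b == a then F a else 0) = F b.
Proof.
rewrite (bigD1 b) //= eqxx big1 ?addr0 // => a; rewrite eq_sym => /negbTE ->.
by [].
Qed.

Lemma big_pick2 b1 b2 (p : 'I_L -> 'I_L -> bool) (F : 'I_L -> 'I_L -> Fr) :
  \sum_(a : 'I_L) \sum_(b : 'I_L | p a b) (if (b1 == a) && (b2 == b) then F a b else 0) =
  if p b1 b2 then F b1 b2 else 0.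
Proof.
rewrite -[RHS](big_pick b1 (fun a => if p a b2 then F a b2 else 0)); apply: eq_bigr => a _.
rewrite big_mkcond /= -[X in if _ then X else _](big_pick b2 (fun b => if p a b then F a b else 0)).
case: (b1 == a) => /=; last by rewrite big1 // => b _; case: ifP.
by apply: eq_bigr => b _; case: (b2 == b); case: (p a b).
Qed.

Lemma Rop_eval P b1 b2 : Rop N L P b1 b2 =
  if b1 == b2 then (q ^+ 2 * z1 - z2) * P b1 b2
  else q * (z1 - z2) * P b1 b2 + (if (b1 < b2)%N then z1 else z2) * (q ^+ 2 - 1) * P b2 b1.
Proof.
rewrite /Rop !(big_pick2 b1 b2 _ (fun a b => _)).
have -> : \sum_(a : 'I_L) (if (b1 == a) && (b2 == a) then (q ^+ 2 * z1 - z2) * P a a else 0) =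
  if b1 == b2 then (q ^+ 2 * z1 - z2) * P b1 b2 else 0.
  rewrite (bigD1 b1) //= eqxx big1 => [|a]; last by rewrite eq_sym => /negbTE ->.
  by rewrite addr0 /= eq_sym; case: eqP => // ->.
case: (eqVneq b1 b2) => [->|hb]; first by rewrite ltnn !addr0.
move: (z1) (z2) (cst (qq N)) => x y c.
case: (ltngtP b1 b2) => h; rewrite /= ?add0r ?addr0 //.
by case/eqP: hb; apply: val_inj.
Qed.

Lemma z12_neq0 : z1 - z2 != 0.
Proof. by have := lin_neq0 1; rewrite /cst tof1 mul1r. Qed.

Lemma Tc_eval P b1 b2 : Tc N L P b1 b2 =
  - (if b1 == b2 then 1 else q) * swF (P b2 b1)
  + (q ^+ 2 - 1) * (z2 * (swF (P b1 b2) - P b1 b2) / (z1 - z2) + (if (b1 < b2)%N then swF (P b1 b2) else 0)).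
Proof.
have h0 := z12_neq0.
have hc : q ^+ 2 = cst (qq N ^+ 2) by move: (qq N) => c; rewrite !expr2 /cst !rmorphM tofM.
have h1 : z1 - q ^+ 2 * z2 != 0 by rewrite hc lin_neq0.
have h2 : q ^+ 2 * z2 - z1 != 0 by rewrite -oppr_eq0 opprB.
have sq : swF (q ^+ 2) = q ^+ 2 by rewrite hc swF_cst.
have sw : swF (q ^+ 2 * z1 - z2) = q ^+ 2 * z2 - z1 by rewrite swFD swFN swFM sq swF_z1 swF_z2.
have sd : swF (z1 - z2) = z2 - z1 by rewrite swFD swFN swF_z1 swF_z2.
have sh : swF (q ^+ 2 - 1) = q ^+ 2 - 1 by rewrite swFD swFN sq swF1.
have E : swF (Rop N L P b2 b1) = if b1 == b2 then (q ^+ 2 * z2 - z1) * swF (P b1 b2)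
  else q * (z2 - z1) * swF (P b2 b1) + (if (b2 < b1)%N then z2 else z1) * (q ^+ 2 - 1) * swF (P b1 b2).
  rewrite Rop_eval eq_sym; case: eqP => [->|_]; first by rewrite swFM sw.
  rewrite swFD !swFM sd sh swF_cst; congr (_ + _ * _ * _).
  by case: ifP => _; rewrite ?swF_z1 ?swF_z2.
rewrite /Tc swFM swFV E sw; case: (eqVneq b1 b2) => [->|hb].
  by rewrite ltnn; apply: Tc_diag.
have -> : (b2 < b1)%N = ~~ (b1 < b2)%N.
  by case: (ltngtP b1 b2) => // h; case/eqP: hb; apply: val_inj.
by rewrite if_neg; apply: Tc_offdiag.
Qed.

End Ops.
End Canonical.

Lemma tc0 (K : fieldType) (a h u v : K) (b : bool) :
  - a * 0 + h * (v * (0 - 0) / u + (if b then 0 else 0)) = 0.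
Proof. by rewrite if_same subr0 !mulr0 mul0r addr0 mulr0 addr0. Qed.

Section Explicit.
Variables (N L : nat).
Hypotheses (hN : (1 < N)%N) (hL : (1 < L)%N).
Local Notation mk := (mk N).
Local Notation ec := (ec N).
Local Notation pc := (pc N).
Local Notation dc := (dc N L).
Local Notation bk := (bk N L).

Definition bkp (p : int) : int := ((p - 1) %/ L%:Z)%Z.

Lemma bkpM p c : bkp (p + L%:Z * c) = bkp p + c.
Proof.
rewrite /bkp; have -> : p + L%:Z * c - 1 = c * L%:Z + (p - 1) by ring.
by rewrite divzMDl; lia.
Qed.

Lemma cnt_bkp p1 p2 : cnt L p1 p2 = bkp p2 - bkp p1 + ind (dcp L p1 < dcp L p2)%N.
Proof.
have e p : p = bkp p * L%:Z + (dcp L p)%:Z + 1 by rewrite /bkp /dcp; have := divz_eq (p - 1) L%:Z; lia.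
exact: (cnt_dcp hL (e p1) (e p2)).
Qed.

Section Field.
Variables (K : fieldType) (x y c : K).
Hypotheses (x0 : x != 0) (y0 : y != 0) (xy : x - y != 0).

(** The (b1, b2) component of z_1^m z_2^n e_a (x) e_b; [tcv] is this component after T^c, and [tsv]
    the matrix of T^s. *)
Definition mono (a b b1 b2 : nat) (m n : int) : K := if (a == b1) && (b == b2) then x ^ m * y ^ n else 0.
Definition tcv (a b b1 b2 : nat) (m n : int) : K :=
  - (if b1 == b2 then 1 else c) * mono a b b2 b1 n m
  + (c ^+ 2 - 1) * (y * (mono a b b1 b2 n m - mono a b b1 b2 m n) / (x - y)
     + (if (b1 < b2)%N then mono a b b1 b2 n m else 0)).
Definition tsv (h1 h2 e1 e2 : nat) : K :=
  if h1 == h2 then (if (e1 == h1) && (e2 == h2) then c ^+ 2 else 0)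
  else if (h1 < h2)%N then (if (e1 == h2) && (e2 == h1) then c else 0)
  else (if (e1 == h2) && (e2 == h1) then c else 0)
       + (if (e1 == h1) && (e2 == h2) then c ^+ 2 - 1 else 0).

(** The first n - m terms of the oriented sum form the divided difference; when the residue of p1 is
    the smaller one there is one further term, the swapped monomial. *)
Lemma heck_mono b1 b2 p1 p2 :
  heck c L (fun p p' => mono (dcp L p) (dcp L p') b1 b2 (bkp p) (bkp p')) p1 p2 =
  tcv (dcp L p1) (dcp L p2) b1 b2 (bkp p1) (bkp p2).
Proof.
rewrite /heck /tcv; congr (_ + _ * _).
  rewrite /mono /ne [X in if X then _ else 0]andbC.
  by case: andP => [[/eqP -> /eqP ->]|_]; rewrite ?mulr0 // eq_sym.
rewrite /SS; set a := dcp L p1; set b := dcp L p2; set m := bkp p1; set n := bkp p2.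
rewrite (@eq_osum _ _ (fun j => mono a b b1 b2 (m + j) (n - j))); last first.
  move=> j; rewrite -mulrN !bkpM !dcpM //.
rewrite /mono; case: andP => [[/eqP <- /eqP <-]|_]; last first.
  have -> : (if (b1 < b2)%N then 0 else 0) = 0 :> K by case: ifP.
  by rewrite subr0 mulr0 mul0r addr0; case: (cnt _ _ _) => k /=; rewrite big1 ?oppr0.
have e1 : m + (n - m) = n by ring.
have e2 : n - (n - m) = m by ring.
rewrite cnt_bkp -/a -/b -/m -/n /ind; case: ifP => _.
  by rewrite osumS osum_geom // e1 e2.
by rewrite addr0 osum_geom // e1 e2 addr0.
Qed.

Lemma RR_mono b1 b2 e1 e2 k1 k2 :
  RR c N L (fun a b => if (ec a == e1) && (ec b == e2) then mono (dc a) (dc b) b1 b2 (bk a) (bk b) else 0) k1 k2 =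
  (if (ec k1 == e1) && (ec k2 == e2) then tcv (dc k1) (dc k2) b1 b2 (bk k1) (bk k2) else 0)
  - tsv (ec k1) (ec k2) e1 e2 * mono (dc k1) (dc k2) b1 b2 (bk k1) (bk k2).
Proof.
have h1 := ec_lt hN k1; have h2 := ec_lt hN k2.
have Eb p e : (e < N)%N -> bk (mk p e) = bkp p by move=> he; rewrite /bk pc_mk.
have Ed p e : (e < N)%N -> dc (mk p e) = dcp L p by move=> he; rewrite dc_dcp pc_mk.
rewrite /RR; congr (_ - _).
  rewrite (@eq_heck _ c L _ (fun p p' => if (ec k1 == e1) && (ec k2 == e2) then mono (dcp L p) (dcp L p') b1 b2 (bkp p) (bkp p') else 0)).
    case: ifP => _; first by rewrite heck_mono !dc_dcp.
    by have := heck_lin c L 0 0 (fun _ _ => 0) (fun _ _ => 0) (pc k1) (pc k2); rewrite !mul0r !addr0.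
  by move=> p p'; rewrite !ec_mk // !Eb // !Ed.
rewrite !ec_mk // !Eb // !Ed // -/(bk k1) -/(bk k2) /tsv !dc_dcp.
move: (mono _ _ _ _ _ _) => z; rewrite ![_ == e1]eq_sym ![_ == e2]eq_sym.
have [e|hne] := eqVneq (ec k1) (ec k2).
  by rewrite e ltnn mul0r addr0; case: ifP => _; rewrite ?mulr0 ?mul0r.
case: (ltngtP (ec k1) (ec k2)) => hlt; last by rewrite hlt eqxx in hne.
  by rewrite mul0r addr0; case: ifP => _; rewrite ?mulr0 ?mul0r.
by case: ifP => _; case: ifP => _; ring.
Qed.

End Field.

Lemma swF_mono a b b1 b2 m n : swF (mono z1 z2 a b b1 b2 m n) = mono z1 z2 a b b1 b2 n m.
Proof. by rewrite /mono; case: ifP => _; rewrite ?swF0 // swFM !swFX swF_z1 swF_z2 mulrC. Qed.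

Lemma emb2_one k1 k2 (b1 b2 : 'I_L) (e1 e2 : 'I_N) : emb2 N L [:: (1, (k1, k2))] b1 b2 e1 e2 =
  if (ec k1 == e1) && (ec k2 == e2) then mono z1 z2 (dc k1) (dc k2) b1 b2 (bk k1) (bk k2) else 0.
Proof.
rewrite /emb2 big_seq1 /= !kdotE // !kbarE // !kundE // /mono.
have -> : cst 1 = 1 by exact: tof1.
rewrite mul1r !(inj_eq (addIr 1)) !eqz_nat.
by case: (dc k1 == b1); case: (dc k2 == b2); case: (ec k1 == e1); case: (ec k2 == e2).
Qed.

Definition cstm : {rmorphism Kf -> Fr} := (@FracField.tofrac {poly {poly Kf}}) \o (polyC \o polyC).

Lemma emb2_sum r (b1 b2 : 'I_L) (e1 e2 : 'I_N) : emb2 N L r b1 b2 e1 e2 =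
  \sum_(p <- r) cstm p.1 * (if (ec p.2.1 == e1) && (ec p.2.2 == e2) then
     mono z1 z2 (dc p.2.1) (dc p.2.2) b1 b2 (bk p.2.1) (bk p.2.2) else 0).
Proof.
apply: eq_bigr => p _; rewrite !kdotE // !kbarE // !kundE // /mono.
rewrite !(inj_eq (addIr 1)) !eqz_nat.
have -> : cst p.1 = cstm p.1 by [].
by case: (dc p.2.1 == b1); case: (dc p.2.2 == b2); case: (ec p.2.1 == e1); case: (ec p.2.2 == e2);
   rewrite /= ?mulr0 // mulrA.
Qed.

Lemma rmorph_tsv (K K' : fieldType) (phi : {rmorphism K -> K'}) (c : K) h1 h2 e1 e2 :
  phi (tsv c h1 h2 e1 e2) = tsv (phi c) h1 h2 e1 e2.
Proof.
rewrite /tsv; case: ifP => _; last case: ifP => _; rewrite ?rmorphD.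
- by case: ifP => _; rewrite ?rmorph0 ?rmorphXn.
- by case: ifP => _; rewrite ?rmorph0.
by congr (_ + _); case: ifP => _; rewrite ?rmorph0 ?rmorphB ?rmorphXn ?rmorph1.
Qed.

Lemma cst_tsv (h1 h2 e1 e2 : 'I_N) : cst (Tsimg N h1 h2 e1 e2) = tsv (cst (qq N)) h1 h2 e1 e2.
Proof.
exact: (rmorph_tsv cstm).
Qed.

(** Here the explicit expansion meets the rational definition of T^c. It puts into [in_rel] the
    relations that force [isR] on every functional vanishing there. *)
Lemma rcan_T2rel k1 k2 : T2rel N L k1 k2 (rcan N L (qq N) k1 k2).
Proof.
move=> b1 b2 e1 e2; rewrite emb2_sum (rcan_sum N L cstm (qq N) (fun a b =>
  if (ec a == e1) && (ec b == e2) then mono z1 z2 (dc a) (dc b) b1 b2 (bk a) (bk b) else 0)).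
have -> : cstm (qq N) = cst (qq N) by [].
rewrite (RR_mono (cst (qq N)) z1_neq0 z2_neq0 z12_neq0).
rewrite /TcTs Tc_eval !emb2_one.
congr (_ - _).
  case: ifP => _; first by rewrite !swF_mono /tcv.
  by rewrite swF0; apply/esym/tc0.
pose o1 := Ordinal (ec_lt hN k1); pose o2 := Ordinal (ec_lt hN k2).
rewrite (bigD1 o1) //= [X in _ + X]big1 => [|h1 hh]; last first.
  apply: big1 => h2 _; rewrite emb2_one.
  have -> : (ec k1 == h1) = false by apply/negP => /eqP e; case/eqP: hh; apply: val_inj.
  by rewrite mulr0.
rewrite (bigD1 o2) //= [X in _ + X + _]big1 => [|h2 hh]; last first.
  rewrite emb2_one; have -> : (ec k2 == h2) = false by apply/negP => /eqP e; case/eqP: hh; apply: val_inj.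
  by rewrite andbF mulr0.
by rewrite emb2_one /= !eqxx cst_tsv !addr0.
Qed.

End Explicit.

(** * Separation *)

Section Separation.
Implicit Types (u v w : Tens) (f : seq int -> Kf).

Definition pair f v : Kf := \sum_(p <- v) p.1 * f p.2.

Lemma pair_nil f : pair f [::] = 0. Proof. exact: big_nil. Qed.
Lemma pair_cons f p v : pair f (p :: v) = p.1 * f p.2 + pair f v. Proof. exact: big_cons. Qed.
Lemma pair_cat f v w : pair f (v ++ w) = pair f v + pair f w. Proof. exact: big_cat. Qed.
Lemma pair_scale f c v : pair f (scaleT c v) = c * pair f v.
Proof. by rewrite /pair big_map mulr_sumr; apply: eq_bigr => p _; rewrite mulrA. Qed.
Lemma pair_sub f v w : pair f (subT v w) = pair f v - pair f w.
Proof. by rewrite pair_cat pair_scale mulN1r. Qed.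
Lemma pair_linop f (F : seq int -> Tens) v : pair f (linop F v) = pair (fun s => pair f (F s)) v.
Proof.
elim: v => [|p v IH]; first by rewrite !pair_nil.
by rewrite /linop /= pair_cat -/(linop F v) IH pair_scale pair_cons.
Qed.
Lemma pair_flatten f (l : seq Tens) : pair f (flatten l) = \sum_(v <- l) pair f v.
Proof. by elim: l => [|v l IH]; rewrite ?big_nil ?pair_nil // big_cons /= pair_cat IH. Qed.
Lemma eq_pair f f' v : f =1 f' -> pair f v = pair f' v.
Proof. by move=> e; apply: eq_bigr => p _; rewrite e. Qed.
Lemma pair_map f (g : seq int -> seq int) v : pair f [seq (p.1, g p.2) | p <- v] = pair (f \o g) v.
Proof. by rewrite /pair big_map. Qed.

(** Vectors are lists of terms, so a subspace must also be closed under passing to another list with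
    the same value under every functional. *)
Record subsp (S : Tens -> Prop) : Prop := Subsp {
  ss_nil : S [::];
  ss_lin : forall c v w, S v -> S w -> S (scaleT c v ++ w);
  ss_ext : forall v w, (forall f, pair f v = pair f w) -> S v -> S w }.

Section OneSubspace.
Variables (S0 : Tens -> Prop) (v0 : Tens) (H0 : subsp S0) (h0 : ~ S0 v0).

Definition adj (S : Tens -> Prop) (s : seq int) v := exists c, S (v ++ [:: (c, s)]).

Lemma adj_subsp S s : subsp S -> subsp (adj S s).
Proof.
move=> H; split.
- by exists 0; apply: (ss_ext H _ (ss_nil H)) => f; rewrite /= pair_cons pair_nil mul0r addr0.
- move=> c v w [a ha] [b hb]; exists (c * a + b); apply: (ss_ext H _ (ss_lin H c ha hb)) => f.
  rewrite !(pair_cat, pair_scale, pair_cons, pair_nil) /= !addr0.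
  by rewrite mulrDl mulrDr mulrA addrACA.
move=> v w e [c hc]; exists c; apply: (ss_ext H _ hc) => f.
by rewrite !pair_cat e.
Qed.

Lemma sub_adj S s v : subsp S -> S v -> adj S s v.
Proof.
move=> H hv; exists 0; apply: (ss_ext H _ hv) => f.
by rewrite pair_cat pair_cons pair_nil mul0r !addr0.
Qed.

(* Adjoin the words one after the other, each unless this would put [v0] in the span: modulo the
   union [top] every word is a multiple of [v0], and [sepf] reads off the factor. *)
Fixpoint tower n : Tens -> Prop :=
  if n is n'.+1 then fun v => tower n' v \/
    exists s, [/\ unpickle n' = Some s, ~ adj (tower n') s v0 & adj (tower n') s v]
  else S0.

Lemma towerP n : subsp (tower n) /\ ~ tower n v0.
Proof.
elim: n => [|n [IH hn]] //=.
split; last by case=> // [[s []]].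
have [[s [es hs]]|no] := classic (exists s, unpickle n = Some s /\ ~ adj (tower n) s v0).
- have A := adj_subsp s IH.
  have eqv v : (tower n v \/ exists s, [/\ unpickle n = Some s, ~ adj (tower n) s v0 & adj (tower n) s v])
    <-> adj (tower n) s v.
    split; last by move=> h; right; exists s.
    case; first exact: sub_adj.
    by case=> s' []; rewrite es => [] [<-].
  split=> [|c v w|v w e]; rewrite !eqv.
  + exact: (ss_nil A).
  + exact: (ss_lin A).
  exact: (ss_ext A).
have eqv v : (tower n v \/ exists s, [/\ unpickle n = Some s, ~ adj (tower n) s v0 & adj (tower n) s v])
    <-> tower n v.
  split; last by left.
  by case=> // [[s [h1 h2 h3]]]; case: no; exists s.
split=> [|c v w|v w e]; rewrite !eqv.
+ exact: (ss_nil IH).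
+ exact: (ss_lin IH).
exact: (ss_ext IH).
Qed.

Lemma tower_mono m n v : (m <= n)%N -> tower m v -> tower n v.
Proof.
move=> /subnK <-; elim: (n - m)%N => // k IH h; rewrite addSn /=.
by left; apply: IH.
Qed.

Definition top v := exists n, tower n v.

Lemma topP : subsp top.
Proof.
split; first by exists 0%N; exact: (ss_nil H0).
- move=> c v w [m hm] [n hn]; exists (m + n)%N; apply: (ss_lin (towerP _).1).
    by apply: tower_mono hm; apply: leq_addr.
  by apply: tower_mono hn; apply: leq_addl.
by move=> v w e [n hn]; exists n; apply: (ss_ext (towerP n).1 e).
Qed.

Lemma top_v0 : ~ top v0. Proof. by case=> n; exact: (towerP n).2. Qed.

Lemma top_scale c : top (scaleT c v0) -> c = 0.
Proof.
move=> h; apply/eqP; apply: contra_notT top_v0 => c0.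
have := ss_lin topP c^-1 h (ss_nil topP); apply: (ss_ext topP) => f.
by rewrite cats0 !pair_scale mulrA mulVf ?mul1r.
Qed.

(** Either s was adjoined at its own stage [pickle s], or adjoining it would have produced v0, which
    expresses s through v0 modulo that stage. *)
Lemma top_word s : exists c, top ((1, s) :: scaleT c v0).
Proof.
have [hn|hn] := classic (adj (tower (pickle s)) s v0).
- case: hn => c hc.
  have c0 : c != 0.
    apply/eqP => e; apply: top_v0; exists (pickle s); apply: (ss_ext (towerP _).1 _ hc) => f.
    by rewrite e pair_cat pair_cons pair_nil mul0r !addr0.
  exists c^-1; have := ss_lin topP c^-1 (ex_intro _ (pickle s) hc) (ss_nil topP).
  apply: (ss_ext topP) => f; rewrite cats0 !(pair_scale, pair_cat, pair_cons, pair_nil) /=.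
  by rewrite addr0 mulrDr mulrA mulVf // addrC.
exists 0; exists (pickle s).+1 => /=; right; exists s; split => //; first exact: pickleK.
exists (-1); apply: (ss_ext (towerP _).1 _ (ss_nil (towerP (pickle s)).1)) => f.
by rewrite !(pair_scale, pair_cat, pair_cons, pair_nil) /= mul0r !addr0 mulN1r mul1r subrr.
Qed.

Definition sepf (s : seq int) : Kf := - epsilon (inhabits 0) (fun c => top ((1, s) :: scaleT c v0)).

Lemma sepfP v : top (v ++ scaleT (- pair sepf v) v0).
Proof.
elim: v => [|p v IH].
  apply: (ss_ext topP _ (ss_nil topP)) => f.
  by rewrite pair_scale !pair_nil oppr0 mul0r.
have hs : top ((1, p.2) :: scaleT (- sepf p.2) v0).
  by rewrite /sepf opprK; apply: epsilon_spec (top_word p.2).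
apply: (ss_ext topP _ (ss_lin topP p.1 hs IH)) => f.
rewrite !(pair_scale, pair_cat, pair_cons, pair_nil) /=.
by rewrite mul1r mulrDr mulrA mulrN addrACA -mulrDl -opprD.
Qed.

Lemma sepf_S0 v : S0 v -> pair sepf v = 0.
Proof.
move=> hv; apply/eqP; rewrite -oppr_eq0; apply/eqP/top_scale.
have h1 : top v by exists 0%N.
apply: (ss_ext topP _ (ss_lin topP (-1) h1 (sepfP v))) => f.
by rewrite !(pair_cat, pair_scale) addrA mulN1r addNr add0r.
Qed.

Lemma sepf_v0 : pair sepf v0 = 1.
Proof.
apply/esym/eqP; rewrite -subr_eq0; apply/eqP/top_scale.
by apply: (ss_ext topP _ (sepfP v0)) => f; rewrite pair_cat !pair_scale mulrBl mul1r mulNr.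
Qed.

End OneSubspace.

Lemma separation S v : subsp S -> (forall f, (forall w, S w -> pair f w = 0) -> pair f v = 0) -> S v.
Proof.
move=> H hf; apply: NNPP => hv.
have := hf (sepf S v) (fun w => @sepf_S0 S v H hv w); rewrite (sepf_v0 H hv) => /eqP.
by rewrite oner_eq0.
Qed.

End Separation.

(** * Equality in the Fock space tested by functionals *)

Section FockEq.
Variables (N L : nat) (M : int).
Hypotheses (hN : (1 < N)%N) (hL : (1 < L)%N).

Lemma coef_pair v s : coefT v s = pair (fun u => (u == s)%:R) v.
Proof.
rewrite /coefT /pair big_mkcond; apply: eq_bigr => p _.
by case: eqP => _; rewrite ?mulr1 ?mulr0.
Qed.

Lemma pair_extTo f P v : pair f (extTo M P v) = pair (fun s => f (s ++ tailS M (size s) P)) v.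
Proof. exact: (pair_map f (fun s => s ++ tailS M (size s) P)). Qed.

Lemma pair_gens f (gs : seq gen) : pair f (flatten (map genT gs)) = \sum_(g <- gs) pair f (genT g).
Proof. by rewrite pair_flatten big_map. Qed.

Definition scaleg c g := Gen (c * gc g) (gpre g) (gk1 g) (gk2 g) (gr g) (gpost g).

Lemma in_rel_subsp : subsp (in_rel N L).
Proof.
split.
- by exists [::]; split.
- move=> c v w [gs [h1 e1]] [gs' [h2 e2]]; exists (map (scaleg c) gs ++ gs'); split.
    by elim: (gs) h1 => [|g' l IH] //= h1 g [<-|hg]; [exact: (h1 g' (or_introl erefl))|apply: IH => // g2 hg2; apply: h1; right].
  move=> s; rewrite !coef_pair map_cat flatten_cat !pair_cat pair_scale.
  rewrite -!coef_pair e1 e2 !coef_pair; congr (_ + _).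
  rewrite !pair_gens big_map mulr_sumr; apply: eq_bigr => g _.
  by rewrite /genT !pair_scale mulrA.
move=> v w e [gs [h1 e1]]; exists gs; split=> // s.
by rewrite -e1 !coef_pair e.
Qed.

(** Nullity is asked at all large lengths, so that two null combinations have a common length and
    their sum is null. *)
Definition fnull v := exists P0, forall P, (P0 <= P)%N -> in_rel N L (extTo M P v).

Lemma fnull_subsp : subsp fnull.
Proof.
have H := in_rel_subsp; split.
- by exists 0%N => P _; exact: (ss_nil H).
- move=> c v w [P1 h1] [P2 h2]; exists (P1 + P2)%N => P hP.
  have -> : extTo M P (scaleT c v ++ w) = scaleT c (extTo M P v) ++ extTo M P w.
    by rewrite /extTo /scaleT map_cat -!map_comp.
  by apply: (ss_lin H); [apply: h1|apply: h2]; lia.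
move=> v w e [P1 h1]; exists P1 => P hP; apply: (ss_ext H _ (h1 P hP)) => f.
by rewrite !pair_extTo e.
Qed.

Definition rgen pre k1 k2 post := Gen 1 pre k1 k2 (rcan N L (qq N) k1 k2) post.

Lemma pair_rgen f pre k1 k2 post : pair f (genT (rgen pre k1 k2 post)) =
  RR (qq N) N L (fun a b => f (pre ++ a :: b :: post)) k1 k2.
Proof.
rewrite /genT pair_scale mul1r /pair big_map.
by rewrite -(rcan_sum N L idfun (qq N) (fun a b => f (pre ++ a :: b :: post))).
Qed.

Lemma in_rel_rgen pre k1 k2 post : in_rel N L (genT (rgen pre k1 k2 post)).
Proof.
exists [:: rgen pre k1 k2 post]; split=> [g [<-|[]]|s]; first exact: rcan_T2rel.
by rewrite /= cats0.
Qed.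

Lemma fnull_rgen pre k1 k2 post : fnull (genT (rgen pre k1 k2 post)).
Proof.
exists 0%N => P _.
apply: (ss_ext in_rel_subsp _ (in_rel_rgen pre k1 k2 (post ++ tailS M (size (pre ++ k1 :: k2 :: post)) P))) => f.
rewrite pair_extTo !pair_rgen; congr RR; do 2 apply: functional_extensionality => ?.
by rewrite -catA /= !size_cat.
Qed.

Lemma fnull_tail s : fnull [:: (1, s ++ [:: M - (size s)%:Z]); (-1, s)].
Proof.
exists (size s).+1 => P hP; apply: (ss_ext in_rel_subsp _ (ss_nil in_rel_subsp)) => f.
rewrite pair_extTo !pair_cons !pair_nil /= mul1r mulN1r addr0 -catA /= size_cat addn1.
by rewrite -tailS_S // subrr.
Qed.

(** Two kinds of null vectors suffice: the expansions [rcan] in every context, and the differences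
    between a word and its extension by the next vacuum letter. *)
Lemma fnull_psi f : (forall v, fnull v -> pair f v = 0) -> inPsi (qq N) N L M f.
Proof.
move=> H; split.
  by move=> pre post k1 k2; rewrite -pair_rgen; apply: H; exact: fnull_rgen.
move=> s; have := H _ (fnull_tail s); rewrite !pair_cons pair_nil /= mul1r mulN1r addr0.
by move=> /eqP; rewrite subr_eq0 => /eqP.
Qed.

Lemma size_bound (v : Tens) : exists P, forall p, List.In p v -> (size p.2 <= P)%N.
Proof.
elim: v => [|p v [P IH]]; first by exists 0%N.
exists (size p.2 + P)%N => p' /= [<-|/IH h]; first exact: leq_addr.
exact: leq_trans h (leq_addl _ _).
Qed.

Lemma fock_eq_psi v w : (forall f, inPsi (qq N) N L M f -> pair f v = pair f w) -> fock_eq N L M v w.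
Proof.
move=> H; have [P0 h0] : fnull (subT v w).
  apply: (separation fnull_subsp) => f hf; rewrite pair_sub H ?subrr //.
  exact: fnull_psi.
have [P1 h1] := size_bound (v ++ w); exists (P0 + P1)%N; split.
  by move=> p /h1 h; apply: leq_trans h (leq_addl _ _).
have -> : subT (extTo M (P0 + P1) v) (extTo M (P0 + P1) w) = extTo M (P0 + P1) (subT v w).
  by rewrite /subT /extTo /scaleT map_cat -!map_comp.
by apply: h0; lia.
Qed.

End FockEq.

(** * The relations on the Fock space *)

Lemma qint2E (K : fieldType) (q : K) : q != 0 -> q - q^-1 != 0 -> (q ^+ 2 - q ^- 2) / (q - q^-1) = q + q^-1.
Proof.
move=> q0 h; apply: (mulIf h); rewrite divfK //; have -> : q ^- 2 = q^-1 ^+ 2 by rewrite exprVn.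
by ring.
Qed.

Lemma qint3E (K : fieldType) (q : K) : q != 0 -> q - q^-1 != 0 ->
  (q ^+ 3 - q ^- 3) / (q - q^-1) = q ^+ 2 + 1 + q ^- 2.
Proof.
move=> q0 h; apply: (mulIf h); rewrite divfK //.
have -> : q ^- 3 = q^-1 ^+ 3 by rewrite exprVn.
have -> : q ^- 2 = q^-1 ^+ 2 by rewrite exprVn.
have e : q * q^-1 = 1 by rewrite divff.
by move: q^-1 e => p e; rewrite -[1]e; ring.
Qed.

Lemma qdiff_neq0 (K : fieldType) (q : K) k : q != 0 -> q ^+ (k + k) != 1 -> q ^+ k - q ^- k != 0.
Proof.
move=> q0; apply: contra; rewrite subr_eq0 => /eqP e; rewrite exprD {2}e divff //.
exact: expf_neq0.
Qed.

(** Transposition reverses products, so the Serre expressions on functionals list their terms in the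
    opposite order. *)
Lemma alt1 (K : fieldType) (a b : K) : b - a = 0 -> a - b = 0.
Proof. by move=> h; rewrite -opprB h oppr0. Qed.
Lemma alt2 (K : fieldType) (x a b c : K) : c - x * b + a = 0 -> a - x * b + c = 0.
Proof. by move=> <-; ring. Qed.
Lemma alt3 (K : fieldType) (x a b c d : K) :
  d - x * c + x * b - a = 0 -> a - x * b + x * c - d = 0.
Proof. by move=> h; rewrite -[RHS]oppr0 -h; ring. Qed.

(** * Quantum binomials of order at most 3 *)

Section QBinomial.
Variable q : Kf.
Hypotheses (q0 : q != 0) (hq : forall k, (0 < k)%N -> q ^+ k != 1).

Let qd : q - q^-1 != 0. Proof. by have := @qdiff_neq0 _ q 1 q0 (hq (isT : 0 < 2)%N). Qed.

Lemma qint1 : qint q 1 = 1. Proof. by rewrite /qint !expr1 divff. Qed.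
Lemma qint_neq0 k : (0 < k)%N -> qint q k != 0.
Proof.
move=> hk; apply: mulf_neq0; last by rewrite invr_eq0.
by apply: (qdiff_neq0 q0); apply: hq; rewrite addn_gt0 hk.
Qed.
Lemma qfact_neq0 k : qfact q k != 0.
Proof.
rewrite /qfact prodf_seq_neq0; apply/allP => j; rewrite mem_index_iota => /andP [h _] /=.
exact: qint_neq0.
Qed.
Lemma qfactS k : qfact q k.+1 = qfact q k * qint q k.+1.
Proof. by rewrite /qfact big_nat_recr. Qed.
Lemma qfact0 : qfact q 0 = 1. Proof. by rewrite /qfact big_geq. Qed.
Lemma qbinom0 k : qbinom q k 0 = 1.
Proof. by rewrite /qbinom subn0 qfact0 mul1r (divff (qfact_neq0 k)). Qed.
Lemma qbinomn k : qbinom q k k = 1.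
Proof. by rewrite /qbinom subnn qfact0 mulr1 (divff (qfact_neq0 k)). Qed.
Lemma qbinom1 k : qbinom q k.+1 1 = qint q k.+1.
Proof. by rewrite /qbinom subn1 /= !qfactS qfact0 qint1 !mul1r mulrAC (divff (qfact_neq0 k)) mul1r. Qed.
Lemma qbinom32 : qbinom q 3 2 = qint q 3.
Proof. by rewrite -qbinom1 /qbinom [X in _ / X = _]mulrC. Qed.

Lemma serre_sum1 (T : nat -> Kf) : \sum_(k <- iota 0 2) (-1) ^+ k * qbinom q 1 k * T k = T 0%N - T 1%N.
Proof. by rewrite /= !big_cons big_nil qbinom0 qbinomn expr0 expr1 !mul1r mulr1 mulN1r addr0. Qed.
Lemma serre_sum2 (T : nat -> Kf) : \sum_(k <- iota 0 3) (-1) ^+ k * qbinom q 2 k * T k =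
  T 0%N - (q + q^-1) * T 1%N + T 2%N.
Proof.
rewrite /= !big_cons big_nil qbinom0 qbinomn qbinom1 /qint (qint2E q0 qd) expr0 expr1 sqrrN expr1n.
by rewrite !mul1r mulN1r mulNr addr0 addrA.
Qed.
Lemma serre_sum3 (T : nat -> Kf) : \sum_(k <- iota 0 4) (-1) ^+ k * qbinom q 3 k * T k =
  T 0%N - (q ^+ 2 + 1 + q ^- 2) * T 1%N + (q ^+ 2 + 1 + q ^- 2) * T 2%N - T 3%N.
Proof.
rewrite /= !big_cons big_nil qbinom0 qbinomn qbinom32 qbinom1 /qint (qint3E q0 qd) expr0 expr1 sqrrN expr1n.
have -> : (-1) ^+ 3 = -1 :> Kf by rewrite exprS sqrrN expr1n mulr1.
by rewrite !mul1r !mulN1r mulNr addr0 !addrA.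
Qed.

End QBinomial.

Section QuantumAffine.
Variables (N L : nat) (M : int).
Hypotheses (hN : (1 < N)%N) (hL : (1 < L)%N).
Local Notation q := (qq N).
Hypotheses (q0 : q != 0) (q2 : 1 + q ^+ 2 != 0) (hq : forall k, (0 < k)%N -> q ^+ k != 1).
Local Notation inPsi := (inPsi q N L).
Local Notation feq := (fock_eq N L M).

(* [Y] is the transpose of [X] on the functionals of charge [M]. *)
Definition transp (X : op) (Y : (seq int -> Kf) -> seq int -> Kf) :=
  forall f x, inPsi M f -> pair f (X x) = pair (Y f) x.
Definition stable (Y : (seq int -> Kf) -> seq int -> Kf) := forall f, inPsi M f -> inPsi M (Y f).

Lemma transp_iter X Y k : stable Y -> transp X Y -> transp (iter k X) (iter k Y).
Proof.
move=> hY hX; elim: k => [|k IH] f x hf //.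
by rewrite iterS hX // IH ?iterSr //; exact: hY.
Qed.

Lemma stable_iter Y k : stable Y -> stable (iter k Y).
Proof. by move=> hY f hf; elim: k => //= k IH; apply: hY. Qed.

Section OneSide.
Variables (S : side) (HS : sideP q N L S).
Local Notation n := (sn S).
Local Notation XE := (XE q N L S M).
Local Notation XF := (XF q N L S M).
Local Notation KH := (KH q N L S M).
Local Notation cart := (cart S).
Variables (E F K Ki : nat -> op) (D : op).

Record bridge : Prop := Bridge {
  br_E : forall i, (i < n)%N -> transp (E i) (XE i);
  br_F : forall i, (i < n)%N -> transp (F i) (XF i);
  br_K : forall i, (i < n)%N -> transp (K i) (fun f s => KH i s * f s);
  br_Ki : forall i, (i < n)%N -> transp (Ki i) (fun f s => (KH i s)^-1 * f s);
  br_D : transp D (Dmul N L M) }.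

Hypothesis HB : bridge.

Lemma st_E i : (i < n)%N -> stable (XE i). Proof. by move=> hi f hf; apply: XE_psi. Qed.
Lemma st_F i : (i < n)%N -> stable (XF i). Proof. by move=> hi f hf; apply: XF_psi. Qed.
Lemma st_K i : (i < n)%N -> stable (fun f s => KH i s * f s).
Proof. by move=> hi f hf; apply: psi_KH. Qed.
Lemma st_Ki i : (i < n)%N -> stable (fun f s => (KH i s)^-1 * f s).
Proof. by move=> hi f hf; apply: psi_KHV. Qed.
Lemma st_D : stable (Dmul N L M). Proof. by move=> f hf; apply: (DH_psi hN hL q0 q2). Qed.

Lemma cartan_cart i j : (i < n)%N -> (j < n)%N -> cartan n i j = cart i j.
Proof.
move=> hi hj; have n1 := s_n HS; rewrite /cartan /cart.
have e1 : eqmod n%:Z i%:Z j%:Z = (i == j) by rewrite eqmod_nat ?modn_small //; lia.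
have e2 : eqmod n%:Z i%:Z (j%:Z + 1) = (i == nx n j).
  have -> : j%:Z + 1 = j.+1%:Z by lia.
  by rewrite eqmod_nat ?(modn_small hi) //; lia.
have e3 : eqmod n%:Z i%:Z (j%:Z - 1) = (j == nx n i).
  have -> : eqmod n%:Z i%:Z (j%:Z - 1) = eqmod n%:Z i.+1%:Z j%:Z.
    by rewrite /eqmod; congr (_ == 0); congr (_ %% _)%Z; lia.
  by rewrite eqmod_nat ?(modn_small hj) 1?eq_sym //; lia.
by rewrite e1 e2 e3.
Qed.

Lemma pairD f g x : pair (fun s => f s + g s) x = pair f x + pair g x.
Proof. by rewrite /pair -big_split; apply: eq_bigr => p _; rewrite mulrDr. Qed.
Lemma pairZ c f x : pair (fun s => c * f s) x = c * pair f x.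
Proof. by rewrite /pair mulr_sumr; apply: eq_bigr => p _; rewrite mulrCA. Qed.
Lemma pair0 f x : (forall s, f s = 0) -> pair f x = 0.
Proof. by move=> h; rewrite /pair big1 // => p _; rewrite h mulr0. Qed.

Lemma serre_pair (X Y : op) (X' Y' : (seq int -> Kf) -> seq int -> Kf) m f x :
  stable X' -> stable Y' -> transp X X' -> transp Y Y' -> inPsi M f ->
  pair f (serre q m X Y x) =
  pair (fun s => \sum_(k <- iota 0 m.+1) (-1) ^+ k * qbinom q m k * iter k X' (Y' (iter (m - k) X' f)) s) x.
Proof.
move=> sX sY tX tY hf; rewrite /serre pair_flatten big_map.
elim: (iota 0 m.+1) => [|k l IH]; first by rewrite big_nil pair0 // => s; rewrite big_nil.
rewrite big_cons IH pair_scale (transp_iter (m - k) sX tX) // tY; last by apply: stable_iter.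
rewrite (transp_iter k sX tX); last by apply: sY; apply: stable_iter.
by rewrite -pairZ -pairD; apply: eq_pair => s; rewrite big_cons.
Qed.


Lemma serre_rel (X : nat -> op) (X' : nat -> letop Kf) i j x : (i < n)%N -> (j < n)%N -> i != j ->
  (forall k, (k < n)%N -> stable (lX (X' k) M)) -> (forall k, (k < n)%N -> transp (X k) (lX (X' k) M)) ->
  (forall f s, inPsi M f -> serreG q (X' i) (X' j) (cart i j) M f s = 0) ->
  feq (serre q (absz (1 - cartan n i j)) (X i) (X j) x) [::].
Proof.
move=> hi hj hij sX tX H; apply: (fock_eq_psi hN hL) => f hf.
rewrite (serre_pair _ _ (sX i hi) (sX j hj) (tX i hi) (tX j hj) hf) pair_nil pair0 // => s.
have := H f s hf; rewrite (cartan_cart hi hj) /serreG.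
case/or3P: (cart_cases hN hL q0 q2 hi hj hij) => /eqP ->; rewrite /=.
- by rewrite (serre_sum1 q0 hq) => /alt1.
- by rewrite (serre_sum2 q0 hq) => /alt2.
by rewrite (serre_sum3 q0 hq) => /alt3.
Qed.

Lemma Uq_rel : Uq_relations feq n q E F K Ki D.
Proof.
have tE := br_E HB; have tF := br_F HB; have tK := br_K HB; have tKi := br_Ki HB; have tD := br_D HB.
have A := fock_eq_psi (M := M) hN hL.
split; last split; last split; last split; last split; last split.
- move=> i j hi hj x; split; apply: A => f hf; rewrite ?tK ?tKi ?tK ?tKi //;
    try (by [apply: st_K | apply: st_Ki]); apply: eq_pair => s; exact: mulrCA.
- move=> i hi x; split; apply: A => f hf; rewrite ?tK ?tKi ?tD ?tK ?tKi //;
    try (by [apply: st_K | apply: st_Ki | apply: st_D]); apply: eq_pair => s; exact: mulrCA.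
- move=> i hi x; have k0 s := KH_neq0 hN hL q0 q2 S M i s; split; apply: A => f hf.
    rewrite tK // tKi //; last exact: st_K.
    by apply: eq_pair => s; exact: (mulKf (k0 s)).
  rewrite tKi // tK //; last exact: st_Ki.
  by apply: eq_pair => s; exact: (mulVKf (k0 s)).
- move=> i j hi hj x; split; apply: A => f hf; rewrite pair_scale (cartan_cart hi hj) tK //.
    rewrite tE //; last exact: st_K.
    rewrite tE // tK //; last exact: st_E.
    by rewrite -pairZ; apply: eq_pair => s; rewrite (XE_KH hN hL q0 q2 HS) // mulrA.
  rewrite tF //; last exact: st_K.
  rewrite tF // tK //; last exact: st_F.
  by rewrite -pairZ; apply: eq_pair => s; rewrite (XF_KH hN hL q0 q2 HS) // mulrA.
- move=> i hi x; split; apply: A => f hf; rewrite pair_scale pair_sub tD //.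
    rewrite (tE i hi (Dmul N L M f)); last exact: st_D.
    rewrite !(tE i hi f) // tD; last exact: st_E.
    rewrite -[- pair _ _]mulN1r -!pairZ -pairD; apply: eq_pair => s; rewrite (XE_D hN hL q0 q2 HS) //.
    by rewrite /Dmul rmorphD /= mulrDl mulN1r addrAC subrr add0r.
  rewrite (tF i hi (Dmul N L M f)); last exact: st_D.
  rewrite !(tF i hi f) // tD; last exact: st_F.
  rewrite -[- pair _ _]mulN1r -!pairZ -pairD; apply: eq_pair => s; rewrite (XF_D hN hL q0 q2 HS) //.
  by rewrite /Dmul rmorphB /= mulrBl mulN1r addrAC subrr add0r mulNr.
- move=> i j hi hj x; apply: A => f hf; rewrite pair_scale !pair_sub tE // tF //; last exact: st_E.
  rewrite tF // tE //; last exact: st_F.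
  rewrite tK // tKi // -[- pair (fun s => (KH i s)^-1 * _) _]mulN1r -[- pair (XE _ _) _]mulN1r -!pairZ -!pairD -pairZ.
  apply: eq_pair => s; have := EF_rel hN hL q0 q2 hq HS s hi hj hf.
  rewrite /REF /cEF => /eqP; rewrite subr_eq0 !mulN1r => /eqP ->.
  rewrite -mulrA mulrBl; congr (_ / _ * _).
  by case: (i == j).
move=> i j hi hj /eqP hij x; split.
  apply: (serre_rel (X := E) (X' := LE q N L S) _ hi hj hij st_E tE).
  by move=> f s hf; apply: serreE.
apply: (serre_rel (X := F) (X' := LF q N L S) _ hi hj hij st_F tF).
by move=> f s hf; apply: serreF.
Qed.

(** The exponents of the finitely many words of x are added up. *)
Lemma loc_nil (X : op) (Y : (seq int -> Kf) -> seq int -> Kf) x : stable Y -> transp X Y ->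
  (forall s, exists k, forall f, inPsi M f -> iter k Y f s = 0) -> exists k, feq (iter k X x) [::].
Proof.
move=> sY tX H.
have [k Hk] : exists k, forall f, inPsi M f -> forall p, List.In p x -> iter k Y f p.2 = 0.
  elim: x => [|p x [k IH]]; first by exists 0%N.
  have [k' Hk'] := H p.2; exists (k + k')%N => f hf p' [<-|hp].
    by rewrite addnC iterD Hk' //; apply: stable_iter.
  by rewrite iterD IH //; apply: stable_iter.
exists k; apply: (fock_eq_psi hN hL) => f hf; rewrite (transp_iter k sY tX) // pair_nil.
elim: x Hk => [|p x IH] Hk; first by rewrite pair_nil.
rewrite pair_cons IH; last by move=> g hg p' hp; apply: Hk => //; right.
by rewrite Hk ?mulr0 ?addr0 //; left.
Qed.

Lemma Uq_int : integrable feq n q E F K D.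
Proof.
have tE := br_E HB; have tF := br_F HB; have tK := br_K HB; have tD := br_D HB.
split=> [i hi x|x].
  split; first by apply: (loc_nil x (st_E hi) (tE i hi)) => s; apply: (nilE hN hL q0 q2 HS).
  by apply: (loc_nil x (st_F hi) (tF i hi)) => s; apply: (nilF hN hL q0 q2 HS).
(* Every single word is a weight vector, so splitting x into its terms is a weight decomposition. *)
exists [seq [:: p] | p <- x]; split; last first.
  by apply: (fock_eq_psi hN hL) => f hf; rewrite flatten_map1 map_id.
move=> y; elim: x => [|p x IH] //= [<-|hy]; last exact: IH.
pose w := ext N L M (mch M p.2) p.2.
exists (fun i => (sl S)%:Z * ind (i == 0%N)
  + ((count (fun z => scl S z == i) w)%:Z - (count (fun z => scl S z == nx n i) w)%:Z)).
exists (DH N L M p.2)%:~R; split=> [i hi|]; apply: (fock_eq_psi hN hL) => f hf.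
  rewrite tK // pair_scale !pair_cons !pair_nil !addr0 mulrCA; congr (_ * _).
  by rewrite /KH /lam (pr_kk hN hL q0 q2) -/w -expfzDr.
by rewrite tD // pair_scale !pair_cons !pair_nil !addr0 mulrCA.
Qed.

End OneSide.

Lemma comm_feq (X Y : op) X' Y' x : stable X' -> stable Y' -> transp X X' -> transp Y Y' ->
  (forall f, inPsi M f -> Y' (X' f) =1 X' (Y' f)) -> feq (X (Y x)) (Y (X x)).
Proof.
move=> sX sY tX tY H; apply: (fock_eq_psi hN hL) => f hf; rewrite tX // tY; last exact: sX.
by rewrite tY // tX; [apply: eq_pair; exact: H|exact: sY].
Qed.

Section Cross.
Variables (S S' : side) (HS : sideP q N L S) (HS' : sideP q N L S') (HC : crossP S S').
Variables (E F K Ki : nat -> op) (D : op) (E' F' K' Ki' : nat -> op) (D' : op).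
Hypotheses (HB : bridge S E F K Ki D) (HB' : bridge S' E' F' K' Ki' D').

Lemma cross_feq i a X Y x : (i < sn S)%N -> (a < sn S')%N ->
  List.In X [:: E i; F i; K i; Ki i] -> List.In Y [:: E' a; F' a; K' a; Ki' a] -> feq (X (Y x)) (Y (X x)).
Proof.
move=> hi ha; have HC' := crossP_sym HC.
have tE := br_E HB hi; have tF := br_F HB hi; have tK := br_K HB hi; have tKi := br_Ki HB hi.
have uE := br_E HB' ha; have uF := br_F HB' ha; have uK := br_K HB' ha; have uKi := br_Ki HB' ha.
have sE := st_E HS hi; have sF := st_F HS hi; have sK := st_K HS hi; have sKi := st_Ki HS hi.
have rE := st_E HS' ha; have rF := st_F HS' ha; have rK := st_K HS' ha; have rKi := st_Ki HS' ha.
case=> [<-|[<-|[<-|[<-|[]]]]]; case=> [<-|[<-|[<-|[<-|[]]]]].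
- apply: (comm_feq x sE rE tE uE) => f hf s; apply/esym/eqP; rewrite -subr_eq0; apply/eqP.
  exact: (cross_EE hN hL q0 q2 HS HS' HC s hi ha hf).
- apply: (comm_feq x sE rF tE uF) => f hf s; apply/eqP; rewrite -subr_eq0; apply/eqP.
  exact: (cross_FE hN hL q0 q2 hq HS' HS HC' s ha hi hf).
- apply: (comm_feq x sE rK tE uK) => f hf s.
  exact: (esym (congr1 (fun g => g s) (XE_crossKH hN hL q0 q2 HS' HC' M i f ha))).
- apply: (comm_feq x sE rKi tE uKi) => f hf s.
  exact: (esym (congr1 (fun g => g s) (crossKHV hN hL q0 q2 (fun g => XE_crossKH hN hL q0 q2 HS' HC' M i g ha) f))).
- apply: (comm_feq x sF rE tF uE) => f hf s; apply/esym/eqP; rewrite -subr_eq0; apply/eqP.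
  exact: (cross_FE hN hL q0 q2 hq HS HS' HC s hi ha hf).
- apply: (comm_feq x sF rF tF uF) => f hf s; apply/esym/eqP; rewrite -subr_eq0; apply/eqP.
  exact: (cross_FF hN hL q0 q2 hq s HS HS' HC hi ha hf).
- apply: (comm_feq x sF rK tF uK) => f hf s.
  exact: (esym (congr1 (fun g => g s) (XF_crossKH hN hL q0 q2 HS' HS HC' M i f ha))).
- apply: (comm_feq x sF rKi tF uKi) => f hf s.
  exact: (esym (congr1 (fun g => g s) (crossKHV hN hL q0 q2 (fun g => XF_crossKH hN hL q0 q2 HS' HS HC' M i g ha) f))).
- apply: (comm_feq x sK rE tK uE) => f hf s.
  exact: (congr1 (fun g => g s) (XE_crossKH hN hL q0 q2 HS HC M a f hi)).
- apply: (comm_feq x sK rF tK uF) => f hf s.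
  exact: (congr1 (fun g => g s) (XF_crossKH hN hL q0 q2 HS HS' HC M a f hi)).
- by apply: (comm_feq x sK rK tK uK) => f hf s; exact: mulrCA.
- by apply: (comm_feq x sK rKi tK uKi) => f hf s; exact: mulrCA.
- apply: (comm_feq x sKi rE tKi uE) => f hf s.
  exact: (congr1 (fun g => g s) (crossKHV hN hL q0 q2 (fun g => XE_crossKH hN hL q0 q2 HS HC M a g hi) f)).
- apply: (comm_feq x sKi rF tKi uF) => f hf s.
  exact: (congr1 (fun g => g s) (crossKHV hN hL q0 q2 (fun g => XF_crossKH hN hL q0 q2 HS HS' HC M a g hi) f)).
- by apply: (comm_feq x sKi rK tKi uK) => f hf s; exact: mulrCA.
- by apply: (comm_feq x sKi rKi tKi uKi) => f hf s; exact: mulrCA.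
Qed.

End Cross.
End QuantumAffine.

Lemma qq_expE N k : qq N ^+ k = tK 'X^(2 * N * k).
Proof. by rewrite /qq -exprM /tK -rmorphXn. Qed.

Lemma qq_neq0 N : qq N != 0.
Proof. by rewrite /qq expf_neq0 // /tK tofrac_eq0 polyX_eq0. Qed.

Lemma qq_exp_neq1 N k : (0 < N)%N -> (0 < k)%N -> qq N ^+ k != 1.
Proof.
move=> hN hk; rewrite qq_expE /tK -tofrac1 tofrac_eq; apply/eqP => /(congr1 (fun p : {poly rat} => size p)).
by rewrite size_polyXn size_poly1 => -[] /eqP; rewrite !muln_eq0; lia.
Qed.

(** q^2 = -1 would give q^4 = 1. *)
Lemma qq_sum_neq0 N : (0 < N)%N -> 1 + qq N ^+ 2 != 0.
Proof.
move=> hN; apply/eqP => h; have := qq_exp_neq1 hN (isT : (0 < 4)%N).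
rewrite (_ : 4 = 2 * 2)%N // exprM; move/eqP: h; rewrite addr_eq0 => /eqP h.
by rewrite -[qq N ^+ 2]opprK -h sqrrN expr1n eqxx.
Qed.

Lemma two_neq0 : (2 : Kf) != 0.
Proof.
have -> : (2 : Kf) = FracField.tofrac (2%:R : {poly rat}) by rewrite rmorph_nat.
by rewrite tofrac_eq0 -polyC_natr polyC_eq0.
Qed.

(** * The Fock space operators as transposes *)

Section Bridges.
Variables (N L : nat) (M : int).
Hypotheses (hN : (1 < N)%N) (hL : (1 < L)%N).
Local Notation q := (qq N).
Let q0 := qq_neq0 N.
Let q2 : 1 + q ^+ 2 != 0. Proof. by apply: qq_sum_neq0; apply: ltnW. Qed.
Local Notation inPsi := (inPsi q N L).

Lemma pair_copAct x1 cl cr g t l r f w : (forall x, x1 x = if g x then Some (t x) else None) ->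
  cl =1 l -> (forall w, cr w = pr r w) -> pair f (copAct x1 cl cr w) = cop g t l r w f.
Proof.
move=> e1 e2 e3; elim: w f => [|x w IH] f; first by rewrite pair_nil.
rewrite /= pair_cat pair_scale e1 e2 e3 /consT (pair_map f (cons x)) -IH; congr (_ + _).
by case: ifP => _; rewrite ?pair_nil // pair_cons pair_nil addr0.
Qed.

Lemma transp_linop (F : seq int -> Tens) (Y : (seq int -> Kf) -> seq int -> Kf) :
  (forall f s, inPsi M f -> pair f (F s) = Y f s) -> transp N L M (linop F) Y.
Proof. by move=> H f x hf; rewrite pair_linop; apply: eq_pair => s; rewrite H. Qed.

Lemma pair_one f c s : pair f [:: (c, s)] = c * f s.
Proof. by rewrite pair_cons pair_nil addr0. Qed.

(** The form in which F_i is defined on v /\ |-NLm>: one summand acts on v, the other on the first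
    vacuum block, which contributes only for i = 0. *)
Lemma XF_split S i f w : sideP q N L S -> (i < sn S)%N -> inPsi M f ->
  XF q N L S M i f w = muF q S i * (copF q S i (vof N L M w) f
   + (if i == 0%N then pr (lF q S i) (vof N L M w)
        * copF q S i (vbar N L (mch M w)) (fun u => f (vof N L M w ++ u)) else 0)).
Proof.
move=> HS hi hf; rewrite /XF -/(vof N L M w) /copF cop_cat; congr (_ * (_ + _)); last first.
  case: ifP => // /negbT i0; rewrite -/(copF _ _ _ _ _) (copF_vac hN hL q0 q2 HS) ?mulr0 //.
  exact: hf.1.
have -> : pr (rF q S i) (vbar N L (mch M w)) = 1.
  rewrite pr_rF (pr_kk_vbar hN hL q0 q2 HS) //; case: (ss S) => //; exact: invr1.
have hsz : (size (vof N L M w))%:Z = M + (N * L * mch M w)%:Z.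
  exact: (ext_size (ok_mch hN hL q0 q2 M w)).
rewrite mul1r -[RHS]mul1r; apply: cop_scale => u x v e _; rewrite mul1r (stab_vbar hf.2) //.
by rewrite (size_upd u v _ x) -e.
Qed.

(** The division by 2 in the field is undone by 2 C(m, 2) = m (m - 1), which makes the degree an
    integer. *)
Lemma Dvac_int m : Dvac N L m = (- (N * L * 'C(m, 2))%:Z)%:~R.
Proof.
have h2 := two_neq0; apply: (mulIf h2); rewrite /Dvac divfK //.
have -> : (2 : Kf) = 2%:Z%:~R by [].
rewrite -[(N * L)%:R]/((N * L)%:Z%:~R) -!rmorphM /=; congr (_%:~R).
have := mul_bin_diag m 1; rewrite bin1; case: m => [|m] /= h; lia.
Qed.

Lemma bridge_D : transp N L M (opD N L M) (Dmul N L M).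
Proof.
apply: transp_linop => f s hf; rewrite /fD pair_one /Dmul.
rewrite (stab_ext _ _ _ _ hf.2 : f (vof N L M s) = f s); congr (_ * _).
rewrite Dvac_int /Dt -rmorphD /= /DH /bsum; congr (_%:~R); congr (_ - _).
by apply: eq_bigr => x _; rewrite kundE.
Qed.

Lemma Kt_pr i w : (i < N)%N -> Kt N i w = pr (kk q (sideN N L) i) w.
Proof. by move=> hi; apply: eq_bigr => x _; rewrite wtKE. Qed.
Lemma Kdt_pr i w : (i < L)%N -> Kdt N L i w = pr (kk q (sideL N L) i) w.
Proof. by move=> hi; apply: eq_bigr => x _; rewrite wtKdE. Qed.

Lemma bridgeN : bridge N L M (sideN N L) (opE N L M) (opF N L M) (opK N L M) (opKi N L M) (opD N L M).
Proof.
have HS := sideNP hN hL q0 q2; split=> [i hi|i hi|i hi|i hi|]; last exact: bridge_D.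
all: rewrite /= in hi; apply: transp_linop => f s hf.
- rewrite /fE pair_scale; congr (_ * _); apply: pair_copAct => // [x|v].
    by rewrite E1E.
  exact: Kt_pr.
- have EF w g : pair g (Ft N L i w) = copF q (sideN N L) i w g.
    apply: pair_copAct => // [x|x|v]; first by rewrite F1E.
      by rewrite /lF /= /kk /kw wtKE // invr_expz.
    by rewrite /rF /= pr_one.
  rewrite (XF_split _ HS) // /fF pair_cat EF mul1r; congr (_ + _).
  case: (eqVneq i 0%N) => i0; last by rewrite pair_nil.
  rewrite pair_scale /prependT (pair_map f (cat (vof N L M s))) Kt_pr //.
  rewrite -i0 EF /lF /= pr_inv //.
- rewrite /fK pair_one (stab_ext _ _ _ _ hf.2 : f (vof N L M s) = f s) Kt_pr //.
  by congr (_ * _); rewrite mulrC.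
- rewrite /fKi pair_one (stab_ext _ _ _ _ hf.2 : f (vof N L M s) = f s) Kt_pr //.
  by rewrite /KH invfM /lam invr_expz; congr (_ * _); rewrite mulrC.
Qed.

Lemma bridgeL : bridge N L M (sideL N L) (opEd N L M) (opFd N L M) (opKd N L M) (opKdi N L M) (opDd N L M).
Proof.
have HS := sideLP hN hL q0 q2; split=> [i hi|i hi|i hi|i hi|]; last exact: bridge_D.
all: rewrite /= in hi; apply: transp_linop => f s hf.
- rewrite /fEd /XE mul1r; apply: pair_copAct => // [x|x|v]; first by rewrite Ed1E.
    by rewrite /lE /= /kk /kw wtKdE.
  by rewrite /rE /= pr_one.
- have EF w g : pair g (Fdt N L i w) = copF q (sideL N L) i w g.
    apply: pair_copAct => // [x|v]; first by rewrite Fd1E.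
    by rewrite Kdt_pr // /rF /= pr_inv.
  rewrite (XF_split _ HS) // /fFd pair_cat pair_scale EF mulrDr; congr (_ + _).
    by rewrite /muF /= /lam invr_expz.
  case: (eqVneq i 0%N) => i0; last by rewrite pair_nil mulr0.
  rewrite /prependT (pair_map f (cat (vof N L M s))) pair_scale -i0 EF /lF /= pr_one mul1r.
  by rewrite /muF /= /lam invr_expz i0 mulr1.
- rewrite /fKd pair_one (stab_ext _ _ _ _ hf.2 : f (vof N L M s) = f s) Kdt_pr //.
  by congr (_ * _); rewrite mulrC.
- rewrite /fKdi pair_one (stab_ext _ _ _ _ hf.2 : f (vof N L M s) = f s) Kdt_pr //.
  by rewrite /KH invfM /lam invr_expz; congr (_ * _); rewrite mulrC.
Qed.

End Bridges.

Theorem mainTheorem4 (N L : nat) (M : int) :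
  (2 <= N)%N -> (2 <= L)%N ->
  (* (i) U_q(sl^_N)-module structure on F_M, integrable *)
  Uq_relations (fock_eq N L M) N (qq N)
    (opE N L M) (opF N L M) (opK N L M) (opKi N L M) (opD N L M)
  /\ integrable (fock_eq N L M) N (qq N)
       (opE N L M) (opF N L M) (opK N L M) (opD N L M)
  (* (i) U_q(sl^_L)-module structure on F_M, integrable *)
  /\ Uq_relations (fock_eq N L M) L (qq N)
       (opEd N L M) (opFd N L M) (opKd N L M) (opKdi N L M) (opDd N L M)
  /\ integrable (fock_eq N L M) L (qq N)
       (opEd N L M) (opFd N L M) (opKd N L M) (opDd N L M)
  (* (ii) the actions of U'_q(sl^_N) and U'_q(sl^_L) commute *)
  /\ (forall i a, (i < N)%N -> (a < L)%N ->
      forall X Y : op,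
        Stdlib.Lists.List.In X [:: opE N L M i; opF N L M i; opK N L M i; opKi N L M i] ->
        Stdlib.Lists.List.In Y [:: opEd N L M a; opFd N L M a; opKd N L M a; opKdi N L M a] ->
        forall x : Tens, fock_eq N L M (X (Y x)) (Y (X x))).
Proof.
move=> hN hL; have q0 := qq_neq0 N; have q2 := qq_sum_neq0 (ltnW hN).
have hq k : (0 < k)%N -> qq N ^+ k != 1 by apply: qq_exp_neq1; apply: ltnW.
have SN := sideNP hN hL q0 q2; have SL := sideLP hN hL q0 q2.
have BN := bridgeN M hN hL; have BL := bridgeL M hN hL.
split; first exact: (Uq_rel hN hL q0 q2 hq SN BN).
split; first exact: (Uq_int hN hL q0 q2 SN BN).
split; first exact: (Uq_rel hN hL q0 q2 hq SL BL).
split; first exact: (Uq_int hN hL q0 q2 SL BL).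
move=> i a hi ha X Y hX hY x.
exact: (cross_feq hN hL q0 q2 hq SN SL (crossNL hN hL) BN BL x hi ha hX hY).
Qed.
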